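(* Let $K_a$ be the Kasteleyn matrix of the double Aztec diamond of size $n$ and overlap $\rho=n-2m$ (rows indexed by $\mathtt B_{AD}$, columns by $\mathtt W_{AD}$). The entries of the inverse Kasteleyn matrix are given, for $\mathtt w=(w_1,w_2)\in\mathtt W_{AD}$ and $\mathtt b=(b_1,b_2)\in\mathtt B_{AD}$, by $$K_a^{-1}(\mathtt w,\mathtt b)=-(-1)^{(w_1-w_2+b_1-b_2+2)/4}\;\mathbb K_{n,\rho}\Big(b_2+1,\tfrac{b_2-b_1+2m+1}{2};\,w_2+1,\tfrac{w_2-w_1+2m+1}{2}\Big).$$
   Context: **Graph.** $n\ge 1$, $1\le\rho\le n$ are integers with $n-\rho=2m$ even, and $a>0$. White vertices ($x_1$ odd, $x_2$ even): $\mathtt W_{AD}=\{(x_1,x_2): 1\le x_1\le 2(2m+n)+1,\ 0\le x_2\le 2(n-1)\}\cup\{(x_1,2n):1\le x_1\le 2n-1\}$. Black vertices ($x_1$ even, $x_2$ odd): $\mathtt B_{AD}=\{(x_1,x_2):0\le x_1\le 2(2m+n),\ 1\le x_2\le 2n-1\}\cup\{(x_1,-1): 2(2m+1)\le x_1\le 2(2m+n)\}$. **Kasteleyn matrix.** With $e_1=(1,1)$, $e_2=(-1,1)$, $\alpha(1)=1$, $\alpha(2)=-a\mathrm i$, for $\mathtt b=(b_1,b_2)\in\mathtt B_{AD}$, $\mathtt w\in\mathtt W_{AD}$, $r\in\{1,2\}$: $$K_a(\mathtt b,\mathtt w)=\begin{cases}(-1)^{-(b_1+b_2+1)/2}\alpha(r)&\mathtt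 w=\mathtt b+e_r\\(-1)^{-(b_1+b_2-1)/2}\alpha(r)&\mathtt w=\mathtt b-e_r\\0&\text{otherwise.}\end{cases}$$ Fractional powers: $(-1)^x=e^{\mathrm i\pi x}$. **Kernel $\mathbb K_{n,\rho}$.** $\Gamma_{0,a}$ is a positively oriented simple closed contour enclosing $0$ and $a$ but not $-1/a$; in a double integral with $u\in\Gamma_{0,a}$, $v\in\Gamma_{0,a,u}$ the $v$-contour encloses $0,a$ and the whole $u$-contour, but not $-1/a$. For integers $r,s,x,y$ and $\varepsilon_1,\varepsilon_2\in\{0,1\}$, $$\mathbb K_{n,\rho}(2r+\varepsilon_1,x;2s+\varepsilon_2,y)=-\mathbb 1_{2s+\varepsilon_2<2r+\varepsilon_1}\psi_{2r+\varepsilon_1,2s+\varepsilon_2}(x,y)+(-1)^{x-y}S(2r+\varepsilon_1,x;2s+\varepsilon_2,y)$$ $$\qquad-(-1)^{x-y}\big\langle\big((I-K_n)^{-1}_{\ge 2m+1}a_{-y,2s+\varepsilon_2}\big)(k),\,b_{-x,2r+\varepsilon_1}(k)\big\rangle_{\ge 2m+1},$$ $$\psi_{2r+\varepsilon_1,2s+\varepsilon_2}(x,y)=\oint_{\Gamma_{0,a}}\frac{dz}{2\pi\mathrm i z}z^{x-y}\frac{(1+az)^{s-r}}{(1-\frac az)^{s-r+\varepsilon_2-\varepsilon_1}},$$ $$S(2r+\varepsilon_1,x;2s+\varepsilon_2,y)=\frac{(-1)^{x-y}}{(2\pi\mathrm i)^2}\oint_{\Gamma_{0,a}}du\oint_{\Gamma_{0,a,u}}\frac{dv}{v-u}\frac{v^{x-m-1}}{u^{y-m}}\frac{(1+au)^s(1-\frac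 au)^{n-s+1-\varepsilon_2}}{(1+av)^r(1-\frac av)^{n-r+1-\varepsilon_1}},$$ $$a_{x,2s+\varepsilon}(k)=\frac{(-1)^{k-x}}{(2\pi\mathrm i)^2}\oint_{\Gamma_{0,a}}du\oint_{\Gamma_{0,a,u}}\frac{dv}{u-v}\frac{v^{x+m}}{u^{k+1}}\frac{(1+av)^s(1-\frac av)^{n-s+1-\varepsilon}}{(1+au)^n(1-\frac au)^{n+1}},$$ $$b_{y,2r+\varepsilon}(k)=\frac{(-1)^{k-y}}{(2\pi\mathrm i)^2}\oint_{\Gamma_{0,a}}du\oint_{\Gamma_{0,a,u}}\frac{dv}{v-u}\frac{v^k}{u^{y+m+1}}\frac{(1+av)^n(1-\frac av)^{n+1}}{(1+au)^r(1-\frac au)^{n-r+1-\varepsilon}},$$ $$K_n(j,k)=\frac{(-1)^{j+k}}{(2\pi\mathrm i)^2}\oint_{\Gamma_{0,a}}dw\oint_{\Gamma_{0,a,w}}\frac{dz}{z-w}\frac{z^{n-j}(1+aw)^n(w-a)^{n+1}}{w^{n+1-k}(1+az)^n(z-a)^{n+1}}.$$ Here $\langle f(k),g(k)\rangle_{\ge\alpha}=\sum_{k\ge\alpha}f(k)g(k)$ and $(I-K_n)^{-1}_{\ge\alpha}$ is the inverse of $I-K_n$ with the matrix $K_n(j,k)$ restricted to $j,k\ge\alpha$ (note $K_n(j,k)=0$ for $k>n$). *)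

(* Defs.v *)
From HB Require Import structures.
From mathcomp Require Import all_boot all_order all_algebra.
From mathcomp Require Import all_classical all_reals all_analysis.
From mathcomp Require Import complex.

Set Implicit Arguments.
Unset Strict Implicit.
Unset Printing Implicit Defensive.

Import Order.TTheory GRing.Theory Num.Theory.
Import numFieldNormedType.Exports.

Local Open Scope classical_set_scope.
Local Open Scope ring_scope.

(* (-1)^x = e^{i pi x} *)
Definition m1pow (R : realType) (x : R) : R[i] :=
  (cos (pi * x) +i* sin (pi * x))%C.

Definition two_pi_i (R : realType) : R[i] := (0 +i* (2 * pi))%C.

Definition C1_on (R : realType) (x y : R) (f : R -> R) : Prop :=
  derivable_oo_LRcontinuous f x y /\
  exists2 f' : R -> R,
    {within `[x, y], continuous f'} & {in `]x, y[, derive1 f =1 f'}.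

(* [itv_partition 0 1 s] : the breakpoints of [0, 1] are 0 :: s, and the last
   one is 1. *)
Definition piecewise_C1 (R : realType) (g : R -> R[i]) : Prop :=
  exists2 s : seq R, itv_partition 0 1 s &
    forall k, (k < size s)%N ->
      C1_on (nth 0 (0 :: s) k) (nth 0 s k) (fun t => complex.Re (g t)) /\
      C1_on (nth 0 (0 :: s) k) (nth 0 s k) (fun t => complex.Im (g t)).

Definition simple_closed_contour (R : realType) (g : R -> R[i]) : Prop :=
  [/\ piecewise_C1 g, g 0 = g 1 & {in `[0, 1[ &, injective g}].

(* \int_0^1 f (g t) g'(t) dt; g' is meaningful off the breakpoints of g. *)
Definition contour_integral (R : realType) (g : R -> R[i]) (f : R[i] -> R[i])
    : R[i] :=
  let g' t := (derive1 (fun s => complex.Re (g s)) t +i*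
               derive1 (fun s => complex.Im (g s)) t)%C in
  ((\int[lebesgue_measure]_(t in `[0, 1]) complex.Re (f (g t) * g' t)) +i*
   (\int[lebesgue_measure]_(t in `[0, 1]) complex.Im (f (g t) * g' t)))%C.

Definition winding_number (R : realType) (g : R -> R[i]) (p : R[i]) : R[i] :=
  (two_pi_i R)^-1 * contour_integral g (fun z => (z - p)^-1).

(* For a simple closed contour the winding number about a point off the curve
   is 1 (resp. -1) inside if the orientation is positive (resp. negative) and
   0 outside; so [encloses] also fixes the positive orientation. *)
Definition encloses (R : realType) (g : R -> R[i]) (p : R[i]) : Prop :=
  ~ (g @` `[0, 1]) p /\ winding_number g p = 1.

Definition does_not_enclose (R : realType) (g : R -> R[i]) (p : R[i]) : Prop :=
  ~ (g @` `[0, 1]) p /\ winding_number g p = 0.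

(* g may serve as \Gamma_{0,a} *)
Definition is_Gamma0 (R : realType) (a : R) (g : R -> R[i]) : Prop :=
  [/\ simple_closed_contour g, encloses g 0, encloses g (a%:C)%C &
      does_not_enclose g ((- a^-1)%:C)%C].

(* g' may serve as \Gamma_{0,a,u} for u on g *)
Definition is_Gamma0u (R : realType) (a : R) (g g' : R -> R[i]) : Prop :=
  is_Gamma0 a g' /\ forall t, t \in `[0, 1] -> encloses g' (g t).

(* (2 pi i)^{-2} \oint_g du \oint_{g'} dv F(u,v) *)
Definition double_integral (R : realType) (g g' : R -> R[i])
    (F : R[i] -> R[i] -> R[i]) : R[i] :=
  (two_pi_i R) ^- 2 *
  contour_integral g (fun u => contour_integral g' (fun v => F u v)).

Definition vertex : Type := (int * int)%type.

Definition even_int (x : int) : bool := (2 %| x)%Z.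

Definition white_AD (n m : nat) : set vertex :=
  [set x | ~~ even_int x.1 /\ even_int x.2 /\
     ((1 <= x.1 <= 2 * (2 * m%:Z + n%:Z) + 1 /\ 0 <= x.2 <= 2 * (n%:Z - 1)) \/
      (1 <= x.1 <= 2 * n%:Z - 1 /\ x.2 = 2 * n%:Z))].

Definition black_AD (n m : nat) : set vertex :=
  [set x | even_int x.1 /\ ~~ even_int x.2 /\
     ((0 <= x.1 <= 2 * (2 * m%:Z + n%:Z) /\ 1 <= x.2 <= 2 * n%:Z - 1) \/
      (2 * (2 * m%:Z + 1) <= x.1 <= 2 * (2 * m%:Z + n%:Z) /\ x.2 = -1))].

Definition e1 : vertex := (1, 1).
Definition e2 : vertex := (-1, 1).

Definition alpha1 (R : realType) : R[i] := 1.
Definition alpha2 (R : realType) (a : R) : R[i] := (0 -i* a)%C.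

Definition Kasteleyn (R : realType) (a : R) (b w : vertex) : R[i] :=
  if w == b + e1 then m1pow (- ((b.1 + b.2 + 1)%:~R / 2)) * alpha1 R
  else if w == b + e2 then m1pow (- ((b.1 + b.2 + 1)%:~R / 2)) * alpha2 a
  else if w == b - e1 then m1pow (- ((b.1 + b.2 - 1)%:~R / 2)) * alpha1 R
  else if w == b - e2 then m1pow (- ((b.1 + b.2 - 1)%:~R / 2)) * alpha2 a
  else 0.

(* L (columns B, rows W) is the two-sided inverse of K (rows B, columns W). *)
Definition is_inverse_matrix (R : realType) (B W : set vertex)
    (K L : vertex -> vertex -> R[i]) : Prop :=
  (forall b b', B b -> B b' -> \sum_(w \in W) K b w * L w b' = (b == b')%:R) /\
  (forall w w', W w -> W w' -> \sum_(b \in B) L w b * K b w' = (w == w')%:R).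

Definition inner_ge (R : realType) (al : nat) (f g : nat -> R[i]) : R[i] :=
  limn (fun N => \sum_(al <= k < N) (f k * g k) : R[i]^o).

Definition mulmx_ge (R : realType) (al : nat) (A B : nat -> nat -> R[i])
    (j k : nat) : R[i] :=
  inner_ge al (A j) (fun l => B l k).

Definition id_sub (R : realType) (K : nat -> nat -> R[i]) (j k : nat) : R[i] :=
  (j == k)%:R - K j k.

Definition is_inverse_ge (R : realType) (al : nat) (A L : nat -> nat -> R[i])
    : Prop :=
  forall j k, (al <= j)%N -> (al <= k)%N ->
    mulmx_ge al A L j k = (j == k)%:R /\ mulmx_ge al L A j k = (j == k)%:R.

(* Only the entries with both indices >= al are meaningful; the value is
   arbitrary if no inverse exists. *)
Definition inverse_ge (R : realType) (al : nat) (A : nat -> nat -> R[i])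
    : nat -> nat -> R[i] :=
  xget (fun _ _ => 0) [set L | is_inverse_ge al A L].

Section Kernel.
Local Open Scope complex_scope.

Definition psi_kernel (R : realType) (a : R) (g : R -> R[i])
    (r ep1 s ep2 x y : int) : R[i] :=
  contour_integral g (fun z =>
    (two_pi_i R * z)^-1 * z ^ (x - y) *
    ((1 + a%:C * z) ^ (s - r) / (1 - a%:C / z) ^ (s - r + ep2 - ep1))).

Definition S_kernel (R : realType) (n m : nat) (a : R) (g g' : R -> R[i])
    (r ep1 x s ep2 y : int) : R[i] :=
  (-1) ^ (x - y) * double_integral g g' (fun u v =>
    (v - u)^-1 * (v ^ (x - m%:Z - 1) / u ^ (y - m%:Z)) *
    (((1 + a%:C * u) ^ s * (1 - a%:C / u) ^ (n%:Z - s + 1 - ep2)) /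
     ((1 + a%:C * v) ^ r * (1 - a%:C / v) ^ (n%:Z - r + 1 - ep1)))).

Definition a_vec (R : realType) (n m : nat) (a : R) (g g' : R -> R[i])
    (x s ep : int) (k : nat) : R[i] :=
  (-1) ^ (k%:Z - x) * double_integral g g' (fun u v =>
    (u - v)^-1 * (v ^ (x + m%:Z) / u ^ (k%:Z + 1)) *
    (((1 + a%:C * v) ^ s * (1 - a%:C / v) ^ (n%:Z - s + 1 - ep)) /
     ((1 + a%:C * u) ^ n%:Z * (1 - a%:C / u) ^ (n%:Z + 1)))).

Definition b_vec (R : realType) (n m : nat) (a : R) (g g' : R -> R[i])
    (y r ep : int) (k : nat) : R[i] :=
  (-1) ^ (k%:Z - y) * double_integral g g' (fun u v =>
    (v - u)^-1 * (v ^ k%:Z / u ^ (y + m%:Z + 1)) *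
    (((1 + a%:C * v) ^ n%:Z * (1 - a%:C / v) ^ (n%:Z + 1)) /
     ((1 + a%:C * u) ^ r * (1 - a%:C / u) ^ (n%:Z - r + 1 - ep)))).

Definition K_op (R : realType) (n : nat) (a : R) (g g' : R -> R[i])
    (j k : nat) : R[i] :=
  (-1) ^ (j%:Z + k%:Z) * double_integral g g' (fun w z =>
    (z - w)^-1 *
    ((z ^ (n%:Z - j%:Z) * (1 + a%:C * w) ^ n%:Z * (w - a%:C) ^ (n%:Z + 1)) /
     (w ^ (n%:Z + 1 - k%:Z) * (1 + a%:C * z) ^ n%:Z *
        (z - a%:C) ^ (n%:Z + 1)))).

(* The first and third arguments p = 2r + ep1 and q = 2s + ep2 (ep1, ep2 in
   {0,1}) are decoded by Euclidean division by 2. *)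
Definition KK (R : realType) (n m : nat) (a : R) (g g' : R -> R[i])
    (p x q y : int) : R[i] :=
  let r := (p %/ 2)%Z in let ep1 := (p %% 2)%Z in
  let s := (q %/ 2)%Z in let ep2 := (q %% 2)%Z in
  let al := (2 * m + 1)%N in
  let IK := inverse_ge al (id_sub (K_op n a g g')) in
  - ((q < p)%R%:R * psi_kernel a g r ep1 s ep2 x y)
  + (-1) ^ (x - y) * S_kernel n m a g g' r ep1 x s ep2 y
  - (-1) ^ (x - y) *
    inner_ge al (fun k => inner_ge al (IK k) (a_vec n m a g g' (- y) s ep2))
                (b_vec n m a g g' (- x) r ep1).

End Kernel.

(* Main.v *)
Require Import Defs.
From HB Require Import structures.
From mathcomp Require Import all_boot all_order all_algebra.
From mathcomp Require Import all_classical all_reals all_analysis.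
From mathcomp Require Import measurable_realfun complex polyrcf polyorder cauchyreals.
From mathcomp Require Import ring lra zify.

Set Implicit Arguments.
Unset Strict Implicit.
Unset Printing Implicit Defensive.

Import Order.TTheory GRing.Theory Num.Theory.
Import numFieldNormedType.Exports.

Local Open Scope classical_set_scope.
Local Open Scope ring_scope.

(** Write a white vertex as w = (2i+1, 2s) and a black one as b = (2j,
    2r-1). Up to powers of the imaginary unit, the row of the Kasteleyn
    matrix at b sends Y to Y(j,r) - a Y(j-1,r) - Y(j-1,r-1) - a Y(j,r-1),
    and the functions phi_{i,s}(z) = z^(i-n) (1+az)^s (z-a)^(n-s) satisfy
    this four-term relation identically in z. The kernel depends on w only
    through phi_{i,s}, and linearly; so away from the boundary it is
    annihilated by the Kasteleyn matrix, apart from a delta produced by the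
    indicator of s < r. What has to be understood is the boundary, and this
    is what the correction by the inverse of I - K_n is for.

    Every integrand is rational with poles among 0, a and -1/a. Let rho be
    the sum of the residues at 0 and a, that is (2 pi i)^-1 times the
    contour integral. A rational F of this kind splits as F_reg + F_pol,
    where F_reg has no pole at 0 and a, and F_pol has no pole at -1/a and
    vanishes at infinity. The nested double integral of F(u) G(v) / (v-u) is
    the bilinear form D(F,G) = rho(F G_reg), and all that is used of it is
    D(F,G) + D(G,F) = rho(F G) (pairing_sym), D(F,G) = 0 for regular F
    (reg_pairing) and for G = G_pol (pairing_pol). The contours are
    arbitrary piecewise C^1 curves, so the residue calculus is not taken
    from Cauchy's theorem: powers (z-p)^k with k <> -1 have a primitive,
    1/(z-p) gives the winding number, and partial fractions do the rest
    (residue_ratf).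

    Put psi(z) = (1+az)^n (1-a/z)^(n+1), e_k = z^k psi and f_l = z^(-l-1) /
    psi, so that rho(f_l e_k) is a Kronecker delta. Then K_n(l,k) =
    (-1)^(l+k) D(e_k, f_l), and the kernel equals -[s<r] rho(phi beta) +
    D(phi,beta) + sum_k c_k D(beta,e_k), where c is the solution of c_l -
    sum_k D(e_k,f_l) c_k = D(f_l,phi) for l and k at least N = 2m+1
    (KK_value). At the boundary the solution is explicit. On the missing
    column i = -1, phi vanishes at infinity, so c = 0 and all terms cancel
    (kernel_entry_left). On the missing part of the row s = n, phi is a
    polynomial with D(f_l,phi) = 0, so again c = 0 (kernel_entry_top). At a
    black vertex with r = 0 only phi_{j,0} - a phi_{j-1,0} = z^j
    (1-a/z)^(n+1) occurs; it is the infinite combination of the e_k whose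
    coefficients are those of the power series z^j / (1+az)^n, and these
    coefficients are the solution c (kernel_entry_bottom).

    The inverse of I - K_n exists for the following reason. As K_n(j,k) = 0
    for k > n, only the block of indices between N and n matters. A null
    vector of this block yields polynomials y, U, C with deg y <= n-N, deg U
    < N and y + z^(n-N+1) U (1+az)^n = (z-a)^(n+1) C. Substituting z =
    (1+at)/(t-a) and differentiating n times turns this into F^(n) = -h
    (t-a)^N with deg h <= n-N, where F vanishes to order n at 0 and to order
    n-N+1 at -1/a. Integrating (1+at)^(N-1) h F^(n) by parts n times over
    [-1/a, 0] gives zero, while the integrand is h^2 times a function of
    constant sign; hence h = 0 and then y = 0 (mixed_root_vanish).

    These facts give a right inverse of the Kasteleyn matrix
    (right_inverse). It is two-sided because there are as many black
    vertices as white ones. *)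

(** * Integrals of complex functions along piecewise smooth curves *)

Section ComplexValuedIntegral.
Variable R : realType.
Implicit Types (h k : R -> R[i]) (x y t : R) (c d : R[i]).
Local Notation mu := (@lebesgue_measure R).
Local Notation Re := (@complex.Re R).
Local Notation Im := (@complex.Im R).

Lemma eq_complexP c d : Re c = Re d -> Im c = Im d -> c = d.
Proof. by case: c; case: d => ? ? ? ? /= -> ->. Qed.

Lemma ReD c d : Re (c + d) = Re c + Re d. Proof. by case: c; case: d. Qed.

Lemma ImD c d : Im (c + d) = Im c + Im d. Proof. by case: c; case: d. Qed.

Lemma ReM c d : Re (c * d) = Re c * Re d - Im c * Im d.
Proof. by case: c; case: d. Qed.

Lemma ImM c d : Im (c * d) = Re c * Im d + Im c * Re d.
Proof. by case: c; case: d. Qed.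

Lemma ReV c : Re c^-1 = Re c / (Re c ^+ 2 + Im c ^+ 2). Proof. by case: c. Qed.

Lemma ImV c : Im c^-1 = - (Im c / (Re c ^+ 2 + Im c ^+ 2)).
Proof. by case: c. Qed.

Lemma normsq_neq0 c : c != 0 -> Re c ^+ 2 + Im c ^+ 2 != 0.
Proof.
case: c => a b; rewrite eq_complex /= paddr_eq0 ?sqr_ge0 //.
by rewrite !sqrf_eq0.
Qed.

Lemma within_contD x y (f g : R -> R) :
  {within `[x, y], continuous f} -> {within `[x, y], continuous g} ->
  {within `[x, y], continuous (fun t => f t + g t)}.
Proof. by move=> cf cg t; apply: cvgD; [exact: cf|exact: cg]. Qed.

Lemma within_contN x y (f : R -> R) : {within `[x, y], continuous f} ->
  {within `[x, y], continuous (fun t => - f t)}.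
Proof. by move=> cf t; apply: cvgN; exact: cf. Qed.

Lemma within_contM x y (f g : R -> R) :
  {within `[x, y], continuous f} -> {within `[x, y], continuous g} ->
  {within `[x, y], continuous (fun t => f t * g t)}.
Proof. by move=> cf cg t; apply: cvgM; [exact: cf|exact: cg]. Qed.

Lemma within_contV x y (f : R -> R) : (forall t, f t != 0) ->
  {within `[x, y], continuous f} ->
  {within `[x, y], continuous (fun t => (f t)^-1)}.
Proof. by move=> f0 cf t; apply: cvgV; [exact: f0|exact: cf]. Qed.

(** Continuity is expressed on real and imaginary parts, because the
    integrals of complex functions are defined that way too. *)
Definition ccont x y h : Prop :=
  {within `[x, y], continuous (fun t => Re (h t))} /\
  {within `[x, y], continuous (fun t => Im (h t))}.

Lemma ccontC x y c : ccont x y (fun=> c).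
Proof. by split=> t; exact: cvg_cst. Qed.

Lemma ccontD x y h k : ccont x y h -> ccont x y k -> ccont x y (fun t => h t + k t).
Proof.
move=> [h1 h2] [k1 k2]; split.
  rewrite (_ : (fun _ => _) = (fun t => Re (h t) + Re (k t))).
    exact: within_contD.
  by apply/funext => t; rewrite ReD.
rewrite (_ : (fun _ => _) = (fun t => Im (h t) + Im (k t))).
  exact: within_contD.
by apply/funext => t; rewrite ImD.
Qed.

Lemma ccontM x y h k : ccont x y h -> ccont x y k -> ccont x y (fun t => h t * k t).
Proof.
move=> [h1 h2] [k1 k2]; split.
  rewrite (_ : (fun _ => _) = (fun t => Re (h t) * Re (k t) - Im (h t) * Im (k t))).
    by apply: within_contD; [|apply: within_contN]; exact: within_contM.
  by apply/funext => t; rewrite ReM.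
rewrite (_ : (fun _ => _) = (fun t => Re (h t) * Im (k t) + Im (h t) * Re (k t))).
  by apply: within_contD; exact: within_contM.
by apply/funext => t; rewrite ImM.
Qed.

Lemma eq_ccont x y h k : {in `[x, y], h =1 k} -> ccont x y h -> ccont x y k.
Proof.
move=> hk [h1 h2].
have E (p : R[i] -> R) : {in `[x, y]%classic, (fun t => p (h t)) =1 (fun t => p (k t))}.
  by move=> t; rewrite inE /= => tI; rewrite hk.
split.
- exact: (subspace_eq_continuous (E Re)) h1.
- exact: (subspace_eq_continuous (E Im)) h2.
Qed.

Lemma ccontV x y h : {in `[x, y], forall t, h t != 0} -> ccont x y h ->
  ccont x y (fun t => (h t)^-1).
Proof.
move=> h0 ch; pose k t := if t \in `[x, y] then h t else 1.
have k0 t : k t != 0 by rewrite /k; case: ifP => [/h0//|_]; rewrite oner_eq0.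
have [k1 k2] : ccont x y k by apply: eq_ccont ch => t tI; rewrite /k tI.
suff: ccont x y (fun t => (k t)^-1).
  by apply: eq_ccont => t tI; rewrite /k tI.
have cn : {within `[x, y], continuous (fun t => (Re (k t) ^+ 2 + Im (k t) ^+ 2)^-1)}.
  apply: within_contV => [t|]; first exact: normsq_neq0.
  by apply: within_contD; exact: within_contM.
split.
  rewrite (_ : (fun _ => _) =
      (fun t => Re (k t) * (Re (k t) ^+ 2 + Im (k t) ^+ 2)^-1)).
    exact: within_contM.
  by apply/funext => t; rewrite ReV.
rewrite (_ : (fun _ => _) =
    (fun t => - (Im (k t) * (Re (k t) ^+ 2 + Im (k t) ^+ 2)^-1))).
  by apply: within_contN; exact: within_contM.
by apply/funext => t; rewrite ImV.
Qed.

Lemma ccontX x y h n : ccont x y h -> ccont x y (fun t => h t ^+ n).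
Proof.
move=> ch; elim: n => [|n IH]; first exact: ccontC.
apply: eq_ccont (ccontM ch IH) => t _; exact/esym/exprS.
Qed.

Definition cderiv h t d : Prop :=
  is_derive t (1 : R) (fun u => Re (h u)) (Re d) /\
  is_derive t (1 : R) (fun u => Im (h u)) (Im d).

Lemma cderiv_eq h t d c : cderiv h t d -> d = c -> cderiv h t c.
Proof. by move=> + <-. Qed.

Lemma cderivC t c : cderiv (fun=> c) t 0.
Proof. by split; exact: is_derive_cst. Qed.

Lemma cderivD h k t c d : cderiv h t c -> cderiv k t d ->
  cderiv (fun u => h u + k u) t (c + d).
Proof.
move=> [h1 h2] [k1 k2]; split.
  rewrite (_ : (fun _ => _) = (fun t => Re (h t)) + (fun t => Re (k t))).
    by rewrite ReD; exact: is_deriveD.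
  by apply/funext => u; rewrite ReD.
rewrite (_ : (fun _ => _) = (fun t => Im (h t)) + (fun t => Im (k t))).
  by rewrite ImD; exact: is_deriveD.
by apply/funext => u; rewrite ImD.
Qed.

Lemma cderivM h k t c d : cderiv h t c -> cderiv k t d ->
  cderiv (fun u => h u * k u) t (c * k t + h t * d).
Proof.
move=> [h1 h2] [k1 k2]; split.
  rewrite (_ : (fun _ => _) = (fun t => Re (h t)) * (fun t => Re (k t)) -
      (fun t => Im (h t)) * (fun t => Im (k t))).
    apply: is_derive_eq; rewrite ReD !ReM /GRing.scale /=; ring.
  by apply/funext => u; rewrite ReM.
rewrite (_ : (fun _ => _) = (fun t => Re (h t)) * (fun t => Im (k t)) +
    (fun t => Im (h t)) * (fun t => Re (k t))).
  apply: is_derive_eq; rewrite ImD !ImM /GRing.scale /=; ring.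
by apply/funext => u; rewrite ImM.
Qed.

Lemma cderivV h t c : h t != 0 -> cderiv h t c ->
  cderiv (fun u => (h u)^-1) t (- (c * (h t)^-1 ^+ 2)).
Proof.
move=> h0 [h1 h2]; have n0 := normsq_neq0 h0.
set N : R -> R := (fun u => Re (h u)) * (fun u => Re (h u)) +
                  (fun u => Im (h u)) * (fun u => Im (h u)).
have NE u : N u = Re (h u) ^+ 2 + Im (h u) ^+ 2 by rewrite !expr2.
have dN : is_derive t (1 : R) (fun u => (N u)^-1)
    (- N t ^- 2 *: (2 * Re (h t) * Re c + 2 * Im (h t) * Im c)).
  apply: is_deriveV; first by rewrite NE.
  by apply: is_derive_eq; rewrite /GRing.scale /=; ring.
split.
  rewrite (_ : (fun _ => _) = (fun u => Re (h u)) * (fun u => (N u)^-1)).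
    apply: is_derive_eq.
    rewrite /= NE /GRing.scale /= expr2; case: (h t) n0 => p q /=.
    by case: c {h1 h2 dN} => a b /= n0; field.
  by apply/funext => u; rewrite ReV -NE.
rewrite (_ : (fun _ => _) = - ((fun u => Im (h u)) * (fun u => (N u)^-1))).
  apply: is_derive_eq.
  rewrite /= NE /GRing.scale /= expr2; case: (h t) n0 => p q /=.
  by case: c {h1 h2 dN} => a b /= n0; field.
by apply/funext => u; rewrite ImV -NE.
Qed.

Lemma cderivX h t c n : cderiv h t c ->
  cderiv (fun u => h u ^+ n.+1) t (n.+1%:R * h t ^+ n * c).
Proof.
move=> dh; elim: n => [|n IH].
  by rewrite mulr1 mul1r (_ : (fun _ => _) = h).
rewrite (_ : (fun _ => _) = (fun u => h u * h u ^+ n.+1)); last first.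
  by apply/funext => u; rewrite exprS.
apply: cderiv_eq (cderivM dh IH) _.
by rewrite [n.+2%:R]mulrS !exprS; ring.
Qed.

(** The end points of an interval are negligible, so nothing needs to be
    known there; this is what makes the value of the derivative of a curve
    at its break points irrelevant. *)
Lemma integrable_eq_oo x y (f g : R -> R) :
  {in `]x, y[, f =1 g} -> mu.-integrable `[x, y] (EFin \o g) ->
  mu.-integrable `[x, y] (EFin \o f) /\
  \int[mu]_(t in `[x, y]) f t = \int[mu]_(t in `[x, y]) g t.
Proof.
move=> fg ig.
have fgE : {in `]x, y[%classic, f =1 g} by move=> t; rewrite inE /= => /fg.
have mg : measurable_fun `[x, y] g.
  by apply/measurable_EFinP; exact: measurable_int ig.
have mgo : measurable_fun `]x, y[ g.
  by apply: measurable_funS mg => //; exact: subset_itv_oo_cc.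
have mfo : measurable_fun `]x, y[ f.
  by apply: eq_measurable_fun mgo => t tI; rewrite fgE.
have mf : measurable_fun `[x, y] f by exact: measurable_fun_itv_cc mfo.
move/measurable_EFinP in mgo; move/measurable_EFinP in mfo.
move/measurable_EFinP in mf.
split; last first.
  rewrite /Rintegral (integral_itv_bndoo _ _ mfo) (integral_itv_bndoo _ _ mgo).
  congr fine; apply: eq_integral => t tI; by rewrite /= fgE.
apply/integrableP; split => //.
rewrite integral_itv_bndoo; last by apply: measurableT_comp.
have /integrableP[_] := ig.
rewrite integral_itv_bndoo; last by apply: measurableT_comp.
by congr (_ < _)%E; apply: eq_integral => t tI; rewrite /= fgE.
Qed.

Lemma integrable_cat x y z (f : R -> R) : x <= y -> y <= z ->
  mu.-integrable `[x, y] (EFin \o f) -> mu.-integrable `[y, z] (EFin \o f) ->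
  mu.-integrable `[x, z] (EFin \o f) /\
  \int[mu]_(t in `[x, z]) f t =
    \int[mu]_(t in `[x, y]) f t + \int[mu]_(t in `[y, z]) f t.
Proof.
move=> xy yz ixy iyz.
(* The pieces are made disjoint by removing y from the second one. *)
have iyz' : mu.-integrable `]y, z] (EFin \o f).
  by apply: integrableS iyz => //; apply: subset_itvr; rewrite bnd_simp.
have E : `[x, z]%classic = `[x, y] `|` `]y, z].
  by rewrite -itv_bndbnd_setU // bnd_simp.
have ixz : mu.-integrable `[x, z] (EFin \o f).
  rewrite E; move: ixy iyz' => /integrableP[m1 i1] /integrableP[m2 i2].
  apply/integrableP; split; first exact/measurable_funU.
  rewrite ge0_integral_setU //.
  - exact: lte_add_pinfty.
  - by apply: measurableT_comp => //; exact/measurable_funU.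
  - apply/disj_setPS => t [/=]; rewrite 2!in_itv/= => /andP[_ ty] /andP[].
    by rewrite ltNge ty.
split => //; rewrite -(Rintegral_itv_obnd_cbnd iyz').
by rewrite -(Rintegral_itvB ixz) ?bnd_simp // addrC subrK.
Qed.

Definition cintegrable x y h : Prop :=
  mu.-integrable `[x, y] (EFin \o (fun t => Re (h t))) /\
  mu.-integrable `[x, y] (EFin \o (fun t => Im (h t))).

Definition cintegral x y h : R[i] :=
  ((\int[mu]_(t in `[x, y]) Re (h t)) +i* (\int[mu]_(t in `[x, y]) Im (h t)))%C.

Lemma cintegrable_ccont x y h : ccont x y h -> cintegrable x y h.
Proof.
by move=> [h1 h2]; split; apply: continuous_compact_integrable => //;
  exact: segment_compact.
Qed.

(** The integrand along a curve involves its derivative, which agrees with a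
    continuous function only inside each smooth piece. *)
Lemma cintegral_eq_oo x y h k : {in `]x, y[, h =1 k} -> cintegrable x y k ->
  cintegrable x y h /\ cintegral x y h = cintegral x y k.
Proof.
move=> hk [k1 k2].
have [|h1 e1] := @integrable_eq_oo x y (fun t => Re (h t)) _ _ k1.
  by move=> t tI /=; rewrite hk.
have [|h2 e2] := @integrable_eq_oo x y (fun t => Im (h t)) _ _ k2.
  by move=> t tI /=; rewrite hk.
by split; [split | rewrite /cintegral e1 e2].
Qed.

Lemma cintegral_cat x y z h : x <= y -> y <= z ->
  cintegrable x y h -> cintegrable y z h ->
  cintegrable x z h /\ cintegral x z h = cintegral x y h + cintegral y z h.
Proof.
move=> xy yz [h1 h2] [k1 k2].
have [i1 e1] := integrable_cat xy yz h1 k1.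
have [i2 e2] := integrable_cat xy yz h2 k2.
by split; [split | rewrite /cintegral e1 e2].
Qed.

Lemma EFin_integrableD x y (f g : R -> R) :
  mu.-integrable `[x, y] (EFin \o f) -> mu.-integrable `[x, y] (EFin \o g) ->
  mu.-integrable `[x, y] (EFin \o (fun t => f t + g t)).
Proof. by move=> fi gi; exact: (integrableD _ fi gi). Qed.

Lemma EFin_integrableZ x y (r : R) (f : R -> R) :
  mu.-integrable `[x, y] (EFin \o f) ->
  mu.-integrable `[x, y] (EFin \o (fun t => r * f t)).
Proof. by move=> fi; exact: (integrableZl _ r fi). Qed.

Lemma cintegrableD x y h k : cintegrable x y h -> cintegrable x y k ->
  cintegrable x y (fun t => h t + k t) /\
  cintegral x y (fun t => h t + k t) = cintegral x y h + cintegral x y k.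
Proof.
move=> [h1 h2] [k1 k2].
have eR : (fun t => Re (h t + k t)) = (fun t => Re (h t) + Re (k t)).
  by apply/funext => t; rewrite ReD.
have eI : (fun t => Im (h t + k t)) = (fun t => Im (h t) + Im (k t)).
  by apply/funext => t; rewrite ImD.
split.
  by split; rewrite ?eR ?eI; exact: EFin_integrableD.
by rewrite /cintegral eR eI !RintegralD.
Qed.

Lemma cintegrableZ x y c h : cintegrable x y h ->
  cintegrable x y (fun t => c * h t) /\
  cintegral x y (fun t => c * h t) = c * cintegral x y h.
Proof.
move=> [h1 h2].
have eR : (fun t => Re (c * h t)) = (fun t => Re c * Re (h t) + - Im c * Im (h t)).
  by apply/funext => t; rewrite ReM mulNr.
have eI : (fun t => Im (c * h t)) = (fun t => Re c * Im (h t) + Im c * Re (h t)).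
  by apply/funext => t; rewrite ImM.
split.
  by split; rewrite ?eR ?eI; apply: EFin_integrableD; exact: EFin_integrableZ.
apply: eq_complexP; rewrite ?ReM ?ImM /= ?eR ?eI.
  rewrite RintegralD //; try exact: EFin_integrableZ.
  by rewrite !RintegralZl // mulNr.
rewrite RintegralD //; try exact: EFin_integrableZ.
by rewrite !RintegralZl.
Qed.

Lemma cintegral_FTC x y (H h : R -> R[i]) : x < y -> ccont x y H -> ccont x y h ->
  {in `]x, y[, forall t, cderiv H t (h t)} ->
  cintegral x y h = H y - H x.
Proof.
move=> xy [H1 H2] [h1 h2] dH.
have ftc (f F : R -> R) : {within `[x, y], continuous F} ->
    {within `[x, y], continuous f} ->
    {in `]x, y[, forall t, is_derive t (1 : R) F (f t)} ->
    \int[mu]_(t in `[x, y]) f t = F y - F x.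
  move=> cF cf dF; rewrite /Rintegral (@continuous_FTC2 R f F x y) //.
    have [_ cL cR] := (continuous_within_itvP F xy).1 cF.
    by split => // t tI; have := dF _ tI.
  by move=> t tI; rewrite derive1E; have dFt := dF _ tI; rewrite derive_val.
apply: eq_complexP => /=.
  rewrite (@ftc _ (fun t => Re (H t))) // => [|t /dH[]//].
  by case: (H y); case: (H x).
rewrite (@ftc _ (fun t => Im (H t))) // => [|t /dH[]//].
by case: (H y); case: (H x).
Qed.

Lemma cintegral0 x y : cintegral x y (fun=> 0) = 0.
Proof. by rewrite /cintegral /= /Rintegral integral0. Qed.

Lemma cintegral_refl x h : cintegrable x x h /\ cintegral x x h = 0.
Proof.
have [|i e] := @cintegral_eq_oo x x h (fun=> 0) _ (cintegrable_ccont (ccontC _ _ 0)).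
  by move=> t; rewrite in_itv /= => /andP[/lt_trans/[apply]]; rewrite ltxx.
by rewrite e cintegral0.
Qed.

Variable g : R -> R[i].

(** The speed vector that occurs in [contour_integral]; at the break points
    it is an unspecified value. *)
Definition velocity t : R[i] :=
  (derive1 (fun s => Re (g s)) t +i* derive1 (fun s => Im (g s)) t)%C.

Lemma contour_integralE f :
  contour_integral g f = cintegral 0 1 (fun t => f (g t) * velocity t).
Proof. by []. Qed.

Definition smooth_piece x y : Prop :=
  C1_on x y (fun t => Re (g t)) /\ C1_on x y (fun t => Im (g t)).

Lemma smooth_pieceP x y : smooth_piece x y ->
  ccont x y g /\ exists2 v : R -> R[i], ccont x y v &
    {in `]x, y[, forall t, velocity t = v t /\ cderiv g t (v t)}.
Proof.
move=> [[d1 [v1 cv1 e1]] [d2 [v2 cv2 e2]]]; split.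
  by split; exact: derivable_oo_LRcontinuous_within.
exists (fun t => (v1 t +i* v2 t)%C) => // t tI.
rewrite /velocity e1 // e2 //; split => //; split => /=.
  rewrite -e1 // derive1E; apply: derivableP; by case: d1 => + _ _; apply.
rewrite -e2 // derive1E; apply: derivableP; by case: d2 => + _ _; apply.
Qed.

Definition curve_cont (f : R[i] -> R[i]) : Prop :=
  forall x y, 0 <= x -> y <= 1 -> ccont x y g -> ccont x y (fun t => f (g t)).

Definition curve_deriv (F f : R[i] -> R[i]) : Prop :=
  forall t d, t \in `[0, 1] -> cderiv g t d ->
    cderiv (fun u => F (g u)) t (f (g t) * d).

(** Integrability and the fundamental theorem of calculus hold on each
    smooth piece; both pass to a chain of pieces by induction, the values of
    the primitive telescoping. *)
Lemma path_integral (f : R[i] -> R[i]) (s : seq R) x :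
  curve_cont f -> path <%R x s -> 0 <= x -> last x s <= 1 ->
  (forall k : nat, (k < size s)%N -> smooth_piece (nth 0 (x :: s) k) (nth 0 s k)) ->
  cintegrable x (last x s) (fun t => f (g t) * velocity t) /\
  (forall F, curve_cont F -> curve_deriv F f ->
    cintegral x (last x s) (fun t => f (g t) * velocity t) =
      F (g (last x s)) - F (g x)).
Proof.
move=> cf; elim: s x => [|y s IH] x /=.
  move=> _ _ _ _; have [i ->] := cintegral_refl x (fun t => f (g t) * velocity t).
  by split => // F; rewrite subrr.
move=> /andP[xy ps] x0 l1 sp.
have yl : y <= last y s.
  have : itv_partition y (last y s) s by split.
  exact: itv_partition_le.
have y1 : y <= 1 by exact: le_trans l1.
have y0 : 0 <= y by rewrite (le_trans x0) // ltW.
have [cg [v cv Ev]] := smooth_pieceP (sp 0%N isT).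
rewrite /= in cg cv Ev.
have [|i2 F2] := IH y ps y0 l1; first by move=> k; exact: (sp k.+1).
have cfv : ccont x y (fun t => f (g t) * v t) by apply: ccontM => //; exact: cf.
have [|i1 e1] := @cintegral_eq_oo x y (fun t => f (g t) * velocity t) _ _
  (cintegrable_ccont cfv).
  by move=> t /Ev[->].
have [i e] := cintegral_cat (ltW xy) yl i1 i2.
split => // F cF dF; rewrite e e1 (F2 F) // (cintegral_FTC xy _ cfv (H := fun t => F (g t))).
- by rewrite addrC addrA subrK.
- exact: cF.
- move=> t tI; apply: dF; last by case: (Ev t tI).
  move: tI; rewrite !in_itv /= => /andP[xt ty].
  by rewrite (le_trans x0 (ltW xt)) (le_trans (ltW ty)).
Qed.

Hypotheses (pw : piecewise_C1 g) (closed_g : g 0 = g 1).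

Definition curve_integrable (f : R[i] -> R[i]) : Prop :=
  cintegrable 0 1 (fun t => f (g t) * velocity t).

Lemma curve_cont_integrable f : curve_cont f -> curve_integrable f.
Proof.
case: pw => s [ps /eqP ls] sp cf.
have [|||//|] := @path_integral f s 0 cf => //; by rewrite ?ls.
Qed.

(** The primitive takes the same value at both ends of a closed curve. *)
Lemma contour_primitive F f : curve_cont F -> curve_cont f -> curve_deriv F f ->
  contour_integral g f = 0.
Proof.
case: pw => s [ps /eqP ls] sp cF cf dF.
have [|||//|_ H] := @path_integral f s 0 cf => //; first by rewrite ls.
by rewrite contour_integralE -ls (H F) // ls -closed_g subrr.
Qed.

Lemma contourD f1 f2 : curve_integrable f1 -> curve_integrable f2 ->
  curve_integrable (fun z => f1 z + f2 z) /\
  contour_integral g (fun z => f1 z + f2 z) =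
    contour_integral g f1 + contour_integral g f2.
Proof.
move=> i1 i2; have [i e] := cintegrableD i1 i2.
have E : (fun t => (f1 (g t) + f2 (g t)) * velocity t) =
   (fun t => f1 (g t) * velocity t + f2 (g t) * velocity t).
  by apply/funext => t; rewrite mulrDl.
by rewrite /curve_integrable !contour_integralE E.
Qed.

Lemma contourZ c f : curve_integrable f ->
  curve_integrable (fun z => c * f z) /\
  contour_integral g (fun z => c * f z) = c * contour_integral g f.
Proof.
move=> i1; have [i e] := cintegrableZ c i1.
have E : (fun t => (c * f (g t)) * velocity t) =
   (fun t => c * (f (g t) * velocity t)).
  by apply/funext => t; rewrite mulrA.
by rewrite /curve_integrable !contour_integralE E.
Qed.

Lemma eq_contour f1 f2 : {in `[0, 1], forall t, f1 (g t) = f2 (g t)} ->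
  contour_integral g f1 = contour_integral g f2.
Proof.
move=> E; rewrite !contour_integralE /cintegral.
by congr (_ +i* _)%C; apply: eq_Rintegral => t; rewrite inE /= => tI; rewrite E.
Qed.

Lemma curve_contC c : curve_cont (fun=> c).
Proof. by move=> x y _ _ _; exact: ccontC. Qed.

Lemma curve_cont_id : curve_cont id.
Proof. by move=> x y _ _. Qed.

Lemma curve_contD f1 f2 : curve_cont f1 -> curve_cont f2 ->
  curve_cont (fun z => f1 z + f2 z).
Proof. by move=> c1 c2 x y x0 y1 cg; apply: ccontD; [exact: c1|exact: c2]. Qed.

Lemma curve_contM f1 f2 : curve_cont f1 -> curve_cont f2 ->
  curve_cont (fun z => f1 z * f2 z).
Proof. by move=> c1 c2 x y x0 y1 cg; apply: ccontM; [exact: c1|exact: c2]. Qed.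

Lemma curve_contX f n : curve_cont f -> curve_cont (fun z => f z ^+ n).
Proof. by move=> c1 x y x0 y1 cg; apply: ccontX; exact: c1. Qed.

Lemma curve_contV f : {in `[0, 1], forall t, f (g t) != 0} -> curve_cont f ->
  curve_cont (fun z => (f z)^-1).
Proof.
move=> f0 cf x y x0 y1 cg; apply: ccontV; last exact: cf.
move=> t; rewrite in_itv /= => /andP[xt ty]; apply: f0.
by rewrite in_itv /= (le_trans x0) // (le_trans ty).
Qed.

End ComplexValuedIntegral.

(** * Residues of rational functions from winding numbers *)

Section RationalContourIntegrals.
Variables (R : realType) (g : R -> R[i]).
Hypotheses (pw : piecewise_C1 g) (closed_g : g 0 = g 1).
Implicit Types (f : R[i] -> R[i]) (P Q : {poly R[i]}) (ps : seq R[i]).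

(** For a positively oriented simple closed curve this is the sum of the
    residues of f inside the curve. *)
Definition residue_sum f : R[i] := (two_pi_i R)^-1 * contour_integral g f.
Local Notation rho := residue_sum.

Definition off_curve (p : R[i]) : Prop := {in `[0, 1], forall t, g t != p}.

(** A fraction is given by its numerator and the list of its poles with
    multiplicity, so that partial fractions are inductions on a list. *)
Definition ratf P ps (z : R[i]) : R[i] := P.[z] / \prod_(p <- ps) (z - p).

Lemma curve_cont_horner P : curve_cont g (horner P).
Proof.
elim/poly_ind: P => [|P c IH].
  by rewrite (_ : horner 0 = fun=> 0); [exact: curve_contC|apply/funext => z; rewrite horner0].
rewrite (_ : horner _ = fun z => P.[z] * z + c).
  apply: curve_contD; last exact: curve_contC.
  by apply: curve_contM => //; exact: curve_cont_id.
by apply/funext => z; rewrite hornerMXaddC.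
Qed.

Lemma curve_contB p : curve_cont g (fun z => z - p).
Proof. by apply: curve_contD; [exact: curve_cont_id|exact: curve_contC]. Qed.

Lemma curve_cont_prod ps : curve_cont g (fun z => \prod_(p <- ps) (z - p)).
Proof.
elim: ps => [|p ps IH].
  rewrite (_ : (fun _ => _) = fun=> 1); first exact: curve_contC.
  by apply/funext => z; rewrite big_nil.
rewrite (_ : (fun _ => _) = fun z => (z - p) * \prod_(p <- ps) (z - p)).
  by apply: curve_contM => //; exact: curve_contB.
by apply/funext => z; rewrite big_cons.
Qed.

Lemma prod_sub_neq0 ps z : z \notin ps -> \prod_(p <- ps) (z - p) != 0.
Proof.
elim: ps => [|p ps IH]; first by rewrite big_nil oner_eq0.
rewrite inE negb_or big_cons mulf_eq0 negb_or subr_eq0 => /andP[-> /IH ->] //.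
Qed.

Lemma off_curve_notin ps : {in ps, forall p, off_curve p} ->
  {in `[0, 1], forall t, g t \notin ps}.
Proof. by move=> ops t tI; apply/negP => /ops /(_ t tI); rewrite eqxx. Qed.

Lemma curve_cont_ratf P ps : {in ps, forall p, off_curve p} ->
  curve_cont g (ratf P ps).
Proof.
move=> ops; apply: curve_contM; first exact: curve_cont_horner.
apply: curve_contV; last exact: curve_cont_prod.
by move=> t tI; apply/prod_sub_neq0/off_curve_notin.
Qed.

Lemma eq_residue f1 f2 : {in `[0, 1], forall t, f1 (g t) = f2 (g t)} ->
  rho f1 = rho f2.
Proof. by move=> E; rewrite /rho (eq_contour E). Qed.

Lemma residueD f1 f2 : curve_cont g f1 -> curve_cont g f2 ->
  rho (fun z => f1 z + f2 z) = rho f1 + rho f2.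
Proof.
move=> c1 c2; rewrite /rho -mulrDr.
by have [_ ->] := contourD (curve_cont_integrable pw c1) (curve_cont_integrable pw c2).
Qed.

Lemma residueZ c f : curve_cont g f -> rho (fun z => c * f z) = c * rho f.
Proof.
move=> cf; rewrite /rho mulrCA.
by have [_ ->] := contourZ c (curve_cont_integrable pw cf).
Qed.

Lemma residueC c : rho (fun=> c) = 0.
Proof.
rewrite /rho (@contour_primitive _ g pw closed_g (fun z => c * z)) ?mulr0 //.
- by apply: curve_contM; [exact: curve_contC|exact: curve_cont_id].
- exact: curve_contC.
- move=> t d tI dg; apply: cderiv_eq (cderivM (cderivC t c) dg) _.
  by rewrite mul0r add0r.
Qed.

Lemma residueXn n : rho (fun z => z ^+ n) = 0.
Proof.
have n0 : n.+1%:R != 0 :> R[i] by rewrite pnatr_eq0.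
rewrite /rho (@contour_primitive _ g pw closed_g (fun z => n.+1%:R^-1 * z ^+ n.+1)) ?mulr0 //.
- apply: curve_contM; [exact: curve_contC|].
  by apply: curve_contX; exact: curve_cont_id.
- by apply: curve_contX; exact: curve_cont_id.
- move=> t d tI dg; apply: cderiv_eq (cderivM (cderivC t _) (cderivX n dg)) _.
  by rewrite mul0r add0r !mulrA mulVf // mul1r.
Qed.

Lemma residue_inv_pow p n : off_curve p -> rho (fun z => (z - p)^-1 ^+ n.+2) = 0.
Proof.
move=> op.
have n0 : n.+1%:R != 0 :> R[i] by rewrite pnatr_eq0.
have p0 : {in `[0, 1], forall t, g t - p != 0} by move=> t /op; rewrite subr_eq0.
have ci : curve_cont g (fun z => (z - p)^-1).
  by apply: curve_contV => //; exact: curve_contB.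
rewrite /rho (@contour_primitive _ g pw closed_g
  (fun z => - n.+1%:R^-1 * (z - p)^-1 ^+ n.+1)) ?mulr0 //.
- by apply: curve_contM; [exact: curve_contC|exact: curve_contX].
- exact: curve_contX.
- move=> t d tI dg.
  have := cderivD dg (cderivC t (- p)); rewrite addr0 => dgp.
  apply: cderiv_eq (cderivM (cderivC t _) (cderivX n (cderivV (p0 t tI) dgp))) _.
  rewrite mul0r add0r; move: (g t - p)^-1 => x; move: n0; set N := n.+1%:R => n0.
  by rewrite -[in RHS]addn2 exprD; field.
Qed.

Section OneWindingNumber.
Variable w : R[i].

Definition residue_value (p : R[i]) : Prop :=
  off_curve p /\ rho (fun z => (z - p)^-1) = w.

(** If all poles coincide, the integrand has a primitive. Otherwise it
    contains two distinct poles p and q, and 1/((z-p)(z-q)) = (1/(z-p) -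
    1/(z-q)) / (p-q) expresses the integral by two shorter products with the
    same value. *)
Lemma residue_prod_inv n ps : size ps = n.+1 -> {in ps, forall p, residue_value p} ->
  rho (fun z => (\prod_(p <- ps) (z - p))^-1) = w *+ (size ps == 1%N).
Proof.
elim: n ps => [|n IH] ps.
  case: ps => [//|p [|//]] _ /(_ p (mem_head _ _)) [op <-].
  by rewrite mulr1n; apply: eq_residue => t tI; rewrite big_seq1.
move=> sz wps; rewrite sz mulr0n.
case: ps sz wps => // p ps [sz] wps.
have ops : {in p :: ps, forall q, off_curve q} by move=> q /wps[].
have [/allP/= allp|/allPn[q qps qp]] := boolP (all (pred1 p) ps).
  have -> : ps = nseq n.+1 p.
    by rewrite -sz; apply/all_pred1P/allP => q /allp.
  rewrite -(residue_inv_pow n (ops p (mem_head _ _))).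
  apply: eq_residue => t tI; rewrite big_cons big_nseq.
  by rewrite iter_mulr mulr1 -exprS exprVn.
have qp' : q != p by [].
have pq0 : p - q != 0 by rewrite subr_eq0 eq_sym.
set ps' := rem q ps.
have pe : perm_eq (p :: ps) (p :: q :: ps') by rewrite perm_cons perm_to_rem.
have w2 : {in q :: ps', forall p, residue_value p}.
  by move=> r rI; apply: wps; rewrite (perm_mem pe) inE rI orbT.
have w1 : {in p :: ps', forall p, residue_value p}.
  move=> r; rewrite inE => rI; apply: wps; rewrite (perm_mem pe) !inE.
  by case/orP: rI => ->; rewrite ?orbT.
have sz' : size ps' = n by rewrite size_rem // sz.
have E : rho (fun z => (\prod_(p <- p :: ps) (z - p))^-1) =
  rho (fun z => (p - q)^-1 * (\prod_(p <- p :: ps') (z - p))^-1 +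
     (- (p - q)^-1) * (\prod_(p <- q :: ps') (z - p))^-1).
  apply: eq_residue => t tI; rewrite (perm_big _ pe) /= !big_cons.
  have : g t \notin [:: p, q & ps'] by rewrite -(perm_mem pe); exact: (off_curve_notin ops).
  rewrite !inE !negb_or -subr_eq0 -[g t == q]subr_eq0 => /and3P[p0 q0 r0].
  have := prod_sub_neq0 r0; set r := \prod_(_ <- _) _ => r0'.
  by field; rewrite r0' p0 q0 pq0.
have cc (c : R[i]) rs : {in rs, forall p, residue_value p} ->
    curve_cont g (fun z => c * (\prod_(p <- rs) (z - p))^-1).
  move=> wrs; apply: curve_contM; first exact: curve_contC.
  apply: curve_contV; last exact: curve_cont_prod.
  by move=> t tI; apply/prod_sub_neq0; apply: off_curve_notin tI => r /wrs[].
have cc1 rs : {in rs, forall p, residue_value p} ->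
    curve_cont g (fun z => (\prod_(p <- rs) (z - p))^-1).
  move=> wrs; apply: curve_contV; last exact: curve_cont_prod.
  by move=> t tI; apply/prod_sub_neq0; apply: off_curve_notin tI => r /wrs[].
rewrite E residueD; [|exact: cc|exact: cc].
rewrite !residueZ; [|exact: cc1|exact: cc1].
by rewrite !IH /= ?sz' // mulNr subrr.
Qed.

(** When every pole has the same winding number w, the integral only sees
    the coefficient of 1/z at infinity. The fraction is reduced to
    reciprocals of products by dividing the numerator by the first pole. *)
Lemma residue_ratf ps P : {in ps, forall p, residue_value p} ->
  (w = 0 -> rho (ratf P ps) = 0) /\
  ((size P <= size ps)%N -> rho (ratf P ps) = w * P`_(size ps).-1).
Proof.
move=> wps.
have ops : {in ps, forall q, off_curve q} by move=> q /wps[].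
elim: ps P wps ops => [|p ps IH] P wps ops.
  split=> [_|]; last first.
    rewrite leqn0 size_poly_eq0 => /eqP ->; rewrite coef0 mulr0 -(residueC 0).
    by apply: eq_residue => t _; rewrite /ratf horner0 mul0r.
  elim/poly_ind: P => [|P c IH].
    by rewrite -(residueC 0); apply: eq_residue => t _; rewrite /ratf horner0 mul0r.
  have {}IH n : rho (fun z => P.[z] * z ^+ n) = 0.
    elim/poly_ind: P n {IH} => [|P d IH] n.
      by rewrite -(residueC 0); apply: eq_residue => t _; rewrite horner0 mul0r.
    rewrite (_ : (fun _ => _) = fun z => P.[z] * z ^+ n.+1 + d * z ^+ n); last first.
      by apply/funext => z; rewrite hornerMXaddC exprS; ring.
    rewrite residueD; first rewrite IH add0r residueZ ?residueXn ?mulr0 //.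
    - by apply: curve_contX; exact: curve_cont_id.
    - apply: curve_contM; first exact: curve_cont_horner.
      by apply: curve_contX; exact: curve_cont_id.
    - apply: curve_contM; first exact: curve_contC.
      by apply: curve_contX; exact: curve_cont_id.
  rewrite (_ : ratf _ _ = fun z => P.[z] * z ^+ 1 + c); last first.
    by apply/funext => z; rewrite /ratf big_nil divr1 hornerMXaddC expr1.
  rewrite residueD; first by rewrite IH residueC addr0.
  - apply: curve_contM; first exact: curve_cont_horner.
    by apply: curve_contX; exact: curve_cont_id.
  - exact: curve_contC.
have wps' : {in ps, forall p, residue_value p} by move=> q qI; apply: wps; rewrite inE qI orbT.
have ops' : {in ps, forall p, off_curve p} by move=> q /wps'[].
have [IH1 IH2] := IH (P %/ ('X - p%:P)) wps' ops'.
have PE : P = (P %/ ('X - p%:P)) * ('X - p%:P) + (P.[p])%:P.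
  by rewrite {1}(divp_eq P ('X - p%:P)) modp_XsubC.
have E : rho (ratf P (p :: ps)) = rho (ratf (P %/ ('X - p%:P)) ps) +
    P.[p] * (w *+ (size (p :: ps) == 1%N)).
  rewrite -(@residue_prod_inv (size ps) (p :: ps)) // -residueZ; last first.
    apply: curve_contV; last exact: curve_cont_prod.
    by move=> t tI; apply/prod_sub_neq0; apply: off_curve_notin tI.
  rewrite -residueD.
  - apply: eq_residue => t tI; rewrite /ratf {1}PE big_cons !hornerE.
    have := off_curve_notin ops tI; rewrite inE negb_or -subr_eq0 => /andP[p0 /prod_sub_neq0].
    set r := \prod_(_ <- _) _ => r0.
    by field; rewrite p0 r0.
  - exact: curve_cont_ratf.
  - apply: curve_contM; first exact: curve_contC.
    apply: curve_contV; last exact: curve_cont_prod.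
    by move=> t tI; apply/prod_sub_neq0; apply: off_curve_notin tI.
split=> [w0|]; first by rewrite E IH1 // w0 mul0rn mulr0 add0r.
rewrite /= => szP.
move: E PE IH2 {IH1}; set P1 := P %/ _ => E PE IH2.
have szQ : (size P1 <= size ps)%N.
  by rewrite /P1 size_divp ?polyXsubC_eq0 // size_XsubC leq_subLR add1n.
rewrite E /= IH2 // [in RHS]PE coefD coefC mulrBr coefB coefMC coefMX.
rewrite /= (nth_default _ szQ) mul0r subr0.
case: (size ps) szQ => [|k] szQ /=; last by rewrite ?mulr0n mulr0 ?addr0.
by rewrite mulr1n nth_default // mulr0 !add0r mulrC.
Qed.

End OneWindingNumber.
End RationalContourIntegrals.

(** The points of [ins] lie inside both curves and those of [outs] outside
    both; the whole curve g lies inside g'. *)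
Record nested_contours (R : realType) (g g' : R -> R[i]) (ins outs : seq R[i]) : Prop := {
  nc_piecewise : piecewise_C1 g;
  nc_closed : g 0 = g 1;
  nc_piecewise' : piecewise_C1 g';
  nc_closed' : g' 0 = g' 1;
  nc_ins : {in ins, forall p, residue_value g 1 p};
  nc_outs : {in outs, forall p, residue_value g 0 p};
  nc_ins' : {in ins, forall p, residue_value g' 1 p};
  nc_outs' : {in outs, forall p, residue_value g' 0 p};
  nc_nested : {in `[0, 1], forall t, residue_value g' 1 (g t)} }.

(** * The bilinear form defined by two nested contours *)

Section NestedContours.
Variables (R : realType) (g g' : R -> R[i]) (ins outs : seq R[i]).
Hypothesis nc : nested_contours g g' ins outs.
Implicit Types (F G H : R[i] -> R[i]) (P Q : {poly R[i]}) (ps qs : seq R[i]).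
Local Notation rho := (residue_sum g).

(** With [strict] the numerator has lower degree than the denominator, that
    is, the fraction vanishes at infinity. The equation is only asked off
    the poles, where the conventions for division by zero do not matter. *)
Definition rational_in (S : seq R[i]) (strict : bool) F : Prop :=
  exists P ps, [/\ {subset ps <= S}, strict ==> (size P <= size ps)%N &
    forall z, z \notin ins ++ outs -> F z = ratf P ps z].

Definition is_rat := rational_in (ins ++ outs) false.
(** The fractions with no pole inside the contours. *)
Definition is_reg := rational_in outs false.
(** The principal parts at the points inside the contours. *)
Definition is_pol := rational_in ins true.

Lemma ratfD P Q ps qs z : z \notin ps -> z \notin qs ->
  ratf P ps z + ratf Q qs z =
  ratf (P * \prod_(q <- qs) ('X - q%:P) + Q * \prod_(p <- ps) ('X - p%:P)) (ps ++ qs) z.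
Proof.
move=> /prod_sub_neq0 zp /prod_sub_neq0 zq.
rewrite /ratf big_cat /= hornerD !hornerM !horner_prod.
under [\prod_(i <- qs) _.[z]]eq_bigr do rewrite hornerXsubC.
under [\prod_(i <- ps) _.[z]]eq_bigr do rewrite hornerXsubC.
by field; rewrite zp zq.
Qed.

Lemma ratfM P Q ps qs z : ratf P ps z * ratf Q qs z = ratf (P * Q) (ps ++ qs) z.
Proof. by rewrite /ratf big_cat /= hornerM invfM mulrACA. Qed.

Lemma ratfZ c P ps z : c * ratf P ps z = ratf (c *: P) ps z.
Proof. by rewrite /ratf hornerZ mulrA. Qed.

Lemma size_prod_XsubC_seq ps : size (\prod_(p <- ps) ('X - p%:P) : {poly R[i]}) = (size ps).+1.
Proof. exact: size_prod_XsubC. Qed.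

Lemma rational_eq S b F G : (forall z, z \notin ins ++ outs -> F z = G z) ->
  rational_in S b F -> rational_in S b G.
Proof.
move=> E [P [ps [sub sz FE]]]; exists P, ps; split => // z zg.
by rewrite -E // FE.
Qed.

Lemma rationalD S b F G : {subset S <= ins ++ outs} ->
  rational_in S b F -> rational_in S b G -> rational_in S b (fun z => F z + G z).
Proof.
move=> subS [P [ps [sP zP FE]]] [Q [qs [sQ zQ GE]]].
exists (P * \prod_(q <- qs) ('X - q%:P) + Q * \prod_(p <- ps) ('X - p%:P)), (ps ++ qs).
split.
- by move=> z; rewrite mem_cat => /orP[/sP|/sQ].
- apply/implyP => hb; move: zP zQ; rewrite hb /= => zP zQ.
  rewrite (leq_trans (size_polyD _ _)) // geq_max size_cat; apply/andP; split.
    by rewrite (leq_trans (size_polyMleq _ _)) // size_prod_XsubC_seq addnS /= leq_add2r.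
  by rewrite (leq_trans (size_polyMleq _ _)) // size_prod_XsubC_seq addnS /= addnC leq_add2l.
- move=> z zg; rewrite FE // GE // ratfD //; apply: contraNN zg; first by move=> /sP/subS.
  by move=> /sQ/subS.
Qed.

Lemma rationalZ S b c F : rational_in S b F -> rational_in S b (fun z => c * F z).
Proof.
move=> [P [ps [sub sz FE]]]; exists (c *: P), ps; split => //.
  by apply/implyP => hb; move: sz; rewrite hb /=; apply: leq_trans; exact: size_scale_leq.
by move=> z zg; rewrite FE // ratfZ.
Qed.

Lemma rationalM S F G : rational_in S false F -> rational_in S false G ->
  rational_in S false (fun z => F z * G z).
Proof.
move=> [P [ps [sP _ FE]]] [Q [qs [sQ _ GE]]].
exists (P * Q), (ps ++ qs); split => //.
  by move=> z; rewrite mem_cat => /orP[/sP|/sQ].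
by move=> z zg; rewrite FE // GE // ratfM.
Qed.

Lemma rational0 S b : rational_in S b (fun=> 0).
Proof.
exists 0, [::]; split => //; first by rewrite size_poly0 implybT.
by move=> z _; rewrite /ratf horner0 mul0r.
Qed.

Lemma reg_rat F : is_reg F -> is_rat F.
Proof.
move=> [P [ps [sub _ FE]]]; exists P, ps; split => // z /sub.
by rewrite mem_cat orbC => ->.
Qed.

Lemma pol_rat F : is_pol F -> is_rat F.
Proof.
move=> [P [ps [sub _ FE]]]; exists P, ps; split => // z /sub.
by rewrite mem_cat => ->.
Qed.

Lemma sub_outs : {subset outs <= ins ++ outs}.
Proof. by move=> z; rewrite mem_cat orbC => ->. Qed.

Lemma sub_ins : {subset ins <= ins ++ outs}.
Proof. by move=> z; rewrite mem_cat => ->. Qed.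

Lemma ins_outs_disjoint p : p \in ins -> p \in outs -> False.
Proof.
move=> /(nc_ins nc)[_ e] /(nc_outs nc)[_]; rewrite e => /eqP; by rewrite oner_eq0.
Qed.

Lemma coprime_prods ps qs : {subset ps <= ins} -> {subset qs <= outs} ->
  coprimep (\prod_(p <- ps) ('X - p%:P)) (\prod_(q <- qs) ('X - q%:P)).
Proof.
elim: ps => [|p ps IH] sp sq; first by rewrite big_nil coprime1p.
rewrite big_cons coprimepMl IH // ?andbT; last first.
  by move=> z zp; apply: sp; rewrite inE zp orbT.
rewrite coprimep_sym coprimep_XsubC root_prod_XsubC; apply/negP => /sq.
by apply: ins_outs_disjoint; apply: sp; exact: mem_head.
Qed.

(** The denominator is a product of two coprime factors, one for the poles
    inside and one for those outside. A Bezout relation splits the fraction,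
    and the polynomial part is put with the regular summand. *)
Lemma rational_split F : is_rat F -> exists Fr Fp, [/\ is_reg Fr, is_pol Fp &
  forall z, z \notin ins ++ outs -> F z = Fr z + Fp z].
Proof.
move=> [P [ps [sub _ FE]]].
pose pi := [seq p <- ps | p \in ins]; pose po := [seq p <- ps | p \notin ins].
have si : {subset pi <= ins} by move=> z; rewrite mem_filter => /andP[].
have so : {subset po <= outs}.
  move=> z; rewrite mem_filter => /andP[zi /sub].
  by rewrite mem_cat (negbTE zi).
have pe : perm_eq (pi ++ po) ps by rewrite perm_filterC.
pose A := \prod_(p <- pi) ('X - p%:P); pose B := \prod_(p <- po) ('X - p%:P).
have /Bezout_eq1_coprimepP[[U V] /= UV] : coprimep A B by exact: coprime_prods.
have A0 : A != 0 by rewrite monic_neq0 // monic_prod_XsubC.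
exists (ratf (P * U + (P * V) %/ A * B) po), (ratf ((P * V) %% A) pi); split.
- by exists (P * U + (P * V) %/ A * B), po.
- exists ((P * V) %% A), pi; split => //=.
  by rewrite -ltnS -[(size pi).+1]size_prod_XsubC_seq -/A ltn_modp.
move=> z zg; rewrite FE //.
have zi : z \notin pi by apply: contraNN zg => /si/sub_ins.
have zo : z \notin po by apply: contraNN zg => /so/sub_outs.
rewrite addrC ratfD // /ratf (perm_big _ pe) /= -/A -/B; congr (_ / _).
congr (_.[z]).
have := divp_eq (P * V) A; set q := _ %/ A; set r := _ %% A => PV.
rewrite [RHS](_ : _ = P * (U * A) + (q * A + r) * B); last by ring.
by rewrite -PV -mulrA -mulrDr UV mulr1.
Qed.

Lemma generic_on_curve : {in `[0, 1], forall t, g t \notin ins ++ outs}.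
Proof.
by apply: off_curve_notin => p; rewrite mem_cat => /orP[/(nc_ins nc)[]|/(nc_outs nc)[]].
Qed.

Lemma generic_on_curve' : {in `[0, 1], forall t, g' t \notin ins ++ outs}.
Proof.
by apply: off_curve_notin => p; rewrite mem_cat => /orP[/(nc_ins' nc)[]|/(nc_outs' nc)[]].
Qed.

Lemma residue_eq F G : (forall z, z \notin ins ++ outs -> F z = G z) -> rho F = rho G.
Proof. by move=> E; apply: eq_residue => t tI; apply: E; exact: generic_on_curve. Qed.

Lemma ratf_cont ps P : {subset ps <= ins ++ outs} -> curve_cont g (ratf P ps).
Proof.
move=> sub; apply: curve_cont_ratf => p /sub.
by rewrite mem_cat => /orP[/(nc_ins nc)[]|/(nc_outs nc)[]].
Qed.

Lemma rho_add F G : is_rat F -> is_rat G -> rho (fun z => F z + G z) = rho F + rho G.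
Proof.
have pw := nc_piecewise nc.
move=> [P [ps [sP _ FE]]] [Q [qs [sQ _ GE]]].
rewrite (residue_eq FE) (residue_eq GE) -residueD //; try exact: ratf_cont.
by apply: residue_eq => z zg; rewrite FE // GE.
Qed.

Lemma rho_scale c F : is_rat F -> rho (fun z => c * F z) = c * rho F.
Proof.
have pw := nc_piecewise nc.
move=> [P [ps [sP _ FE]]].
rewrite (residue_eq FE) -residueZ //; last exact: ratf_cont.
by apply: residue_eq => z zg; rewrite FE.
Qed.

Lemma rho_reg F : is_reg F -> rho F = 0.
Proof.
move=> [P [ps [sP _ FE]]]; rewrite (residue_eq FE).
by have [->] := residue_ratf (nc_piecewise nc) (nc_closed nc) P (fun p (pP : p \in ps) => nc_outs nc (sP p pP)).
Qed.

Lemma rho_pole ps P : {subset ps <= ins} -> (size P <= size ps)%N ->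
  rho (ratf P ps) = P`_(size ps).-1.
Proof.
move=> sP zP.
have [_ ->//] := residue_ratf (nc_piecewise nc) (nc_closed nc) P (fun p (pP : p \in ps) => nc_ins nc (sP p pP)).
by rewrite mul1r.
Qed.

(** The product decreases like z^(-2) at infinity, where its residue
    vanishes. *)
Lemma rho_pol2 F G : is_pol F -> is_pol G -> rho (fun z => F z * G z) = 0.
Proof.
move=> [P [ps [sP /= zP FE]]] [Q [qs [sQ /= zQ GE]]].
rewrite (@residue_eq _ (ratf (P * Q) (ps ++ qs))); last first.
  by move=> z zg; rewrite FE // GE // ratfM.
have szM : (size (P * Q)%R <= (size P + size Q).-1)%N by exact: size_polyMleq.
have szC : (size (P * Q)%R <= (size ps + size qs).-1)%N.
  by apply: leq_trans szM _; rewrite -!subn1 leq_sub2r // leq_add.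
rewrite rho_pole.
- by rewrite size_cat nth_default.
- by move=> z; rewrite mem_cat => /orP[/sP|/sQ].
- by rewrite size_cat (leq_trans szC) // leq_pred.
Qed.

Lemma two_pi_i_neq0 : two_pi_i R != 0.
Proof.
by rewrite /two_pi_i eq_complex /= eqxx /= mulf_neq0 ?pnatr_eq0 // gt_eqF // pi_gt0.
Qed.

(** Cauchy's formula: the difference quotient of G at the point u of the
    inner curve has no pole inside the outer one, and what remains is G(u) /
    (v-u). *)
Lemma cauchy_reg G t : t \in `[0, 1] -> is_reg G ->
  residue_sum g' (fun v => (v - g t)^-1 * G v) = G (g t).
Proof.
have pw' := nc_piecewise' nc.
move=> tI [P [ps [sP _ GE]]]; set u := g t.
have ug : u \notin ins ++ outs by exact: generic_on_curve.
have u0 : u \notin ps by apply: contraNN ug => /sP/sub_outs.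
have u1 := prod_sub_neq0 u0.
set c := \prod_(p <- ps) (u - p) in u1 *.
pose B : {poly R[i]} := \prod_(p <- ps) ('X - p%:P).
have BE z : B.[z] = \prod_(p <- ps) (z - p).
  by rewrite horner_prod; apply: eq_bigr => p _; rewrite hornerXsubC.
have : root (c *: P - P.[u] *: B) u.
  by rewrite /root !hornerE BE -/c mulrC subrr.
case/factor_theorem => H HE.
have ops' : {in ps, forall p, residue_value g' 0 p} by move=> p /sP/(nc_outs' nc).
have [opu ru] := nc_nested nc tI.
transitivity (residue_sum g' (fun v => c^-1 * ratf H ps v + (P.[u] / c) * (v - u)^-1)).
  apply: eq_residue => s sI; set v := g' s.
  have vg : v \notin ins ++ outs by exact: generic_on_curve'.
  have v0 : v \notin ps by apply: contraNN vg => /sP/sub_outs.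
  have v1 := prod_sub_neq0 v0.
  have vu : v - u != 0 by rewrite subr_eq0; exact: opu.
  rewrite GE // /ratf.
  have E := congr1 (horner^~ v) HE; rewrite /= !hornerE BE in E.
  set d := \prod_(p <- ps) (v - p) in v1 E *.
  have {}E : H.[v] = (c * P.[v] - P.[u] * d) / (v - u) by rewrite E mulfK.
  by rewrite E; field; rewrite vu v1 u1.
rewrite residueD //; first last.
- apply: curve_contM; first exact: curve_contC.
  apply: curve_contV; last exact: curve_contB.
  by move=> s sI; rewrite subr_eq0; exact: opu.
- apply: curve_contM; first exact: curve_contC.
  by apply: curve_cont_ratf => p /ops'[].
rewrite !residueZ //; first last.
- by apply: curve_cont_ratf => p /ops'[].
- apply: curve_contV; last exact: curve_contB.
  by move=> s sI; rewrite subr_eq0; exact: opu.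
have [-> // _] := residue_ratf (nc_piecewise' nc) (nc_closed' nc) H ops'.
by rewrite ru mulr0 add0r mulr1 GE.
Qed.

(** All poles of G(v) / (v-u), including u, lie inside the outer curve, and
    it decreases like v^(-2) at infinity. *)
Lemma cauchy_pol G t : t \in `[0, 1] -> is_pol G ->
  residue_sum g' (fun v => (v - g t)^-1 * G v) = 0.
Proof.
move=> tI [P [ps [sP /= zP GE]]].
have ops' : {in g t :: ps, forall p, residue_value g' 1 p}.
  by move=> p; rewrite inE => /predU1P[->|/sP/(nc_ins' nc)//]; exact: (nc_nested nc).
transitivity (residue_sum g' (ratf P (g t :: ps))).
  apply: eq_residue => s sI; rewrite GE ?generic_on_curve' // /ratf big_cons invfM.
  by rewrite mulrCA.
have [_ ->] := residue_ratf (nc_piecewise' nc) (nc_closed' nc) P ops'; last exact: leqW.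
by rewrite /= nth_default // mulr0.
Qed.

Definition pairing F G : R[i] :=
  double_integral g g' (fun u v => (v - u)^-1 * (F u * G v)).

(** The inner integral projects G onto its regular part. *)
Lemma pairing_split F G Gr Gp : is_rat F -> is_reg Gr -> is_pol Gp ->
  (forall z, z \notin ins ++ outs -> G z = Gr z + Gp z) ->
  pairing F G = rho (fun z => F z * Gr z).
Proof.
have pw' := nc_piecewise' nc.
move=> rF rGr rGp GE; rewrite /pairing /double_integral -exprVn expr2 -mulrA; congr (_ * _).
have -> : contour_integral g (fun u => contour_integral g' (fun v => (v - u)^-1 * (F u * G v)))
  = contour_integral g (fun u => two_pi_i R * (F u * Gr u)).
  apply: eq_contour => t tI.
  transitivity (two_pi_i R * residue_sum g' (fun v => F (g t) *
      ((v - g t)^-1 * Gr v + (v - g t)^-1 * Gp v))).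
    rewrite /residue_sum mulrA divff ?two_pi_i_neq0 // mul1r.
    apply: eq_contour => s sI; rewrite GE ?generic_on_curve' //; ring.
  have [opu _] := nc_nested nc tI.
  have cV : curve_cont g' (fun v => (v - g t)^-1).
    apply: curve_contV; last exact: curve_contB.
    by move=> s sI; rewrite subr_eq0; exact: opu.
  have cR S b H : {subset S <= ins ++ outs} -> rational_in S b H ->
      exists H', curve_cont g' H' /\ {in `[0, 1], forall s, H (g' s) = H' (g' s)}.
    move=> sS [P [ps [sP _ HE]]]; exists (ratf P ps); split; last first.
      by move=> s sI; rewrite HE // generic_on_curve'.
    apply: curve_cont_ratf => p /sP/sS; rewrite mem_cat => /orP[/(nc_ins' nc)[]|/(nc_outs' nc)[]] //.
  have [Hr [cHr Er]] := cR _ _ _ sub_outs rGr.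
  have [Hp [cHp Ep]] := cR _ _ _ sub_ins rGp.
  congr (_ * _).
  rewrite (@eq_residue _ g' _ (fun v => F (g t) *
      ((v - g t)^-1 * Hr v + (v - g t)^-1 * Hp v))); last first.
    by move=> s sI; rewrite Er // Ep.
  rewrite residueZ //; last by apply: curve_contD; exact: curve_contM.
  rewrite residueD //; try exact: curve_contM.
  congr (_ * _).
  rewrite -(cauchy_reg tI rGr) -[RHS]addr0 -(cauchy_pol tI rGp).
  by congr (_ + _); apply: eq_residue => s sI; rewrite ?Er ?Ep.
have rM : is_rat (fun z => F z * Gr z) by apply: rationalM => //; exact: reg_rat.
have [P [ps [sP _ ME]]] := rM.
have -> : contour_integral g (fun u => two_pi_i R * (F u * Gr u)) =
   contour_integral g (fun u => two_pi_i R * ratf P ps u).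
  by apply: eq_contour => t tI; rewrite ME // generic_on_curve.
have [_ ->] := contourZ (two_pi_i R) (curve_cont_integrable (nc_piecewise nc) (ratf_cont P sP)).
rewrite mulrA mulVf ?two_pi_i_neq0 // mul1r.
by apply: eq_contour => t tI; rewrite ME // generic_on_curve.
Qed.

Lemma pairing_reg F G : is_rat F -> is_reg G -> pairing F G = rho (fun z => F z * G z).
Proof.
move=> rF rG; apply: (pairing_split rF rG (rational0 _ _)) => z _.
by rewrite addr0.
Qed.

Lemma pairing_pol F G : is_rat F -> is_pol G -> pairing F G = 0.
Proof.
move=> rF rG; rewrite (pairing_split rF (rational0 _ _) rG) => [|z _]; last by rewrite add0r.
by apply: rho_reg; apply: (@rational_eq _ _ (fun=> 0)) (rational0 _ _) => z _; rewrite mulr0.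
Qed.

Lemma reg_pairing F G : is_reg F -> is_rat G -> pairing F G = 0.
Proof.
move=> rF /rational_split[Gr [Gp [rGr rGp GE]]].
rewrite (pairing_split (reg_rat rF) rGr rGp GE).
by apply: rho_reg; exact: rationalM.
Qed.

(** By [rho_reg] and [rho_pol2] only the mixed products F_pol G_reg and
    F_reg G_pol contribute to the integral of F G. *)
Lemma pairing_sym F G : is_rat F -> is_rat G ->
  pairing F G + pairing G F = rho (fun z => F z * G z).
Proof.
move=> rF rG.
have [Fr [Fp [rFr rFp FE]]] := rational_split rF.
have [Gr [Gp [rGr rGp GE]]] := rational_split rG.
rewrite (pairing_split rF rGr rGp GE) (pairing_split rG rFr rFp FE).
have rat1 := reg_rat rFr; have rat2 := reg_rat rGr.
have rat3 := pol_rat rFp; have rat4 := pol_rat rGp.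
have E1 : rho (fun z => F z * Gr z) = rho (fun z => Fp z * Gr z).
  rewrite (@residue_eq _ (fun z => Fr z * Gr z + Fp z * Gr z)).
    rewrite rho_add; try exact: rationalM.
    by rewrite (rho_reg (rationalM rFr rGr)) add0r.
  by move=> z zg; rewrite FE // mulrDl.
have E2 : rho (fun z => G z * Fr z) = rho (fun z => Fr z * Gp z).
  rewrite (@residue_eq _ (fun z => Fr z * Gr z + Fr z * Gp z)).
    rewrite rho_add; try exact: rationalM.
    by rewrite (rho_reg (rationalM rFr rGr)) add0r.
  by move=> z zg; rewrite GE //; ring.
rewrite E1 E2 (@residue_eq (fun z => F z * G z) (fun z => (Fp z * Gr z + Fr z * Gp z) +
    (Fr z * Gr z + Fp z * Gp z))); last by move=> z zg; rewrite FE // GE //; ring.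
rewrite rho_add; first rewrite rho_add; try exact: rationalM.
- rewrite rho_add; try exact: rationalM.
  by rewrite (rho_reg (rationalM rFr rGr)) (rho_pol2 rFp rGp) !addr0.
- by apply: rationalD => //; exact: rationalM.
- by apply: rationalD => //; exact: rationalM.
Qed.

Lemma pol_pairing F G : is_pol F -> is_rat G -> pairing F G = rho (fun z => F z * G z).
Proof.
move=> rF rG; rewrite -pairing_sym //; last exact: pol_rat.
by rewrite (pairing_pol rG rF) addr0.
Qed.

Lemma pairing_eq F F' G G' : (forall z, z \notin ins ++ outs -> F z = F' z) ->
  (forall z, z \notin ins ++ outs -> G z = G' z) -> pairing F G = pairing F' G'.
Proof.
move=> FE GE; rewrite /pairing /double_integral; congr (_ * _).
apply: eq_contour => t tI; apply: eq_contour => s sI.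
by rewrite FE ?generic_on_curve // GE // generic_on_curve'.
Qed.

Lemma pairingDl F F' G : is_rat F -> is_rat F' -> is_rat G ->
  pairing (fun z => F z + F' z) G = pairing F G + pairing F' G.
Proof.
move=> rF rF' /rational_split[Gr [Gp [rGr rGp GE]]].
rewrite !(pairing_split _ rGr rGp GE) //; last exact: rationalD.
rewrite -rho_add; try by apply: rationalM => //; exact: reg_rat.
by apply: residue_eq => z _; rewrite mulrDl.
Qed.

Lemma pairingZl c F G : is_rat F -> is_rat G ->
  pairing (fun z => c * F z) G = c * pairing F G.
Proof.
move=> rF /rational_split[Gr [Gp [rGr rGp GE]]].
rewrite !(pairing_split _ rGr rGp GE) //; last exact: rationalZ.
rewrite -rho_scale; last by apply: rationalM => //; exact: reg_rat.
by apply: residue_eq => z _; rewrite mulrA.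
Qed.

(** Additivity in the second argument follows from that in the first by the
    symmetry relation. *)
Lemma pairingDr F G G' : is_rat F -> is_rat G -> is_rat G' ->
  pairing F (fun z => G z + G' z) = pairing F G + pairing F G'.
Proof.
move=> rF rG rG'.
have rD : is_rat (fun z => G z + G' z) by exact: rationalD.
have E K : is_rat K -> pairing F K = rho (fun z => F z * K z) - pairing K F.
  by move=> rK; rewrite -pairing_sym // addrK.
rewrite !E // pairingDl // (@residue_eq _ (fun z => F z * G z + F z * G' z)).
  rewrite rho_add; try exact: rationalM.
  by rewrite opprD addrACA.
by move=> z _; rewrite mulrDr.
Qed.

Lemma pairingZr c F G : is_rat F -> is_rat G ->
  pairing F (fun z => c * G z) = c * pairing F G.
Proof.
move=> rF rG.
have rZ : is_rat (fun z => c * G z) by exact: rationalZ.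
have E K : is_rat K -> pairing F K = rho (fun z => F z * K z) - pairing K F.
  by move=> rK; rewrite -pairing_sym // addrK.
rewrite !E // pairingZl // (@residue_eq _ (fun z => c * (F z * G z))).
  by rewrite rho_scale ?mulrBr //; exact: rationalM.
by move=> z _; rewrite mulrCA.
Qed.

End NestedContours.

(** * A positivity argument for polynomials with prescribed roots *)

Section PolynomialPositivity.
Variable F : rcfType.
Implicit Types (p q u f : {poly F}) (c t : F) (m n k : nat).

(** One exceptional point is allowed because the substitution used below is
    undefined there. *)
Lemma poly_eq_off c p q : (forall t, t != c -> p.[t] = q.[t]) -> p = q.
Proof.
move=> E; apply/eqP; rewrite -subr_eq0; apply/eqP.
pose h := (p - q) * ('X - c%:P).
suff : h = 0.
  by move/eqP; rewrite mulf_eq0 polyXsubC_eq0 orbF => /eqP.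
pose rs := [seq i%:R : F | i <- iota 0 (size h)].
apply: (@roots_geq_poly_eq0 _ h rs); last by rewrite size_map size_iota.
- apply/allP => t _; rewrite /root !hornerE.
  by have [->|/E ->] := eqVneq t c; rewrite subrr ?mulr0 ?mul0r.
- rewrite map_inj_uniq ?iota_uniq // => i j /eqP; rewrite eqr_nat => /eqP //.
Qed.

Lemma dvdp_derivn c m k f : ('X - c%:P) ^+ (m + k) %| f -> ('X - c%:P) ^+ m %| f^`(k).
Proof.
elim: k m => [|k IH] m; first by rewrite addn0.
rewrite addnS -addSn => /IH; rewrite derivnS => /dvdpP[h ->].
rewrite derivM deriv_exp derivXsubC mul1r /=.
apply: dvdp_add; first by rewrite exprS mulrA dvdp_mulIr.
by apply: dvdp_mull; rewrite -mulr_natl dvdp_mull.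
Qed.

Lemma root_derivn c m k f : (k < m)%N -> ('X - c%:P) ^+ m %| f -> root f^`(k) c.
Proof.
move=> km; rewrite -(subnK km) addnS -addSn => /dvdp_derivn dv.
by rewrite -dvdp_XsubCl; apply: dvdp_trans dv; rewrite exprS dvdp_mulIl.
Qed.

(** The boundary terms of n integrations by parts of u f^(n). *)
Fixpoint parts_primitive n u f : {poly F} :=
  if n is n'.+1 then parts_primitive n' u f^`() + (-1) ^+ n' *: (u^`(n') * f) else 0.

Lemma deriv_parts_primitive n u f :
  (parts_primitive n u f)^`() = u * f^`(n) - (-1) ^+ n *: (u^`(n) * f).
Proof.
elim: n f => [|n IH] f /=; first by rewrite deriv0 scale1r subrr.
rewrite derivD IH derivZ derivM -derivSn -derivnS exprS -!mul_polyC !rmorphM !rmorphN rmorph1.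
by ring.
Qed.

(** Each boundary term is a product of u^(k) and f^(n-1-k), and one of the
    two factors vanishes. *)
Lemma parts_primitive_root n u f c :
  (forall k, (k < n)%N -> root u^`(k) c || root f^`(n.-1 - k) c) ->
  root (parts_primitive n u f) c.
Proof.
elim: n f => [|n IH] f H /=; first exact: root0.
rewrite /root hornerD hornerZ hornerM.
have /rootP -> : root (parts_primitive n u f^`()) c.
  apply: IH => k kn; have := H k (leqW kn); rewrite -derivSn.
  by rewrite /= -[(n - k)%N]prednK ?subn_gt0 // predn_sub.
have := H n (ltnSn n); rewrite /= subnn derivn0.
by case/orP => /rootP ->; rewrite ?mul0r !mulr0 addr0.
Qed.

(** The polynomial q is nondecreasing between x and y with equal values at
    the ends, hence constant there, so its derivative w h^2 is zero. *)
Lemma positive_weight_vanish (x y : F) (w h q : {poly F}) : x < y ->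
  q^`() = w * h ^+ 2 -> q.[x] = q.[y] ->
  (forall t, x < t < y -> 0 < w.[t]) -> h = 0.
Proof.
move=> xy dq qxy wpos.
have dpos t : x < t < y -> 0 <= q^`().[t].
  by move=> /wpos w0; rewrite dq hornerM horner_exp mulr_ge0 ?sqr_ge0 // ltW.
have qc t : x < t < y -> q.[t] = q.[x].
  move=> /andP[xt ty]; apply/eqP; rewrite eq_le; apply/andP; split.
    have [d] := poly_mvt q ty; rewrite in_itv /= => /andP[td dy] e.
    rewrite qxy -subr_ge0 e mulr_ge0 ?subr_ge0 ?(ltW ty) // dpos //.
    by rewrite (lt_trans xt).
  have [d] := poly_mvt q xt; rewrite in_itv /= => /andP[xd dt] e.
  rewrite -subr_ge0 e mulr_ge0 ?subr_ge0 ?(ltW xt) // dpos //.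
  by rewrite xd (lt_trans dt).
have q0 : q - (q.[x])%:P = 0.
  (* More points strictly between x and y than the degree of the difference. *)
  pose rs := [seq x + (y - x) / i.+2%:R : F | i <- iota 0 (size (q - (q.[x])%:P)%R)].
  have yx : y - x != 0 by rewrite subr_eq0 gt_eqF.
  apply: (@roots_geq_poly_eq0 _ _ rs); last by rewrite size_map size_iota.
    apply/allP => _ /mapP[i _ ->]; rewrite /root !hornerE qc ?subrr //.
    have i2 : (1 : F) < i.+2%:R by rewrite ltr1n.
    rewrite ltrDl divr_gt0 ?subr_gt0 ?ltr0n //=.
    by rewrite -ltrBrDl ltr_pdivrMr ?ltr0n // ltr_pMr // subr_gt0.
  rewrite map_inj_uniq ?iota_uniq // => i j /addrI/(mulfI yx)/invr_inj/eqP.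
  by rewrite eqr_nat => /eqP[].
have /eqP : w * h ^+ 2 = 0.
  by rewrite -dq -(subrK (q.[x])%:P q) q0 add0r derivC.
rewrite mulf_eq0 expf_eq0 /= => /orP[/eqP w0|/eqP //].
have : 0 < w.[(x + y) / 2].
  by apply: wpos; apply/andP; split; lra.
by rewrite w0 horner0 ltxx.
Qed.

Variable a : F.
Hypothesis a_gt0 : 0 < a.

Definition affine : {poly F} := a *: 'X + 1.

Lemma affineE t : affine.[t] = 1 + a * t.
Proof. by rewrite !hornerE addrC. Qed.

Lemma size_affine_exp k : (size (affine ^+ k)%R <= k.+1)%N.
Proof.
apply: leq_trans (size_poly_exp_leq _ _) _.
have : (size affine <= 2)%N.
  rewrite (leq_trans (size_polyD _ _)) // geq_max size_poly1 andbT.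
  by rewrite (leq_trans (size_scale_leq _ _)) ?size_polyX.
by case: (size affine) => [|[|[|//]]] // _; rewrite /= ?mul0n ?mul1n.
Qed.

(** The numerator of p((1+at)/(t-a)) over (t-a)^d. *)
Definition homog d p : {poly F} :=
  \sum_(i < d.+1) p`_i *: (affine ^+ i * ('X - a%:P) ^+ (d - i)).

Lemma sqa_neq0 : 1 + a ^+ 2 != 0.
Proof. by rewrite gt_eqF // ltr_wpDr // ?sqr_ge0 // ltr01. Qed.

Lemma size_homog d p : (size (homog d p) <= d.+1)%N.
Proof.
apply: leq_trans (size_sum _ _ _) _; apply/bigmax_leqP => i _.
apply: leq_trans (size_scale_leq _ _) _.
apply: leq_trans (size_polyMleq _ _) _; rewrite size_exp_XsubC.
by have := size_affine_exp i; have := ltn_ord i; lia.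
Qed.

Lemma homogE d p t : (size p <= d.+1)%N -> t != a ->
  (homog d p).[t] = (t - a) ^+ d * p.[(1 + a * t) / (t - a)].
Proof.
move=> sz ta; have ta0 : t - a != 0 by rewrite subr_eq0.
rewrite (horner_coef_wide _ sz) horner_sum mulr_sumr; apply: eq_bigr => i _.
rewrite hornerZ hornerM !horner_exp affineE hornerXsubC expr_div_n.
have -> : (t - a) ^+ d = (t - a) ^+ (d - i) * (t - a) ^+ i.
  by rewrite -exprD subnK // -ltnS.
by have e0 := expf_neq0 i ta0; field.
Qed.

(** The substitution is inverted by t = (1+az)/(z-a), since 1+a^2 is not
    zero. *)
Lemma homog_inj d p : (size p <= d.+1)%N -> homog d p = 0 -> p = 0.
Proof.
move=> sz h0; apply: (@poly_eq_off a) => z za; rewrite horner0.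
have za0 : z - a != 0 by rewrite subr_eq0.
pose t := (1 + a * z) / (z - a).
have ta : t - a = (1 + a ^+ 2) / (z - a) by rewrite /t; field.
have ta0 : t - a != 0 by rewrite ta mulf_neq0 ?invr_eq0 // sqa_neq0.
have := homogE sz (_ : t != a); rewrite h0 horner0 -subr_eq0 => /(_ ta0) /esym/eqP.
have -> : (1 + a * t) / (t - a) = z.
  by rewrite ta /t; have := sqa_neq0 => s0; field; rewrite za0 s0.
by rewrite mulf_eq0 expf_eq0 (negbTE ta0) andbF => /eqP.
Qed.

(** In the variable t with z = (1+at)/(t-a), the three terms of the relation
    become (t-a)^(N+n) G, a polynomial f divisible by t^n and by
    (1+at)^(n-N+1), and a polynomial of degree less than n. Differentiating
    n times removes the last one and gives f^(n) = -h (t-a)^N with deg h <=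
    n-N. Take u = (1+at)^(N-1) h, which has degree less than n. Integrating
    u f^(n) by parts n times over [-1/a, 0] leaves no boundary term, whereas
    u f^(n) is h^2 times a function of constant sign. *)
Lemma mixed_root_vanish n N (y U C : {poly F}) :
  (0 < N <= n)%N -> (size y <= (n - N).+1)%N -> (size U <= N)%N ->
  y + 'X^((n - N).+1) * U * affine ^+ n = ('X - a%:P) ^+ n.+1 * C ->
  y = 0.
Proof.
move=> /andP[N0 Nn] sy sU E.
have sC : (size C <= n)%N.
  have [->|C0] := eqVneq C 0; first by rewrite size_poly0.
  have := congr1 (fun p : {poly F} => size p) E.
  rewrite size_monicM ?monic_exp ?monicXsubC // size_exp_XsubC => sE.
  have : (size (y + 'X^((n - N).+1) * U * affine ^+ n)%R <= n.*2.+1)%N.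
    rewrite (leq_trans (size_polyD _ _)) // geq_max; apply/andP; split; first by lia.
    rewrite (leq_trans (size_polyMleq _ _)) //.
    have h1 := size_polyMleq (polyX F ^+ (n - N).+1)%R U; rewrite size_polyXn in h1.
    by have h2 := size_affine_exp n; lia.
  by rewrite sE; lia.
have s0 := sqa_neq0; set S := 1 + a ^+ 2 in s0.
pose H := homog N.-1 U; pose G := homog (n - N) y.
pose f := S ^+ n *: ('X^n * affine ^+ (n - N).+1 * H).
have I : ('X - a%:P) ^+ (N + n) * G + f = S ^+ n.+1 *: homog n.-1 C.
  apply: (@poly_eq_off a) => t ta.
  have ta0 : t - a != 0 by rewrite subr_eq0.
  have := congr1 (horner^~ ((1 + a * t) / (t - a))) E.
  rewrite /f /= !(affineE, hornerXsubC, horner_exp, hornerM, hornerX, hornerZ, hornerD).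
  rewrite /H /G !homogE ?prednK // ?(leq_trans N0 Nn) //.
  set z := (1 + a * t) / (t - a).
  have -> : 1 + a * z = S * t / (t - a) by rewrite /S /z; field.
  have -> : z - a = S / (t - a) by rewrite /S /z; field.
  have -> : 1 + a * t = z * (t - a) by rewrite /z; field.
  move: z (t - a) ta0 => z T T0.
  rewrite !expr_div_n !exprMn => Ez.
  have e1 : T ^+ (N + n) * T ^+ (n - N) = T ^+ n * T ^+ n.
    by rewrite -!exprD; congr (_ ^+ _); lia.
  have e2 : T ^+ (n - N).+1 * T ^+ N.-1 = T ^+ n.
    by rewrite -!exprD; congr (_ ^+ _); lia.
  have e3 : T ^+ n.-1 * T ^+ n.+1 = T ^+ n * T ^+ n.
    by rewrite -!exprD; congr (_ ^+ _); lia.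
  have T1 : T ^+ n != 0 by exact: expf_neq0.
  have T2 : T ^+ n.+1 != 0 by exact: expf_neq0.
  transitivity (T ^+ n * T ^+ n * (y.[z] + z ^+ (n - N).+1 * U.[z] * (S ^+ n * t ^+ n / T ^+ n))).
    have -> : T ^+ n * T ^+ n * (y.[z] + z ^+ (n - N).+1 * U.[z] * (S ^+ n * t ^+ n / T ^+ n))
      = T ^+ n * T ^+ n * y.[z] + T ^+ n * (S ^+ n * t ^+ n * z ^+ (n - N).+1 * U.[z]).
      by field.
    by rewrite -e1 -e2; ring.
  by rewrite Ez -e3; field; rewrite T2.
have /dvdpP[h hE] : ('X - a%:P) ^+ N %| (('X - a%:P) ^+ (N + n) * G)^`(n).
  by apply: dvdp_derivn; rewrite dvdp_mulIl.
have fn : f^`(n) = - (h * ('X - a%:P) ^+ N).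
  have sC' : (size (homog n.-1 C) <= n)%N.
    by apply: leq_trans (size_homog _ _) _; rewrite prednK // (leq_trans N0).
  have := congr1 (fun p => p^`(n)) I; rewrite derivnD hE [RHS]derivnZ.
  rewrite (poly.derivn_poly0 sC') scaler0.
  by move=> /eqP; rewrite addrC addr_eq0 => /eqP.
have sh : (size h <= (n - N).+1)%N.
  have [->|h0] := eqVneq h 0; first by rewrite size_poly0.
  have := congr1 (fun p : {poly F} => size p) hE.
  rewrite size_derivn [h * _]mulrC [RHS]size_monicM ?monic_exp ?monicXsubC // size_exp_XsubC.
  have := size_polyMleq (('X - a%:P) ^+ (N + n)) G; rewrite size_exp_XsubC.
  have := size_homog (n - N) y; rewrite -/G.
  by move: (size G) (size h) (size (_ * G)) => sG sh sM; clear -Nn; lia.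
pose u := affine ^+ N.-1 * h.
have un : u^`(n) = 0.
  apply: poly.derivn_poly0; apply: leq_trans (size_polyMleq _ _) _.
  have := size_affine_exp N.-1.
  by move: (size h) sh (size (affine ^+ N.-1)) => s1 h1 s2; clear -N0 Nn h1; lia.
have aff : affine = a *: ('X - (- a^-1)%:P).
  rewrite /affine rmorphN opprK scalerDr; congr (_ + _).
  by rewrite -mul_polyC -rmorphM divff ?rmorph1 // gt_eqF.
have dva (c : {poly F}) k : ('X - (- a^-1)%:P) ^+ k %| affine ^+ k * c.
  by rewrite dvdp_mulr // aff exprZn -mul_polyC dvdp_mull.
(* The sign makes the weight (1+at)^(N-1) (a-t)^N positive on the interval. *)
pose q := (-1) ^+ N.+1 *: parts_primitive n u f.
have h0 : h = 0.
  apply: (@positive_weight_vanish (- a^-1) 0 (affine ^+ N.-1 * (a%:P - 'X) ^+ N) h q).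
  - by rewrite oppr_lt0 invr_gt0.
  - rewrite derivZ deriv_parts_primitive un mul0r scaler0 subr0 fn /u.
    have -> : a%:P - 'X = (-1) *: ('X - a%:P) by rewrite scaleN1r opprB.
    by rewrite exprZn -!mul_polyC exprS rmorphM rmorphN rmorph1; ring.
  - have r0 : root (parts_primitive n u f) 0.
      apply: parts_primitive_root => k kn; apply/orP; right.
      apply: (@root_derivn 0 n); first by lia.
      by rewrite subr0 /f -mul_polyC -!mulrA dvdp_mull // dvdp_mulr.
    have r1 : root (parts_primitive n u f) (- a^-1).
      apply: parts_primitive_root => k kn; apply/orP.
      have [kN|kN] := ltnP k N.-1; [left|right].
        by apply: (@root_derivn _ N.-1) => //; exact: dva.
      apply: (@root_derivn _ (n - N).+1); first by lia.
      rewrite /f -mul_polyC -[_ * _ * H]mulrA; apply: dvdp_mull.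
      by apply: dvdp_mull; exact: dva.
    by rewrite /q !hornerZ (rootP r0) (rootP r1).
  - move=> t /andP[t1 t2]; rewrite hornerM !horner_exp affineE !hornerE.
    rewrite mulr_gt0 // exprn_gt0 //; last by rewrite subr_gt0 (lt_trans t2).
    by rewrite -[X in X + _](divff (lt0r_neq0 a_gt0)) -mulrDr mulr_gt0 // addrC -ltrBlDr sub0r.
have : (('X - a%:P) ^+ (N + n) * G)^`(n) == 0 by rewrite hE h0 mul0r.
rewrite -polyorder.derivn_poly0; have [G0 _|G0] := eqVneq G 0.
  exact: (homog_inj sy G0).
rewrite size_monicM ?monic_exp ?monicXsubC // size_exp_XsubC.
have : (0 < size G)%N by rewrite size_poly_gt0.
by lia.
Qed.
End PolynomialPositivity.

Section ComplexCoefficients.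
Variables (R : rcfType) (a : R).
Hypothesis a_gt0 : 0 < a.
Local Notation toC := (real_complex R).

Lemma map_poly_real_mul (f : {additive R[i] -> R}) (q : {poly R}) (p : {poly R[i]}) :
  (forall r c, f (toC r * c) = r * f c) ->
  map_poly f (map_poly toC q * p) = q * map_poly f p.
Proof.
move=> fM; apply/polyP => k; rewrite coef_map !coefM raddf_sum.
by apply: eq_bigr => i _; rewrite !coef_map fM.
Qed.

Definition caffine : {poly R[i]} := toC a *: 'X + 1.

Lemma caffineE : caffine = map_poly toC (affine a).
Proof. by rewrite /caffine /affine rmorphD rmorph1 /= map_polyZ map_polyX. Qed.

(** As a is real, the relation holds separately for the real and the
    imaginary parts of the coefficients. *)
Lemma mixed_root_vanish_complex n N (y U C : {poly R[i]}) :
  (0 < N <= n)%N -> (size y <= (n - N).+1)%N -> (size U <= N)%N ->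
  y + 'X^((n - N).+1) * U * caffine ^+ n = ('X - (toC a)%:P) ^+ n.+1 * C ->
  y = 0.
Proof.
move=> nN sy sU E.
have key (f : {additive R[i] -> R}) : (forall r c, f (toC r * c) = r * f c) ->
    map_poly f y = 0.
  move=> fM; have sf (p : {poly R[i]}) k : (size p <= k)%N -> (size (map_poly f p) <= k)%N.
    by apply: leq_trans; exact: size_poly.
  apply: (@mixed_root_vanish _ a a_gt0 n N _ (map_poly f U) (map_poly f C)) => //.
  - exact: sf.
  - exact: sf.
  have toCX : map_poly toC (('X - a%:P) ^+ n.+1) = ('X - (toC a)%:P) ^+ n.+1.
    by rewrite rmorphXn rmorphB /= map_polyX map_polyC.
  have := map_poly_real_mul (('X - a%:P) ^+ n.+1) C fM; rewrite toCX -E => <-.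
  rewrite raddfD /=; congr (_ + _).
  have -> : 'X^((n - N).+1) * U * caffine ^+ n =
      map_poly toC ('X^((n - N).+1) * affine a ^+ n) * U.
    by rewrite rmorphM /= !rmorphXn /= map_polyX caffineE mulrAC.
  by rewrite (map_poly_real_mul _ _ fM) mulrAC.
have addRe : additive (@complex.Re R : R[i] -> R) by move=> x z; case: x; case: z.
have addIm : additive (@complex.Im R : R[i] -> R) by move=> x z; case: x; case: z.
pose fR : {additive R[i] -> R} := HB.pack_for {additive R[i] -> R} (@complex.Re R : R[i] -> R)
  (GRing.isAdditive.Build _ _ (@complex.Re R : R[i] -> R) addRe).
pose fI : {additive R[i] -> R} := HB.pack_for {additive R[i] -> R} (@complex.Im R : R[i] -> R)
  (GRing.isAdditive.Build _ _ (@complex.Im R : R[i] -> R) addIm).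
have y1 : map_poly fR y = 0.
  by apply: key => r [u v] /=; rewrite mul0r subr0.
have y2 : map_poly fI y = 0.
  by apply: key => r [u v] /=; rewrite mul0r addr0.
apply/polyP => k; rewrite coef0.
have := congr1 (fun p : {poly R} => p`_k) y1; rewrite coef_map coef0 /=.
have := congr1 (fun p : {poly R} => p`_k) y2; rewrite coef_map coef0 /=.
by case: (y`_k) => u v /= -> ->.
Qed.
End ComplexCoefficients.

(** * Power series division of polynomials *)

Section PowerSeriesDivision.
Variable K : fieldType.
Implicit Types p q : {poly K}.

(** The remainder after k steps of dividing p by q in increasing powers,
    when q has constant coefficient 1. *)
Fixpoint series_rest q p k : {poly K} :=
  if k is k'.+1 then
    drop_poly 1 (series_rest q p k' - (series_rest q p k')`_0 *: q)
  else p.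

Definition series_coef q p k : K := (series_rest q p k)`_0.

Lemma series_divE q p k : q`_0 = 1 ->
  p = q * \sum_(0 <= i < k) series_coef q p i *: 'X^i + 'X^k * series_rest q p k.
Proof.
move=> q0; elim: k => [|k IH]; first by rewrite big_geq // mulr0 add0r mul1r.
rewrite big_nat_recr //= {1}IH mulrDr -addrA; congr (_ + _).
set h := series_rest q p k; set d := h - _.
have d0 : d`_0 = 0 by rewrite coefB coefZ q0 mulr1 subrr.
have dE : d = 'X * drop_poly 1 d.
  apply/polyP => i; rewrite coefXM coef_drop_poly.
  by case: i => [//|i] /=; rewrite addn1.
have hE : h = d + h`_0 *: q by rewrite /d subrK.
rewrite /series_coef /= -/h -/d {1}hE {1}dE exprS -!mul_polyC; ring.
Qed.

Lemma series_coef_small q j k : (k < j)%N -> series_coef q 'X^j k = 0.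
Proof.
move=> kj; rewrite /series_coef.
suff -> : series_rest q 'X^j k = 'X^(j - k) by rewrite coefXn eq_sym subn_eq0 leqNgt kj.
elim: k kj => [|k IH] kj /=; first by rewrite subn0.
rewrite IH 1?ltnW // coefXn eq_sym subn_eq0 leqNgt (ltnW kj) /= scale0r subr0.
apply/polyP => i; rewrite coef_drop_poly !coefXn; congr (_%:R); congr nat_of_bool.
by apply/eqP/eqP; lia.
Qed.
End PowerSeriesDivision.

(** * Inverting an infinite matrix with finitely many nonzero columns *)

Section BlockTriangularInverse.
Variables (R : realType) (al n : nat) (K : nat -> nat -> R[i]).
Hypothesis K_vanish : forall j k, (n < k)%N -> K j k = 0.
Implicit Types (f v c : nat -> R[i]).

(** The partial sums are eventually constant. *)
Lemma inner_ge_finite f c M : (forall k, (M <= k)%N -> f k * c k = 0) ->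
  inner_ge al f c = \sum_(al <= k < M) f k * c k.
Proof.
move=> fc0; rewrite /inner_ge; apply: (@norm_lim_near_cst _ (R[i]^o)).
exists (maxn M al) => // N /=; rewrite geq_max => /andP[MN alN].
have [alM|Mal] := leqP al M.
  rewrite (big_cat_nat alM MN) /= [X in _ + X]big_nat_cond [X in _ + X]big1 ?addr0 //.
  by move=> k /andP[/andP[/fc0]].
rewrite [RHS]big_geq ?(ltnW Mal) // big_nat_cond big1 // => k /andP[/andP[ak _] _].
by rewrite fc0 // (leq_trans (ltnW Mal)).
Qed.

(** The system (I - K) c = v on the indices >= al, which makes sense for
    every sequence c because only the columns k <= n of K are nonzero. *)
Definition solves v c : Prop := forall l, (al <= l)%N ->
  c l - \sum_(al <= k < n.+1) K l k * c k = v l.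

Definition block_injective : Prop := forall c,
  (forall l, (al <= l <= n)%N -> c l = \sum_(al <= k < n.+1) K l k * c k) ->
  forall l, (al <= l <= n)%N -> c l = 0.

Hypothesis K_inj : block_injective.

Lemma block_inverse : exists E : nat -> nat -> R[i],
  [/\ forall j k, ~~ (al <= k <= n)%N -> E j k = 0,
      forall j k, (al <= j <= n)%N -> (al <= k <= n)%N ->
        E j k - \sum_(al <= l < n.+1) K j l * E l k = (j == k)%:R &
      forall j k, (al <= j <= n)%N -> (al <= k <= n)%N ->
        E j k - \sum_(al <= l < n.+1) E j l * K l k = (j == k)%:R].
Proof.
pose d := (n.+1 - al)%N.
pose A : 'M[R[i]]_d := \matrix_(i, j) ((i == j)%:R - K (al + i)%N (al + j)%N).
have sumE (F : nat -> R[i]) : \sum_(al <= k < n.+1) F k = \sum_(i < d) F (al + i)%N.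
  by rewrite -{1}[al]addn0 addnC big_addn big_mkord; apply: eq_bigr => i _; rewrite addnC.
have ind (j : nat) : (al <= j <= n)%N -> exists i : 'I_d, j = (al + i)%N.
  move=> /andP[aj jn]; have jd : (j - al < d)%N by rewrite /d; lia.
  by exists (Ordinal jd); rewrite /= subnKC.
have inI (i : 'I_d) : (al <= al + i <= n)%N.
  by have := ltn_ord i; rewrite /d; lia.
have AU : A \in unitmx.
  rewrite -unitmx_tr -row_free_unit -kermx_eq0; apply/eqP/row_matrixP => r.
  rewrite row0; have : row r (kermx A^T) *m A^T = 0 by apply/sub_kermxP; exact: row_sub.
  move: (row r _) => x /matrixP/(_ 0) xA.
  pose c k := if insub (k - al)%N is Some i then x 0 i else 0.
  have cE (i : 'I_d) : c (al + i)%N = x 0 i.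
    rewrite /c addKn; case: insubP => [j _ ji|]; last by rewrite ltn_ord.
    by congr (x 0 _); apply: val_inj.
  apply/rowP => i; rewrite [RHS]mxE -cE; apply: K_inj (inI i) => l /ind[{}i ->].
  apply/eqP; rewrite -subr_eq0 sumE; apply/eqP.
  transitivity ((x *m A^T) 0 i); last by rewrite (xA i) mxE.
  rewrite [RHS]mxE.
  rewrite [RHS](eq_bigr (fun j => (i == j)%:R * x 0 j - K (al + i)%N (al + j)%N * c (al + j)%N)).
    rewrite big_split /= sumrN; congr (_ - _).
    rewrite [in RHS](bigD1 i) //= eqxx mul1r cE [in RHS]big1 ?addr0 // => j ji.
    by rewrite eq_sym (negbTE ji) mul0r.
  by move=> j _; rewrite !mxE cE; ring.
pose E j k := if insub (j - al)%N is Some i then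
  if insub (k - al)%N is Some i' then
    if (al <= k)%N then invmx A i i' else 0 else 0 else 0.
have EE (i i' : 'I_d) : E (al + i)%N (al + i')%N = invmx A i i'.
  rewrite /E !addKn; case: insubP => [j _ ji|]; last by rewrite ltn_ord.
  case: insubP => [j' _ ji'|]; last by rewrite ltn_ord.
  by rewrite leq_addr; congr (invmx A _ _); apply: val_inj.
exists E; split.
- move=> j k; rewrite negb_and -!ltnNge /E => kout.
  case: insubP => // i _ _; case: insubP => // i' i'd _.
  case: ifP => // ak; case/orP: kout; first by rewrite ltnNge ak.
  by move=> nk; move: i'd; rewrite /d; lia.
- move=> _ _ /ind[i ->] /ind[i' ->].
  have /matrixP/(_ i i') := mulmxV AU; rewrite !mxE eqn_add2l => <-.
  rewrite sumE EE [RHS](eq_bigr (fun j => (i == j)%:R * invmx A j i' -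
      K (al + i)%N (al + j)%N * E (al + j)%N (al + i')%N)).
    rewrite big_split /= sumrN; congr (_ - _).
    rewrite [in RHS](bigD1 i) //= eqxx mul1r [in RHS]big1 ?addr0 // => j ji.
    by rewrite eq_sym (negbTE ji) mul0r.
  by move=> j _; rewrite !mxE EE; ring.
- move=> _ _ /ind[i ->] /ind[i' ->].
  have /matrixP/(_ i i') := mulVmx AU; rewrite !mxE eqn_add2l => <-.
  rewrite sumE EE [RHS](eq_bigr (fun j => (j == i')%:R * invmx A i j -
      E (al + i)%N (al + j)%N * K (al + j)%N (al + i')%N)).
    rewrite big_split /= sumrN; congr (_ - _).
    rewrite [in RHS](bigD1 i') //= eqxx mul1r [in RHS]big1 ?addr0 // => j ji.
    by rewrite (negbTE ji) mul0r.
  by move=> j _; rewrite !mxE EE; ring.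
Qed.

Lemma solves_unique v c d : solves v c -> solves v d ->
  forall l, (al <= l)%N -> c l = d l.
Proof.
move=> sc sd.
have sub l : (al <= l)%N ->
    c l - d l = \sum_(al <= k < n.+1) K l k * (c k - d k).
  move=> al_l; have := sc l al_l; rewrite -(sd l al_l) => /eqP.
  under [\sum_(_ <= _ < _) _ * (_ - _)]eq_bigr do rewrite mulrBr.
  rewrite big_split /= sumrN subr_eq => /eqP ->; ring.
have e0 := K_inj (fun l lI => sub l (proj1 (andP lI))).
move=> l al_l; apply/eqP; rewrite -subr_eq0 sub // big_nat_cond big1 //.
by move=> k /andP[/e0 -> _]; rewrite mulr0.
Qed.

Lemma sum_delta (F : nat -> R[i]) j M : (al <= j < M)%N ->
  \sum_(al <= l < M) (j == l)%:R * F l = F j.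
Proof.
move=> jI; rewrite (bigD1_seq j) ?mem_index_iota ?iota_uniq //= eqxx mul1r.
by rewrite big1 ?addr0 // => l lj; rewrite eq_sym (negbTE lj) mul0r.
Qed.

Lemma sum_truncate (F : nat -> R[i]) j M : (n < M)%N ->
  \sum_(al <= l < M) K j l * F l = \sum_(al <= l < n.+1) K j l * F l.
Proof.
move=> nM; have [an|na] := leqP al n.+1.
  rewrite (big_cat_nat an nM) /= [X in _ + X]big_nat_cond [X in _ + X]big1 ?addr0 //.
  by move=> l /andP[/andP[/K_vanish ->]]; rewrite mul0r.
rewrite [RHS]big_geq ?(ltnW na) // big_nat_cond big1 // => l /andP[/andP[al_l _] _].
by rewrite K_vanish ?mul0r // (leq_trans (ltnW na)).
Qed.

Lemma mulmx_id_sub L j k : (al <= j)%N ->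
  mulmx_ge al (id_sub K) L j k = L j k - \sum_(al <= l < n.+1) K j l * L l k.
Proof.
move=> aj; rewrite /mulmx_ge (@inner_ge_finite _ _ (maxn j n).+1); last first.
  move=> l; rewrite gtn_max => /andP[jl nl].
  by rewrite /id_sub K_vanish // subr0 (ltn_eqF jl) mul0r.
rewrite -(@sum_truncate (L^~ k) j (maxn j n).+1) ?ltnS ?leq_maxr //.
rewrite -[in RHS](@sum_delta (L^~ k) j (maxn j n).+1) ?aj ?ltnS ?leq_maxl //.
by rewrite -sumrB; apply: eq_bigr => l _; rewrite /id_sub mulrBl.
Qed.

(** With respect to the splitting at n, I - K is block lower triangular with
    an identity block in the lower right corner. If E is the inverse of the
    finite block, extended by zero, the inverse is I + K E. *)
Lemma row_finite_inverse : exists L : nat -> nat -> R[i],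
  is_inverse_ge al (id_sub K) L /\ forall j k, (maxn j n < k)%N -> L j k = 0.
Proof.
have [E [E0 E1 E2]] := block_inverse.
pose L j k := (j == k)%:R + \sum_(al <= i < n.+1) K j i * E i k.
have Elarge i k : (n < k)%N -> E i k = 0.
  by move=> nk; rewrite E0 // negb_and -!ltnNge nk orbT.
have Lfin j k : (maxn j n < k)%N -> L j k = 0.
  rewrite gtn_max => /andP[jk nk]; rewrite /L (ltn_eqF jk) add0r big1 // => i _.
  by rewrite Elarge // mulr0.
have LE l k : (al <= l <= n)%N -> (al <= k)%N -> L l k = E l k.
  move=> lI ak; have [kn|nk] := leqP k n.
    by rewrite /L -(E1 l k) ?ak // addrNK.
  have ln : (l < k)%N by have /andP[_ ln] := lI; exact: leq_ltn_trans nk.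
  rewrite /L Elarge // (ltn_eqF ln) add0r big1 // => i _; by rewrite Elarge ?mulr0.
exists L; split => // j k aj ak; split.
  rewrite mulmx_id_sub //.
  have -> : \sum_(al <= i < n.+1) K j i * L i k = \sum_(al <= i < n.+1) K j i * E i k.
    by rewrite big_nat_cond [RHS]big_nat_cond; apply: eq_bigr => i /andP[iI _]; rewrite LE.
  by rewrite /L addrK.
pose M := (maxn (maxn j n) k).+1.
have kM : (al <= k < M)%N by rewrite ak ltnS leq_maxr.
have jM : (al <= j < M)%N by rewrite aj ltnS !leq_max leqnn.
have nM : (n < M)%N by rewrite ltnS !leq_max leqnn orbT.
rewrite /mulmx_ge (@inner_ge_finite _ _ M); last first.
  by move=> l lM; rewrite Lfin ?mul0r // (leq_ltn_trans _ lM) // leq_max leqnn.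
transitivity (L j k - \sum_(al <= l < M) L j l * K l k).
  rewrite -[in RHS](@sum_delta (fun l => L j l) k M) // -sumrB.
  by apply: eq_bigr => l _; rewrite /id_sub eq_sym; ring.
have [nk|kn] := ltnP n k.
  rewrite big1 => [|l _]; last by rewrite K_vanish // mulr0.
  rewrite subr0 /L big1 ?addr0 // => i _; by rewrite Elarge // mulr0.
have kn1 : (al <= k < n.+1)%N by rewrite ak ltnS.
have -> : \sum_(al <= l < M) L j l * K l k =
    K j k + \sum_(al <= i < n.+1) K j i * \sum_(al <= l < M) E i l * K l k.
  rewrite -[X in X + _](@sum_delta (fun l => K l k) j M) //.
  under [X in _ = _ + X]eq_bigr do rewrite mulr_sumr.
  rewrite exchange_big /= -big_split /=; apply: eq_bigr => l _.
  by rewrite /L mulrDl mulr_suml; congr (_ + _); apply: eq_bigr => i _; rewrite mulrA.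
have -> : \sum_(al <= i < n.+1) K j i * \sum_(al <= l < M) E i l * K l k =
    \sum_(al <= i < n.+1) (K j i * E i k - (k == i)%:R * K j i).
  rewrite big_nat_cond [RHS]big_nat_cond; apply: eq_bigr => i /andP[iI _].
  have an : (al <= n.+1)%N by case/andP: iI => ? ?; lia.
  have -> : \sum_(al <= l < M) E i l * K l k = \sum_(al <= l < n.+1) E i l * K l k.
    rewrite (big_cat_nat an nM) /= [X in _ + X]big_nat_cond [X in _ + X]big1 ?addr0 //.
    by move=> l /andP[/andP[nl _] _]; rewrite Elarge // mul0r.
  have iI' : (al <= i <= n)%N by [].
  have /eqP := E2 i k iI' kn1; rewrite subr_eq addrC -subr_eq => /eqP <-.
  by rewrite eq_sym; ring.
rewrite sumrB (@sum_delta (K j) k n.+1) // /L; ring.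
Qed.

(** The matrix chosen by [inverse_ge] agrees with the row-finite inverse,
    since the columns of two inverses solve the same system. *)
Lemma inverse_ge_solves v :
  solves v (fun l => inner_ge al (inverse_ge al (id_sub K) l) v).
Proof.
have [L [invL Lfin]] := row_finite_inverse.
have : is_inverse_ge al (id_sub K) (inverse_ge al (id_sub K)).
  by apply: (@xgetPex _ _ [set L | is_inverse_ge al (id_sub K) L]); exists L.
set IK := inverse_ge _ _ => invIK.
have IKE j k : (al <= j)%N -> (al <= k)%N -> IK j k = L j k.
  move=> aj ak; apply: (@solves_unique (fun j => (j == k)%:R) (IK^~ k) (L^~ k)) => // l al_l.
    by have [<- _] := invIK l k al_l ak; rewrite mulmx_id_sub.
  by have [<- _] := invL l k al_l ak; rewrite mulmx_id_sub.
have inE l M : (al <= l)%N -> (maxn l n < M)%N -> (al <= M)%N ->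
    inner_ge al (IK l) v = \sum_(al <= k < M) L l k * v k.
  move=> al_l lM aM; rewrite (@inner_ge_finite _ _ M) => [|k Mk].
    rewrite big_nat_cond [RHS]big_nat_cond; apply: eq_bigr => k /andP[/andP[ak _] _].
    by rewrite IKE.
  by rewrite (IKE _ _ al_l (leq_trans aM Mk)) Lfin ?mul0r // (leq_trans lM).
move=> l al_l; pose M := (maxn l n).+1.
have aM : (al <= M)%N by rewrite (leq_trans al_l) // leqW // leq_maxl.
rewrite (inE l M) //.
have -> : \sum_(al <= k < n.+1) K l k * inner_ge al (IK k) v =
    \sum_(al <= k < n.+1) K l k * \sum_(al <= i < M) L k i * v i.
  rewrite big_nat_cond [RHS]big_nat_cond; apply: eq_bigr => k /andP[/andP[ak kn] _].
  by rewrite (inE k M) // /M; lia.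
under [X in _ - X]eq_bigr do rewrite mulr_sumr.
rewrite exchange_big /= -sumrB -[RHS](@sum_delta v l M) ?al_l ?ltnS ?leq_maxl //.
rewrite big_nat_cond [RHS]big_nat_cond; apply: eq_bigr => k /andP[/andP[ak _] _].
have [<- _] := invL l k al_l ak; rewrite mulmx_id_sub // mulrBl; congr (_ - _).
by rewrite mulr_suml; apply: eq_bigr => i _; rewrite mulrA.
Qed.

End BlockTriangularInverse.

(** * The kernel of the double Aztec diamond *)

Section AztecKernel.
Variables (R : realType) (a : R) (g g' : R -> R[i]).
Hypotheses (a_gt0 : 0 < a) (Hg : is_Gamma0 a g) (Hg' : is_Gamma0u a g g').
Local Notation ac := (a%:C)%C.
Local Notation bc := ((- a^-1)%:C)%C.
Local Notation ins := [:: 0; ac].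
Local Notation outs := [:: bc].
Local Notation rho := (residue_sum g).
Local Notation D := (pairing g g').

Lemma enclosesP (h : R -> R[i]) p : encloses h p -> residue_value h 1 p.
Proof. by move=> [off wind]; split => // t tI; apply/eqP => E; apply: off; exists t. Qed.

Lemma does_not_encloseP (h : R -> R[i]) p : does_not_enclose h p -> residue_value h 0 p.
Proof. by move=> [off wind]; split => // t tI; apply/eqP => E; apply: off; exists t. Qed.

Lemma Gamma0_ins (h : R -> R[i]) : is_Gamma0 a h -> {in ins, forall p, residue_value h 1 p}.
Proof. by move=> [_ h1 h2 _] p; rewrite !inE => /orP[]/eqP ->; exact: enclosesP. Qed.

Lemma Gamma0_outs (h : R -> R[i]) : is_Gamma0 a h -> {in outs, forall p, residue_value h 0 p}.
Proof. by move=> [_ _ _ h0] p; rewrite !inE => /eqP ->; exact: does_not_encloseP. Qed.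

Lemma Gamma_nested : nested_contours g g' ins outs.
Proof.
have [h' nest] := Hg'; split.
- by case: Hg => -[].
- by case: Hg => -[].
- by case: h' => -[].
- by case: h' => -[].
- exact: Gamma0_ins.
- exact: Gamma0_outs.
- exact: Gamma0_ins.
- exact: Gamma0_outs.
- by move=> t tI; exact/enclosesP/nest.
Qed.

Lemma ac_neq0 : ac != 0.
Proof. by rewrite eq_complex /= negb_and gt_eqF. Qed.

Lemma acbc : ac * bc = -1.
Proof. by rewrite -rmorphM /= mulrN divff ?gt_eqF // rmorphN rmorph1. Qed.

Definition generic (z : R[i]) := z \notin ins ++ outs.

Lemma genericP z : generic z -> [/\ z != 0, z - ac != 0 & 1 + ac * z != 0].
Proof.
rewrite /generic !inE !negb_or => /and3P[z0 za zb]; split => //.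
  by rewrite subr_eq0.
by rewrite addrC -[1]opprK -acbc -mulrBr mulf_neq0 ?ac_neq0 // subr_eq0.
Qed.

(** All functions that occur are of this form, so that identities between
    them reduce to linear arithmetic on exponents. *)
Definition mono (i j k : int) (z : R[i]) : R[i] :=
  z ^ i * (z - ac) ^ j * (1 + ac * z) ^ k.

Lemma monoM i j k i' j' k' z : generic z ->
  mono i j k z * mono i' j' k' z = mono (i + i') (j + j') (k + k') z.
Proof.
move=> /genericP[z0 za zb]; rewrite /mono !expfzDr //; ring.
Qed.

Definition int_pos (i : int) : nat := if i is Posz p then p else 0%N.
Definition int_neg (i : int) : nat := if i is Negz p then p.+1 else 0%N.

Lemma int_pos_negE i : (int_pos i)%:Z - (int_neg i)%:Z = i.
Proof. by case: i => p; rewrite /= ?subr0 // sub0r NegzE. Qed.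

Lemma exprz_pos_neg (z : R[i]) i : z ^ i = z ^+ int_pos i / z ^+ int_neg i.
Proof. by case: i => p; rewrite /= ?expr0 ?invr1 ?mulr1 // mul1r. Qed.

Definition mono_num i j k : {poly R[i]} :=
  ac^-1 ^+ int_neg k *: ('X ^+ int_pos i * ('X - ac%:P) ^+ int_pos j * caffine a ^+ int_pos k).

Definition mono_den i j k : seq R[i] :=
  nseq (int_neg i) 0 ++ nseq (int_neg j) ac ++ nseq (int_neg k) bc.

Lemma size_mono_num i j k :
  (size (mono_num i j k) <= (int_pos i + int_pos j + int_pos k).+1)%N.
Proof.
apply: leq_trans (size_scale_leq _ _) _.
apply: leq_trans (size_polyMleq _ _) _.
have := size_polyMleq (polyX R[i] ^+ int_pos i) (('X - ac%:P) ^+ int_pos j).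
rewrite size_polyXn size_exp_XsubC.
have : (size (caffine a ^+ int_pos k) <= (int_pos k).+1)%N.
  by rewrite caffineE -rmorphXn /= size_map_poly size_affine_exp.
by move: (size (caffine a ^+ int_pos k)%R) (size (_ * _ : {poly R[i]})%R) => p q; lia.
Qed.

Lemma mono_ratf i j k z : generic z ->
  mono i j k z = ratf (mono_num i j k) (mono_den i j k) z.
Proof.
move=> gz; have [z0 za zb] := genericP gz.
rewrite /mono /ratf /mono_num /mono_den !exprz_pos_neg !big_cat /= !big_nseq.
rewrite !iter_mulr_1 hornerZ !hornerM !horner_exp hornerX hornerXsubC subr0.
have -> : (caffine a).[z] = 1 + ac * z by rewrite !hornerE addrC.
have -> : z - bc = ac^-1 * (1 + ac * z).
  rewrite mulrDr mulKf ?ac_neq0 // mulr1 addrC; congr (_ + _).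
  by rewrite -[- bc]mul1r -(mulVf ac_neq0) -mulrA mulrN acbc opprK mulr1.
have h1 := expf_neq0 (int_neg i) z0; have h2 := expf_neq0 (int_neg j) za.
have h3 := expf_neq0 (int_neg k) zb; have h4 := expf_neq0 (int_neg k) (invr_neq0 ac_neq0).
rewrite exprMn; field.
by rewrite h1 h2 h3 h4.
Qed.

Local Notation is_rat := (is_rat ins outs).
Local Notation is_reg := (is_reg ins outs).
Local Notation is_pol := (is_pol ins outs).

Lemma mono_rat i j k : is_rat (mono i j k).
Proof.
exists (mono_num i j k), (mono_den i j k); split => //; last by move=> z; exact: mono_ratf.
move=> z; rewrite !mem_cat !mem_nseq !inE.
by case/or3P => /andP[_ ->]; rewrite ?orbT.
Qed.

Lemma mono_reg i j k : 0 <= i -> 0 <= j -> is_reg (mono i j k).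
Proof.
case: i => // i _; case: j => // j _.
exists (mono_num i j k), (mono_den i j k); split => //; last by move=> z; exact: mono_ratf.
by move=> z; rewrite mem_nseq => /andP[_ /eqP ->]; rewrite inE.
Qed.

Lemma mono_pol i j k : 0 <= k -> i + j + k < 0 -> is_pol (mono i j k).
Proof.
case: k => // k _ deg.
exists (mono_num i j k), (mono_den i j k); split => //; last by move=> z; exact: mono_ratf.
  move=> z; rewrite !mem_cat !mem_nseq !inE.
  by case/or3P => /andP[h e] //; rewrite e ?orbT.
apply: leq_trans (size_mono_num _ _ _) _; rewrite !size_cat !size_nseq /= addn0.
by have := int_pos_negE i; have := int_pos_negE j; move: deg; lia.
Qed.

(** No pole outside the contour, and a double zero at infinity. *)
Lemma rho_mono_eq0 i j k : 0 <= k -> i + j + k < -1 -> rho (mono i j k) = 0.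
Proof.
case: k => // k _ deg.
rewrite (residue_eq Gamma_nested (@mono_ratf i j k)).
have sz : (size (mono_num i j k) < size (mono_den i j k))%N.
  apply: leq_ltn_trans (size_mono_num _ _ _) _; rewrite !size_cat !size_nseq /= addn0.
  by have := int_pos_negE i; have := int_pos_negE j; move: deg; lia.
rewrite (rho_pole Gamma_nested); last exact: ltnW.
  by rewrite nth_default // -ltnS prednK // (leq_ltn_trans _ sz).
move=> z; rewrite !mem_cat !mem_nseq !inE.
by case/or3P => /andP[h e] //; rewrite e ?orbT.
Qed.

Lemma rho_mono_reg i j k : 0 <= i -> 0 <= j -> rho (mono i j k) = 0.
Proof. by move=> i0 j0; apply: (rho_reg Gamma_nested); exact: mono_reg. Qed.

Lemma rho_mono_power i : rho (mono i 0 0) = (i == -1)%:R.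
Proof.
have [->|i1] := eqVneq i (-1).
  rewrite (residue_eq Gamma_nested (@mono_ratf (-1) 0 0)).
  rewrite (rho_pole Gamma_nested).
  - by rewrite /mono_num /= !expr0 mulr1 mulr1 scale1r coef1.
  - by move=> z; rewrite !inE => /eqP ->; rewrite eqxx.
  - by rewrite /mono_num /= !expr0 mulr1 mulr1 scale1r size_poly1.
have [i0|i0] := leP 0 i; first exact: rho_mono_reg.
by apply: rho_mono_eq0 => //; lia.
Qed.

Variables (n N : nat).
Hypothesis N_bounds : (0 < N <= n)%N.

(** e_k = z^k psi and f_l = z^(-l-1) / psi, where psi = (1+az)^n
    (1-a/z)^(n+1). *)
Definition e_fun (k : nat) := mono (k%:Z - n%:Z - 1) (n%:Z + 1) n%:Z.
Definition f_fun (l : nat) := mono (n%:Z - l%:Z) (- (n%:Z + 1)) (- n%:Z).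

(** The matrix K_n without its signs (-1)^(j+k). *)
Definition K_unsigned (j k : nat) : R[i] := D (e_fun k) (f_fun j).

Lemma e_rat k : is_rat (e_fun k). Proof. exact: mono_rat. Qed.

Lemma f_rat l : is_rat (f_fun l). Proof. exact: mono_rat. Qed.

Lemma e_reg k : (n < k)%N -> is_reg (e_fun k).
Proof. by move=> nk; apply: mono_reg; lia. Qed.

Lemma mono_eq i j k i' j' k' z : i = i' -> j = j' -> k = k' ->
  mono i j k z = mono i' j' k' z.
Proof. by move=> -> -> ->. Qed.

Lemma fe_orthogonal k l : rho (fun z => f_fun l z * e_fun k z) = (l == k)%:R.
Proof.
rewrite (residue_eq Gamma_nested (G := mono (k%:Z - l%:Z - 1) 0 0)).
  rewrite rho_mono_power; congr (_%:R); congr nat_of_bool.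
  by apply/eqP/eqP => [|->]; lia.
by move=> z gz; rewrite monoM //; apply: mono_eq; lia.
Qed.

Lemma pairing_fe k l : D (f_fun l) (e_fun k) = (l == k)%:R - K_unsigned l k.
Proof.
rewrite -fe_orthogonal.
rewrite -(pairing_sym Gamma_nested
   (f_rat l) (e_rat k)).
by rewrite /K_unsigned addrK.
Qed.

Lemma K_unsigned_vanish j k : (n < k)%N -> K_unsigned j k = 0.
Proof.
move=> nk.
exact: (reg_pairing Gamma_nested
  (e_reg nk) (f_rat j)).
Qed.

Lemma sum_rat (I : Type) (s : seq I) (c : I -> R[i]) (F : I -> R[i] -> R[i]) :
  (forall i, is_rat (F i)) -> is_rat (fun z => \sum_(i <- s) c i * F i z).
Proof.
move=> rF; elim: s => [|i s IH].
  apply: (@rational_eq _ _ _ _ _ (fun=> 0)) (rational0 _ _ _ _) => z _.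
  by rewrite big_nil.
apply: (@rational_eq _ _ _ _ _ (fun z => c i * F i z + \sum_(i <- s) c i * F i z)).
  by move=> z _; rewrite big_cons.
by apply: (rationalD _ (rationalZ (c i) (rF i)) IH).
Qed.

Lemma pairing_sumr G (I : Type) (s : seq I) (c : I -> R[i]) (F : I -> R[i] -> R[i]) :
  is_rat G -> (forall i, is_rat (F i)) ->
  D G (fun z => \sum_(i <- s) c i * F i z) = \sum_(i <- s) c i * D G (F i).
Proof.
move=> rG rF; elim: s => [|i s IH].
  rewrite big_nil (pairing_eq Gamma_nested (F' := G) (G' := fun=> 0)) //.
    exact: (pairing_pol Gamma_nested rG
      (rational0 _ _ _ _)).
  by move=> z _; rewrite big_nil.
rewrite big_cons -IH -(pairingZr Gamma_nested) //.
have rS : is_rat (fun z => \sum_(j <- s) c j * F j z) by exact: sum_rat.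
have <- := pairingDr Gamma_nested rG
  (rationalZ (c i) (rF i)) rS.
by apply: (pairing_eq Gamma_nested) => // z _; rewrite big_cons.
Qed.

Lemma coprime_caffine : coprimep (caffine a ^+ n) (('X - ac%:P) ^+ n.+1).
Proof.
apply/coprimep_expl/coprimep_expr; rewrite coprimep_XsubC /root !hornerE.
have -> : ac * ac + 1 = (a ^+ 2 + 1)%:C%C by rewrite rmorphD rmorphXn rmorph1 /= expr2.
rewrite eq_complex /= negb_and gt_eqF // ltr_wpDl ?sqr_ge0 //.
Qed.

(** Let c be a null vector and w the polynomial with coefficients c_N, ...,
    c_n. The combination x of the e_k with coefficients c_k satisfies D(f_l,
    x) = 0 for l between N and n. Cut the numerator w (z-a)^(n+1) (1+az)^n
    of x at order n-N+1: the low part y gives the principal part of x at 0,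
    the high part X its regular part. Splitting X over the coprime factors
    as U (1+az)^n + V (z-a)^(n+1), the vanishing of D(f_l, x) = rho(f_l X)
    kills the leading coefficients of U one after the other, down to deg U <
    N. Then [mixed_root_vanish_complex] gives y = 0, so z^(n-N+1) divides w,
    whose degree is at most n-N. *)
Lemma K_unsigned_block_injective : block_injective N n K_unsigned.
Proof.
have /andP[N0 Nn] := N_bounds.
move=> c cK.
pose d := (n - N).+1.
pose wp : {poly R[i]} := \poly_(i < d) c (N + i)%N.
pose Z : {poly R[i]} := wp * ('X - ac%:P) ^+ n.+1 * caffine a ^+ n.
pose x z := \sum_(N <= k < n.+1) c k * e_fun k z.
pose y := take_poly d Z; pose X := drop_poly d Z.
have xE z : generic z -> x z = X.[z] + ratf y (nseq d 0) z.
  move=> gz; have [z0 za zb] := genericP gz.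
  have -> : x z = Z.[z] / z ^+ d.
    rewrite /x /Z !hornerM !horner_exp hornerXsubC horner_poly.
    rewrite -{1}[N]add0n big_addn subSn // -/d big_mkord.
    rewrite -!mulrA mulr_suml; apply: eq_bigr => i _.
    rewrite /e_fun /mono [(i + N)%N]addnC -[in RHS]mulrA; congr (_ * _).
    have -> : (N + i)%N%:Z - n%:Z - 1 = i%:Z - d%:Z by rewrite /d; lia.
    rewrite expfzDr // -exprnN.
    have -> : (z - ac) ^ (n%:Z + 1) = (z - ac) ^+ n.+1 by rewrite -addn1.
    rewrite -!exprnP.
    have -> : (caffine a).[z] = 1 + ac * z by rewrite !hornerE addrC.
    by rewrite -exprVn; ring.
  rewrite -[Z](poly_take_drop d) hornerD hornerM hornerXn mulrDl mulfK ?expf_neq0 //.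
  rewrite addrC; congr (_ + _); rewrite /ratf big_nseq iter_mulr_1 subr0 //.
have polY : is_pol (ratf y (nseq d 0)).
  exists y, (nseq d 0); split => //; last by rewrite size_nseq; exact: size_take_poly.
  by move=> p; rewrite mem_nseq => /andP[_ /eqP ->]; exact: mem_head.
have regX : is_reg (fun z => X.[z]).
  by exists X, [::]; split => // z _; rewrite /ratf big_nil divr1.
have ratx : is_rat x by apply: sum_rat => k; exact: e_rat.
have fx0 l : (N <= l <= n)%N -> D (f_fun l) x = 0.
  move=> lI; rewrite (pairing_sumr _ _ (f_rat l) e_rat).
  under eq_bigr do rewrite pairing_fe mulrBr [_ * K_unsigned _ _]mulrC.
  rewrite sumrB -(cK l lI).
  under eq_bigr do rewrite mulrC.
  by rewrite sum_delta ?subrr // ltnS.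
have rX l : (N <= l <= n)%N -> rho (fun z => f_fun l z * X.[z]) = 0.
  move=> lI; rewrite -(fx0 l lI).
  by rewrite (pairing_split Gamma_nested
    (f_rat l) regX polY xE).
have [[u v] /= uv] := Bezout_eq1_coprimepP _ _ coprime_caffine.
pose B : {poly R[i]} := ('X - ac%:P) ^+ n.+1.
pose U := (X * u) %% B; pose V := (X * u) %/ B * caffine a ^+ n + X * v.
have XE : X = U * caffine a ^+ n + V * B.
  rewrite -[LHS]mulr1 -uv mulrDr !mulrA {1}[X * u](divp_eq _ B) -/B -/U /V; ring.
have B0 : B != 0 by rewrite expf_neq0 // polyXsubC_eq0.
have sU0 : (size U <= n.+1)%N.
  by rewrite -ltnS -[n.+2](size_exp_XsubC n.+1 ac) ltn_modp.
(* The index l = n - q gives the coefficient of degree n - q of U, which is the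
   leading one once the previous coefficients are known to vanish. *)
have sU q : (q <= d)%N -> (size U <= n.+1 - q)%N.
  elim: q => [|q IH] qd; first by rewrite subn0.
  have sq := IH (ltnW qd).
  have qn : (q <= n)%N by move: qd; rewrite /d; lia.
  have : rho (ratf ('X^q * U) (nseq n.+1 ac)) = 0.
    have lI : (N <= n - q <= n)%N by move: qd; rewrite /d; lia.
    have := rX _ lI.
    rewrite (residue_eq Gamma_nested (G := fun z => ratf ('X^q * U) (nseq n.+1 ac) z +
      ratf ('X^q * V) [::] z * mono 0 0 (- n%:Z) z)).
      rewrite (rho_add Gamma_nested).
      - rewrite [X in _ + X](rho_reg Gamma_nested) ?addr0 //.
        apply: rationalM; first by exists ('X^q * V), [::].
        exact: mono_reg.
      - exists ('X^q * U), (nseq n.+1 ac); split => // p.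
        by rewrite mem_nseq => /andP[_ /eqP ->]; rewrite !inE eqxx orbT.
      - apply: rationalM; last exact: mono_rat.
        by exists ('X^q * V), [::].
    move=> z gz; have [z0 za zb] := genericP gz.
    rewrite XE /f_fun /mono /ratf big_nil big_nseq iter_mulr_1.
    have -> : n%:Z - (n - q)%N%:Z = q by lia.
    have -> : n%:Z + 1 = n.+1 by lia.
    rewrite -!exprnN -!exprnP hornerD !hornerM !horner_exp hornerX hornerXsubC.
    have -> : (caffine a).[z] = 1 + ac * z by rewrite !hornerE addrC.
    have h1 := expf_neq0 n zb; have h2 := expf_neq0 n.+1 za.
    by rewrite !expr0 !mul1r divr1; field; rewrite h1 h2.
  rewrite (rho_pole Gamma_nested).
  - rewrite size_nseq coefXnM ltnNge qn /= => Uq.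
    have e : (n.+1 - q)%N = (n - q).+1 by lia.
    rewrite subnS e /=; apply/leq_sizeP => j; rewrite leq_eqVlt => /orP[/eqP <- //|nqj].
    by apply: nth_default; rewrite (leq_trans sq) // e.
  - by move=> p; rewrite mem_nseq => /andP[_ /eqP ->]; rewrite !inE eqxx orbT.
  - rewrite size_nseq; apply: leq_trans (size_polyMleq _ _) _.
    by rewrite size_polyXn; move: (size U) sq => p sq; clear -sq qn; lia.
have y0 : y = 0.
  apply: (@mixed_root_vanish_complex _ a a_gt0 n N y U (wp * caffine a ^+ n - 'X^d * V)) => //.
  - exact: size_take_poly.
  - by apply: leq_trans (sU d (leqnn d)) _; rewrite /d; clear -Nn; lia.
  have : Z = y + X * 'X^d by rewrite poly_take_drop.
  rewrite /Z XE -/B => ZE.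
  have -> : y = wp * B * caffine a ^+ n - (U * caffine a ^+ n + V * B) * 'X^d.
    by rewrite ZE addrK.
  rewrite -/d; ring.
have dvZ : 'X^d %| wp.
  have : 'X^d %| Z by rewrite -[Z](poly_take_drop d) -/y y0 add0r dvdp_mull.
  have coX (p : {poly R[i]}) : p.[0] != 0 -> coprimep 'X p.
    by move=> p0; rewrite coprimep_sym -['X]subr0 -polyC0 coprimep_XsubC.
  rewrite /Z -mulrA Gauss_dvdpl // coprimep_expl // coX // hornerM !horner_exp.
  apply: mulf_neq0; apply: expf_neq0.
    by rewrite hornerXsubC sub0r oppr_eq0 ac_neq0.
  by rewrite hornerD hornerZ hornerX hornerC mulr0 add0r oner_eq0.
have wp0 : wp = 0.
  apply/eqP; apply: contraT => w0; have := dvdp_leq w0 dvZ.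
  by rewrite size_polyXn leqNgt ltnS size_poly.
move=> l lI; have := congr1 (fun p : {poly R[i]} => p`_(l - N)) wp0.
rewrite coef_poly coef0 subnKC; last by case/andP: lI.
by have -> : (l - N < d)%N by move: lI; rewrite /d; lia.
Qed.

Lemma eq_mul (x y z t : R[i]) : x = y -> z = t -> x * z = y * t.
Proof. by move=> -> ->. Qed.

Lemma eq_mull (x y z : R[i]) : y = z -> x * y = x * z.
Proof. by move=> ->. Qed.

Lemma mono_z i z : z ^ i = mono i 0 0 z.
Proof. by rewrite /mono !expr0z !mulr1. Qed.

Lemma mono_za j z : (z - ac) ^ j = mono 0 j 0 z.
Proof. by rewrite /mono !expr0z mulr1 mul1r. Qed.

Lemma mono_zb k z : (1 + ac * z) ^ k = mono 0 0 k z.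
Proof. by rewrite /mono !expr0z !mul1r. Qed.

Lemma mono_div k z : generic z -> (1 - ac / z) ^ k = mono (- k) k 0 z.
Proof.
move=> /genericP[z0 za zb]; have -> : 1 - ac / z = (z - ac) * z^-1 by field.
by rewrite expfzMl exprz_inv /mono expr0z mulr1 mulrC.
Qed.

Lemma monoV i j k z : (mono i j k z)^-1 = mono (- i) (- j) (- k) z.
Proof. by rewrite /mono !invfM !invr_expz. Qed.

Lemma pairingE (F G : R[i] -> R[i]) (Phi : R[i] -> R[i] -> R[i]) :
  (forall u v, generic u -> generic v -> Phi u v = (v - u)^-1 * (F u * G v)) ->
  double_integral g g' Phi = D F G.
Proof.
move=> E; rewrite /pairing /double_integral; apply: (congr1 (fun x => two_pi_i R ^- 2 * x)).
apply: eq_contour => t tI; apply: eq_contour => s sI.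
by apply: E; [exact: (generic_on_curve Gamma_nested)|exact: (generic_on_curve' Gamma_nested)].
Qed.

(** The vector a_{x,2s+eps} is defined with u-v in the denominator, whence
    the sign. *)
Lemma pairingNE (F G : R[i] -> R[i]) (Phi : R[i] -> R[i] -> R[i]) :
  is_rat F -> is_rat G ->
  (forall u v, generic u -> generic v -> Phi u v = (u - v)^-1 * (F u * G v)) ->
  double_integral g g' Phi = - D F G.
Proof.
move=> rF rG E; have <- : D (fun z => -1 * F z) G = - D F G.
  by have -> := pairingZl Gamma_nested (-1) rF rG; rewrite mulN1r.
apply: pairingE => u v gu gv.
by rewrite E // -[u - v]opprB invrN; ring.
Qed.

Lemma sgnzz (k : int) : (-1 : R[i]) ^ k * (-1) ^ k = 1.
Proof. by rewrite -expfzMl mulrNN mulr1 exp1rz. Qed.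

Lemma sgnzD (k l : int) : (-1 : R[i]) ^ (k + l) = (-1) ^ k * (-1) ^ l.
Proof. by rewrite expfzDr // oppr_eq0 oner_eq0. Qed.

Lemma sgnzN (k : int) : (-1 : R[i]) ^ (- k) = (-1) ^ k.
Proof. by rewrite -exprz_inv invrN1. Qed.

Lemma K_opE j k : K_op n a g g' j k = (-1) ^ (j%:Z + k%:Z) * K_unsigned j k.
Proof.
rewrite /K_op; apply: eq_mull; apply: pairingE => u v gu gv; apply: eq_mull.
transitivity ((u ^ (n%:Z + 1 - k%:Z))^-1 * (1 + ac * u) ^ n%:Z * (u - ac) ^ (n%:Z + 1) *
  (v ^ (n%:Z - j%:Z) * ((1 + ac * v) ^ n%:Z)^-1 * ((v - ac) ^ (n%:Z + 1))^-1)).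
  by rewrite !invfM; ring.
rewrite !mono_za !mono_zb !mono_z !monoV.
by apply: eq_mul; rewrite !monoM //; apply: mono_eq; lia.
Qed.

(** The dependence of the kernel on the white vertex (2i+1, 2s). *)
Definition phi (i s : int) := mono (i - n%:Z) (n%:Z - s) s.
(** The dependence of the kernel on the black vertex (2j, 2r-1). *)
Definition beta (j r : int) := mono (n%:Z - j) (r - n%:Z - 1) (- r).

Lemma S_kernelE (m : nat) (i j r s : int) :
  S_kernel n m a g g' r 0 (r + m%:Z - j) s 1 (s + m%:Z - i) =
  (-1) ^ (r + m%:Z - j - (s + m%:Z - i)) * D (phi i s) (beta j r).
Proof.
rewrite /S_kernel; apply: eq_mull; apply: pairingE => u v gu gv.
rewrite -mulrA; apply: eq_mull.
transitivity ((u ^ (s + m%:Z - i - m%:Z))^-1 * (1 + ac * u) ^ s * (1 - ac / u) ^ (n%:Z - s + 1 - 1) *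
  (v ^ (r + m%:Z - j - m%:Z - 1) * ((1 + ac * v) ^ r)^-1 * ((1 - ac / v) ^ (n%:Z - r + 1 - 0))^-1)).
  by rewrite !invfM; ring.
rewrite !mono_div // !mono_zb !mono_z !monoV.
by apply: eq_mul; rewrite !monoM //; apply: mono_eq; lia.
Qed.

Lemma a_vecE (m : nat) (i s : int) k :
  a_vec n m a g g' (- (s + m%:Z - i)) s 1 k =
  - ((-1) ^ (k%:Z + (s + m%:Z - i)) * D (f_fun k) (phi i s)).
Proof.
rewrite /a_vec opprK -mulrN; apply: eq_mull; apply: pairingNE => [||u v gu gv]; try exact: mono_rat.
rewrite -mulrA; apply: eq_mull.
transitivity ((u ^ (k%:Z + 1))^-1 * ((1 + ac * u) ^ n%:Z)^-1 * ((1 - ac / u) ^ (n%:Z + 1))^-1 *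
  (v ^ (- (s + m%:Z - i) + m%:Z) * (1 + ac * v) ^ s * (1 - ac / v) ^ (n%:Z - s + 1 - 1))).
  by rewrite !invfM; ring.
rewrite !mono_div // !mono_zb !mono_z !monoV.
by apply: eq_mul; rewrite !monoM //; apply: mono_eq; lia.
Qed.

Lemma b_vecE (m : nat) (j r : int) k :
  b_vec n m a g g' (- (r + m%:Z - j)) r 0 k =
  (-1) ^ (k%:Z + (r + m%:Z - j)) * D (beta j r) (e_fun k).
Proof.
rewrite /b_vec opprK; apply: eq_mull; apply: pairingE => u v gu gv.
rewrite -mulrA; apply: eq_mull.
transitivity ((u ^ (- (r + m%:Z - j) + m%:Z + 1))^-1 * ((1 + ac * u) ^ r)^-1 *
    ((1 - ac / u) ^ (n%:Z - r + 1 - 0))^-1 *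
  (v ^ k%:Z * (1 + ac * v) ^ n%:Z * (1 - ac / v) ^ (n%:Z + 1))).
  by rewrite !invfM; ring.
rewrite !mono_div // !mono_zb !mono_z !monoV.
by apply: eq_mul; rewrite !monoM //; apply: mono_eq; lia.
Qed.

Lemma psi_kernelE (m : nat) (i j r s : int) :
  psi_kernel a g r 0 s 1 (r + m%:Z - j) (s + m%:Z - i) =
  rho (fun z => phi i s z * beta j r z).
Proof.
transitivity (rho (mono (i - j) (r - s - 1) (s - r))); last first.
  apply: (residue_eq Gamma_nested) => z gz; rewrite monoM //; apply: mono_eq; lia.
have [P [ps [sP _ ME]]] := mono_rat (i - j) (r - s - 1) (s - r).
rewrite (residue_eq Gamma_nested ME) /psi_kernel /residue_sum.
have [_ <-] := contourZ (two_pi_i R)^-1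
   (curve_cont_integrable (nc_piecewise Gamma_nested) (ratf_cont Gamma_nested P sP)).
apply: eq_contour => t tI; have gz := generic_on_curve Gamma_nested tI; rewrite -ME //.
move: (g t) gz => z gz; rewrite invfM -!mulrA; apply: eq_mull.
rewrite mono_div // -[z in z^-1]expr1z !mono_zb !mono_z !monoV !monoM //.
by apply: mono_eq; lia.
Qed.

(** Conjugating the matrix by the signs (-1)^k. *)
Lemma solves_signed (y : int) (v c : nat -> R[i]) :
  solves N n K_unsigned v c ->
  solves N n (K_op n a g g') (fun k => - ((-1) ^ (k%:Z + y) * v k))
    (fun k => - ((-1) ^ (k%:Z + y) * c k)).
Proof.
move=> sc l Nl; rewrite -(sc l Nl).
have -> : \sum_(N <= k < n.+1) K_op n a g g' l k * - ((-1) ^ (k%:Z + y) * c k) =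
    - ((-1) ^ (l%:Z + y) * \sum_(N <= k < n.+1) K_unsigned l k * c k).
  rewrite mulr_sumr -sumrN; apply: eq_bigr => k _.
  rewrite K_opE !sgnzD mulrN; have e := sgnzz k.
  transitivity (- (((-1) ^ k%:Z * (-1) ^ k%:Z) * ((-1) ^ l%:Z * K_unsigned l k * (-1) ^ y * c k))).
    by ring.
  by rewrite e; ring.
by ring.
Qed.

Definition solution F c := solves N n K_unsigned (fun l => D (f_fun l) F) c.

Lemma K_op_vanish j k : (n < k)%N -> K_op n a g g' j k = 0.
Proof. by move=> nk; rewrite K_opE K_unsigned_vanish // mulr0. Qed.

Lemma K_op_block_injective : block_injective N n (K_op n a g g').
Proof.
move=> c cK.
have sg (k : nat) : (-1 : R[i]) ^ k%:Z != 0 by rewrite expfz_neq0 // oppr_eq0 oner_eq0.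
have := @K_unsigned_block_injective (fun k => (-1) ^ k%:Z * c k) _.
move=> H l lI; have /eqP : (-1) ^ l%:Z * c l = 0.
  apply: H lI => {l} l lI; rewrite (cK l lI) mulr_sumr; apply: eq_bigr => k _.
  rewrite K_opE sgnzD; have := sgnzz l => e.
  transitivity (((-1) ^ l%:Z * (-1) ^ l%:Z) * ((-1) ^ k%:Z * K_unsigned l k * c k)); first by ring.
  by rewrite e; ring.
by rewrite mulf_eq0 (negbTE (sg l)) => /eqP.
Qed.

Lemma solution_exists F : exists c, solution F c.
Proof. by eexists; exact: (inverse_ge_solves K_unsigned_vanish K_unsigned_block_injective). Qed.

Lemma solution_unique F c d : solution F c -> solution F d ->
  forall l, (N <= l)%N -> c l = d l.
Proof. move=> sc sd; exact: (solves_unique K_unsigned_block_injective sc sd). Qed.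

Definition kernel_value (i j r s : int) (c : nat -> R[i]) (M : nat) : R[i] :=
  - ((s < r)%R%:R * rho (fun z => phi i s z * beta j r z)) +
  (D (phi i s) (beta j r) + \sum_(N <= k < M) c k * D (beta j r) (e_fun k)).

(** The signs in K_n and in the two vectors cancel, and the inverse matrix
    applied to the first vector is the unique solution of the linear system. *)
Lemma KK_value (m : nat) (i j r s : int) c M : N = (2 * m + 1)%N ->
  solution (phi i s) c ->
  (forall k, (M <= k)%N -> D (beta j r) (e_fun k) = 0) ->
  KK n m a g g' (2 * r) (r + m%:Z - j) (2 * s + 1) (s + m%:Z - i) =
  kernel_value i j r s c M.
Proof.
move=> Nm correction_coef bM; rewrite /KK -Nm.
have -> : (2 * r %/ 2)%Z = r by rewrite mulKz.
have -> : (2 * r %% 2)%Z = 0 by rewrite modzMr.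
have -> : ((2 * s + 1) %/ 2)%Z = s by rewrite mulrC divzMDl // addr0.
have -> : ((2 * s + 1) %% 2)%Z = 1 by rewrite mulrC modzMDl.
rewrite psi_kernelE S_kernelE /kernel_value.
set x := r + m%:Z - j; set y := s + m%:Z - i.
have -> : (2 * s + 1 < 2 * r :> int) = (s < r) by apply/idP/idP; lia.
rewrite -addrA; congr (_ + _).
rewrite mulrA sgnzz mul1r; congr (_ + _).
set IK := inverse_ge N _.
set av := a_vec n m a g g' (- y) s 1.
have avE : av = fun k => - ((-1) ^ (k%:Z + y) * D (f_fun k) (phi i s)).
  by apply/funext => k; rewrite /av a_vecE.
have s1 : solves N n (K_op n a g g') av (fun k => inner_ge N (IK k) av).
  exact: (inverse_ge_solves K_op_vanish K_op_block_injective).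
have s2 : solves N n (K_op n a g g') av (fun k => - ((-1) ^ (k%:Z + y) * c k)).
  by rewrite avE; exact: solves_signed.
have cE := solves_unique K_op_block_injective s1 s2.
rewrite (@inner_ge_finite _ _ _ _ M); last first.
  by move=> k Mk; rewrite b_vecE bM // mulr0 mulr0.
rewrite mulr_sumr -sumrN big_nat_cond [RHS]big_nat_cond.
apply: eq_bigr => k /andP[/andP[Nk _] _].
rewrite cE // b_vecE -/x (sgnzD x (- y)) (sgnzD k y) (sgnzD k x) (sgnzN y).
transitivity (((-1) ^ k%:Z * (-1) ^ k%:Z) * (((-1) ^ x * (-1) ^ x) * ((-1) ^ y * (-1) ^ y)) *
   (c k * D (beta j r) (e_fun k))); first by ring.
by rewrite !sgnzz !mul1r.
Qed.

Lemma phi_rat i s : is_rat (phi i s). Proof. exact: mono_rat. Qed.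

Lemma beta_rat j r : is_rat (beta j r). Proof. exact: mono_rat. Qed.

(** For k > n the function e_k is a polynomial, and the factor z^k removes
    the pole of beta at 0 as soon as k > j; the sum over k in the kernel is
    therefore finite. *)
Lemma beta_e_vanish (j r k : nat) : (r <= n)%N -> (n < k)%N -> (j < k)%N ->
  D (beta j r) (e_fun k) = 0.
Proof.
move=> rn nk jk; rewrite (pairing_reg Gamma_nested (beta_rat j r) (e_reg nk)).
rewrite (residue_eq Gamma_nested (G := mono (k%:Z - j%:Z - 1) r%:Z (n%:Z - r%:Z))).
  by apply: rho_mono_reg; lia.
by move=> z gz; rewrite /beta /e_fun monoM //; apply: mono_eq; lia.
Qed.

Lemma solution0 F : (forall l, (N <= l)%N -> D (f_fun l) F = 0) -> solution F (fun=> 0).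
Proof.
move=> F0 l Nl; rewrite F0 // sub0r big1 ?oppr0 // => k _; by rewrite mulr0.
Qed.

Lemma solutionD F G c d : is_rat F -> is_rat G -> solution F c -> solution G d ->
  solution (fun z => F z + G z) (fun k => c k + d k).
Proof.
move=> rF rG sc sd l Nl.
have -> := pairingDr Gamma_nested (f_rat l) rF rG.
rewrite -(sc l Nl) -(sd l Nl).
under eq_bigr do rewrite mulrDr.
by rewrite big_split /=; ring.
Qed.

Lemma solutionZ x F c : is_rat F -> solution F c ->
  solution (fun z => x * F z) (fun k => x * c k).
Proof.
move=> rF sc l Nl.
have -> := pairingZr Gamma_nested x (f_rat l) rF.
rewrite -(sc l Nl) mulrBr mulr_sumr; congr (_ - _).
by apply: eq_bigr => k _; ring.
Qed.

Lemma solution_eq F G c : (forall z, generic z -> F z = G z) -> solution F c ->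
  solution G c.
Proof.
move=> FG sc l Nl; rewrite (sc l Nl).
by apply: (pairing_eq Gamma_nested) => [//|z gz]; exact: FG.
Qed.

Lemma eq_add (x y z t : R[i]) : x = y -> z = t -> x + z = y + t.
Proof. by move=> -> ->. Qed.

Lemma eq_addl (x y z : R[i]) : y = z -> x + y = x + z.
Proof. by move=> ->. Qed.

Lemma eq_addr (x y z : R[i]) : y = z -> y + x = z + x.
Proof. by move=> ->. Qed.

Section FixedBlackVertex.
Variables (j' r' M : nat).
Hypothesis r'n : (r' <= n)%N.
Hypotheses (nM : (n < M)%N) (jM : (j' < M)%N).
Local Notation bt := (beta j' r').

Definition correction_coef F : nat -> R[i] :=
  fun l => inner_ge N (inverse_ge N (id_sub K_unsigned) l) (fun l => D (f_fun l) F).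

Lemma correction_coefP F : solution F (correction_coef F).
Proof. exact: (inverse_ge_solves K_unsigned_vanish K_unsigned_block_injective). Qed.

(** The part of the kernel that depends linearly on the white function F;
    the black vertex (2 j' , 2 r' - 1) is fixed. *)
Definition corrected F : R[i] :=
  D F bt + \sum_(N <= k < M) correction_coef F k * D bt (e_fun k).

Lemma corrected_sol F c : solution F c ->
  corrected F = D F bt + \sum_(N <= k < M) c k * D bt (e_fun k).
Proof.
move=> sc; apply: eq_addl; rewrite big_nat_cond [RHS]big_nat_cond.
apply: eq_bigr => k /andP[/andP[Nk _] _].
by rewrite (solution_unique (correction_coefP F) sc Nk).
Qed.

Lemma corrected_eq F G : (forall z, generic z -> F z = G z) -> corrected F = corrected G.
Proof.
move=> FG; rewrite (corrected_sol (c := correction_coef G)).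
  by apply: eq_addr; apply: (pairing_eq Gamma_nested) => [z gz|//]; exact: FG.
by apply: solution_eq (correction_coefP G) => z gz; rewrite FG.
Qed.

Lemma correctedD F G : is_rat F -> is_rat G ->
  corrected (fun z => F z + G z) = corrected F + corrected G.
Proof.
move=> rF rG; rewrite (corrected_sol (solutionD rF rG (correction_coefP F) (correction_coefP G))).
have -> := pairingDl Gamma_nested rF rG (beta_rat j' r').
under eq_bigr do rewrite mulrDl.
by rewrite big_split /corrected addrACA.
Qed.

Lemma correctedZ x F : is_rat F -> corrected (fun z => x * F z) = x * corrected F.
Proof.
move=> rF; rewrite (corrected_sol (solutionZ x rF (correction_coefP F))).
have -> := pairingZl Gamma_nested x rF (beta_rat j' r').
rewrite /corrected mulrDr mulr_sumr; apply: eq_addl.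
by apply: eq_bigr => k _; rewrite mulrA.
Qed.

Definition kernel_entry (i s : int) : R[i] :=
  - ((s < r'%:Z)%R%:R * rho (fun z => phi i s z * bt z)) + corrected (phi i s).

Lemma kernel_entryE i s c : solution (phi i s) c -> kernel_entry i s = kernel_value i j' r' s c M.
Proof. by move=> sc; rewrite /kernel_entry (corrected_sol sc). Qed.

Lemma phi_betaE i s z : generic z ->
  phi i s z * bt z = mono (i - j'%:Z) (r'%:Z - s - 1) (s - r'%:Z) z.
Proof. by move=> gz; rewrite monoM //; apply: mono_eq; lia. Qed.

(** For i = -1 the function phi vanishes at infinity. The correction is
    zero, and D(phi, beta) = rho(phi beta) cancels the indicator term when s
    < r'; otherwise rho(phi beta) = 0 because phi beta decreases like
    z^(-2). *)
Lemma kernel_entry_left (s : nat) : kernel_entry (-1) s = 0.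
Proof.
have pp : is_pol (phi (-1) s) by apply: mono_pol; lia.
have s0 : solution (phi (-1) s) (fun=> 0).
  by apply: solution0 => l Nl; exact: (pairing_pol Gamma_nested (f_rat l) pp).
rewrite /kernel_entry (corrected_sol s0) big1 ?addr0 => [|k _]; last by rewrite mul0r.
rewrite (pol_pairing Gamma_nested pp (beta_rat j' r')).
have [sr|rs] := ltP s%:Z r'%:Z; first by rewrite mul1r addNr.
rewrite mul0r oppr0 add0r (residue_eq Gamma_nested (phi_betaE (-1) s)).
by apply: rho_mono_eq0; lia.
Qed.

(** Here phi = z^(i-n) (1+az)^n is a polynomial, so D(phi, beta) = 0, and
    f_l phi decreases at least like z^(-2) for l >= N, so the linear system
    has right-hand side zero. *)
Lemma kernel_entry_top (i : nat) : (n <= i < n + N)%N -> kernel_entry i n = 0.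
Proof.
move=> /andP[ni iN].
have pr : is_reg (phi i n) by apply: mono_reg; lia.
have s0 : solution (phi i n) (fun=> 0).
  apply: solution0 => l Nl; rewrite (pairing_reg Gamma_nested (f_rat l) pr).
  rewrite (residue_eq Gamma_nested (G := mono (i%:Z - l%:Z) (- (n%:Z + 1)) 0)).
    by apply: rho_mono_eq0; lia.
  by move=> z gz; rewrite monoM //; apply: mono_eq; lia.
rewrite /kernel_entry (corrected_sol s0) big1 ?addr0 => [|k _]; last by rewrite mul0r.
rewrite (reg_pairing Gamma_nested pr (beta_rat j' r')) addr0.
have -> : (n%:Z < r'%:Z) = false by apply/negbTE; lia.
by rewrite mul0r oppr0.
Qed.

(** All four functions are multiples of the same one, with factors z (1+az),
    1+az, z-a and z (z-a). *)
Lemma phi_four_term (i s : int) z : generic z ->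
  phi i s z + - ac * phi (i - 1) s z + - 1 * phi (i - 1) (s - 1) z
   + - ac * phi i (s - 1) z = 0.
Proof.
move=> gz; have [z0 za zb] := genericP gz.
pose b := mono (i - 1 - n%:Z) (n%:Z - s) (s - 1) z.
have e1 : z * (1 + ac * z) = mono 1 0 1 z by rewrite /mono !expr1z expr0z mulr1.
have e2 : 1 + ac * z = mono 0 0 1 z by rewrite /mono !expr1z !expr0z !mul1r.
have e3 : z - ac = mono 0 1 0 z by rewrite /mono !expr1z !expr0z mul1r mulr1.
have e4 : z * (z - ac) = mono 1 1 0 z by rewrite /mono !expr1z expr0z mulr1.
have -> : phi i s z = b * (z * (1 + ac * z)).
  by rewrite e1 /b monoM //; apply: mono_eq; lia.
have -> : phi (i - 1) s z = b * (1 + ac * z).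
  by rewrite e2 /b monoM //; apply: mono_eq; lia.
have -> : phi (i - 1) (s - 1) z = b * (z - ac).
  by rewrite e3 /b monoM //; apply: mono_eq; lia.
have -> : phi i (s - 1) z = b * (z * (z - ac)).
  by rewrite e4 /b monoM //; apply: mono_eq; lia.
by ring.
Qed.

Lemma phi_two_term (i s : int) z : generic z ->
  phi (i - 1) (s - 1) z + ac * phi i (s - 1) z =
  mono (i - 1 - n%:Z) (n%:Z - s + 1) s z.
Proof.
move=> gz; have [z0 za zb] := genericP gz.
have ez : mono 1 0 0 z = z by rewrite -mono_z expr1z.
have eb : mono 0 0 1 z = 1 + ac * z by rewrite -mono_zb expr1z.
have -> : phi i (s - 1) z = phi (i - 1) (s - 1) z * mono 1 0 0 z.
  by rewrite monoM //; apply: mono_eq; lia.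
transitivity (phi (i - 1) (s - 1) z * mono 0 0 1 z); first by rewrite ez eb; ring.
by rewrite monoM //; apply: mono_eq; lia.
Qed.

Lemma rho_two_term (j : nat) (F : R[i] -> R[i]) (s : int) :
  (forall z, generic z -> F z = mono (j%:Z - 1 - n%:Z) (n%:Z - s + 1) s z) ->
  s = r'%:Z -> rho (fun z => F z * bt z) = (j == j')%:R.
Proof.
move=> FE sr; rewrite (residue_eq Gamma_nested (G := mono (j%:Z - j'%:Z - 1) 0 0)).
  rewrite rho_mono_power; congr (_%:R); congr nat_of_bool.
  by apply/eqP/eqP => [|->]; lia.
by move=> z gz; rewrite FE // monoM //; apply: mono_eq; lia.
Qed.

(** By the four-term relation the linear part drops out. The indicator terms
    cancel for the same reason unless r = r', when only the two functions in
    the row r-1 contribute, and their combination times beta is z^(j-j'-1). *)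
Lemma kernel_entry_interior (j r : nat) : (0 < r)%N ->
  kernel_entry j r - ac * kernel_entry (j%:Z - 1) r - kernel_entry (j%:Z - 1) (r%:Z - 1) - ac * kernel_entry j (r%:Z - 1) =
  ((j == j') && (r == r'))%:R.
Proof.
move=> r0.
pose P (i s : int) := rho (fun z => phi i s z * bt z).
have ratP i s : is_rat (fun z => phi i s z * bt z).
  by apply: rationalM; [exact: phi_rat|exact: beta_rat].
have lin : corrected (phi j r) - ac * corrected (phi (j%:Z - 1) r)
   - corrected (phi (j%:Z - 1) (r%:Z - 1)) - ac * corrected (phi j (r%:Z - 1)) = 0.
  have rz i s x := rationalZ x (phi_rat i s).
  have rz1 := rationalD (fun _ h => h) (phi_rat j r) (rz (j%:Z - 1) r%:Z (- ac)).
  have rz2 := rationalD (fun _ h => h) rz1 (rz (j%:Z - 1) (r%:Z - 1) (- 1)).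
  have e0 := corrected_eq (@phi_four_term j r).
  have e1 := correctedD rz2 (rz j%:Z (r%:Z - 1) (- ac)).
  have e2 := correctedD rz1 (rz (j%:Z - 1) (r%:Z - 1) (- 1)).
  have e3 := correctedD (phi_rat j r) (rz (j%:Z - 1) r%:Z (- ac)).
  have z1 := correctedZ (- ac) (phi_rat (j%:Z - 1) r).
  have z2 := correctedZ (- 1) (phi_rat (j%:Z - 1) (r%:Z - 1)).
  have z3 := correctedZ (- ac) (phi_rat j (r%:Z - 1)).
  have e4 : corrected (fun=> 0) = 0.
    have z0 := correctedZ 0 (phi_rat j r); rewrite [0 * corrected _]mul0r in z0.
    by rewrite -z0; apply: corrected_eq => z _; rewrite mul0r.
  rewrite e4 e1 e2 e3 z1 z2 z3 in e0.
  move: e0; move: (corrected (phi j r)) (corrected (phi (j%:Z - 1) r))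
    (corrected (phi (j%:Z - 1) (r%:Z - 1))) (corrected (phi j (r%:Z - 1))).
  by move=> c1 c2 c3 c4 e0; rewrite -[RHS]e0; ring.
(* The four-term relation for the indicator terms. *)
have ratb i s x : is_rat (fun z => x * (phi i s z * bt z)).
  by apply: rationalZ; exact: ratP.
have hP : P j r - ac * P (j%:Z - 1) r - P (j%:Z - 1) (r%:Z - 1) - ac * P j (r%:Z - 1) = 0.
  have rz1 := rationalD (fun _ h => h) (ratP j r) (ratb (j%:Z - 1) r%:Z (- ac)).
  have rz2 := rationalD (fun _ h => h) rz1 (ratb (j%:Z - 1) (r%:Z - 1) (- 1)).
  have e1 := rho_add Gamma_nested rz2 (ratb j%:Z (r%:Z - 1) (- ac)).
  have e2 := rho_add Gamma_nested rz1 (ratb (j%:Z - 1) (r%:Z - 1) (- 1)).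
  have e3 := rho_add Gamma_nested (ratP j r) (ratb (j%:Z - 1) r%:Z (- ac)).
  have z1 := rho_scale Gamma_nested (- ac) (ratP (j%:Z - 1) r).
  have z2 := rho_scale Gamma_nested (- 1) (ratP (j%:Z - 1) (r%:Z - 1)).
  have z3 := rho_scale Gamma_nested (- ac) (ratP j (r%:Z - 1)).
  rewrite e2 e3 z1 z2 z3 in e1.
  have e0 : rho (fun z => phi j r z * bt z + - ac * (phi (j%:Z - 1) r z * bt z) +
     -1 * (phi (j%:Z - 1) (r%:Z - 1) z * bt z) +
     - ac * (phi j (r%:Z - 1) z * bt z)) = 0.
    rewrite (residue_eq Gamma_nested (G := fun=> 0)).
      by rewrite (rho_reg Gamma_nested (rational0 _ _ _ _)).
    move=> z gz; have := phi_four_term j r gz => /(congr1 (fun x => x * bt z)).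
    rewrite mul0r => <-.
    by move: (phi j r z) (phi (j%:Z - 1) r z) (phi (j%:Z - 1) (r%:Z - 1) z)
      (phi j (r%:Z - 1) z) (bt z) => p1 p2 p3 p4 p5; ring.
  rewrite e0 in e1; move: e1; rewrite -/(P j r) -/(P (j%:Z - 1) r)
    -/(P (j%:Z - 1) (r%:Z - 1)) -/(P j (r%:Z - 1)).
  move: (P j r) (P (j%:Z - 1) r) (P (j%:Z - 1) (r%:Z - 1)) (P j (r%:Z - 1)).
  by move=> p1 p2 p3 p4 e1; rewrite [RHS]e1; ring.
have hD : r = r' -> P (j%:Z - 1) (r%:Z - 1) + ac * P j (r%:Z - 1) = (j == j')%:R.
  move=> rr; rewrite -(@rho_two_term j
     (fun z => phi (j%:Z - 1) (r%:Z - 1) z + ac * phi j (r%:Z - 1) z) r) ?rr //.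
    have <- := rho_scale Gamma_nested ac (ratP j (r'%:Z - 1)).
    have <- := rho_add Gamma_nested (ratP (j%:Z - 1) (r'%:Z - 1)) (ratb j%:Z (r'%:Z - 1) ac).
    apply: (residue_eq Gamma_nested) => z gz.
    by move: (phi (j%:Z - 1) (r'%:Z - 1) z) (phi j (r'%:Z - 1) z) (bt z) => p3 p4 p5; ring.
  by move=> z gz; exact: phi_two_term.
rewrite /kernel_entry -/(P _ _) -/(P _ _) -/(P _ _) -/(P _ _).
move: (corrected (phi j r)) (corrected (phi (j%:Z - 1) r))
  (corrected (phi (j%:Z - 1) (r%:Z - 1))) (corrected (phi j (r%:Z - 1))) lin => c1 c2 c3 c4 lin.
move: (P j r) (P (j%:Z - 1) r) (P (j%:Z - 1) (r%:Z - 1)) (P j (r%:Z - 1)) hP hD => p1 p2 p3 p4 hP hD.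
(* Here b1 and b2 are the indicators of r < r' and r - 1 < r'. *)
have l0 b1 b2 : - (b1 * p1) + c1 - ac * (- (b1 * p2) + c2) - (- (b2 * p3) + c3) -
   ac * (- (b2 * p4) + c4) = - b1 * (p1 - ac * p2 - p3 - ac * p4) +
   (c1 - ac * c2 - c3 - ac * c4) + (b2 - b1) * (p3 + ac * p4) by ring.
rewrite l0 hP lin mulr0 !add0r.
have [rr|rr|rr] := ltngtP r r'.
- have -> : (r%:Z < r'%:Z) = true by apply/idP; lia.
  have -> : (r%:Z - 1 < r'%:Z) = true by apply/idP; lia.
  by rewrite andbF subrr mul0r.
- have -> : (r%:Z < r'%:Z) = false by apply/negbTE; lia.
  have -> : (r%:Z - 1 < r'%:Z) = false by apply/negbTE; lia.
  by rewrite andbF subrr mul0r.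
have -> : (r%:Z < r'%:Z) = false by apply/negbTE; lia.
have -> : (r%:Z - 1 < r'%:Z) = true by apply/idP; lia.
by rewrite andbT subr0 mul1r hD.
Qed.

(** The identity z^j = (1+az)^n (sum of c_k z^k for k < K) + z^K h,
    multiplied by z^(-n-1) (z-a)^(n+1). *)
Lemma series_expansion (j K : nat) z : generic z ->
  mono (j%:Z - n%:Z - 1) (n%:Z + 1) 0 z =
  \sum_(0 <= k < K) series_coef (caffine a ^+ n) 'X^j k * e_fun k z +
  mono (K%:Z - n%:Z - 1) (n%:Z + 1) 0 z * (series_rest (caffine a ^+ n) 'X^j K).[z].
Proof.
move=> gz; have [z0 za zb] := genericP gz.
have q0 : (caffine a ^+ n)`_0 = 1.
  by rewrite -horner_coef0 horner_exp hornerD hornerZ hornerX hornerC mulr0 add0r expr1n.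
have := congr1 (horner^~ z) (series_divE 'X^j K q0).
rewrite hornerD !hornerM horner_sum !hornerXn horner_exp.
under eq_bigr do rewrite hornerZ hornerXn.
have -> : (caffine a).[z] = 1 + ac * z.
  by rewrite hornerD hornerZ hornerX hornerC addrC.
set s := series_coef _ _; move: (series_rest _ _ _).[z] => h E.
pose w := mono (- n%:Z - 1) (n%:Z + 1) 0 z.
have wE (k : nat) : mono (k%:Z - n%:Z - 1) (n%:Z + 1) 0 z = w * z ^+ k.
  by rewrite [z ^+ k]exprnP mono_z monoM //; apply: mono_eq; lia.
have eE k : e_fun k z = w * (1 + ac * z) ^+ n * z ^+ k.
  rewrite -mulrA [_ * z ^+ k]mulrC mulrA -wE exprnP mono_zb monoM //.
  by apply: mono_eq; lia.
rewrite !wE E; under [in RHS]eq_bigr do rewrite eE.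
rewrite mulrDr mulr_sumr mulr_sumr; apply: eq_add; last by ring.
by apply: eq_bigr => k _; ring.
Qed.

(** The two-term combination is xi = z^j (1-a/z)^(n+1). Expanding it in the
    e_k leaves a remainder that is regular inside the contours, of
    arbitrarily high order at 0. Hence the coefficients c_k of z^j /
    (1+az)^n solve the linear system, and sum_k c_k D(beta, e_k) = D(beta,
    xi). The corrected value of xi is then D(xi, beta) + D(beta, xi) =
    rho(xi beta), which the indicator term cancels for r' > 0. *)
Lemma kernel_entry_bottom (j : nat) : (N <= j)%N ->
  kernel_entry j 0 - ac * kernel_entry (j%:Z - 1) 0 = ((j == j') && (0 == r')%N)%:R.
Proof.
move=> Nj.
pose xi := mono (j%:Z - n%:Z - 1) (n%:Z + 1) 0.
pose c := series_coef (caffine a ^+ n) 'X^j.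
pose rest K z := mono (K%:Z - n%:Z - 1) (n%:Z + 1) 0 z *
  (series_rest (caffine a ^+ n) 'X^j K).[z].
pose part K z := \sum_(N <= k < K) c k * e_fun k z.
have regp (p : {poly R[i]}) : is_reg (fun z => p.[z]).
  by exists p, [::]; split => // z _; rewrite /ratf big_nil divr1.
have ratrest K : is_rat (rest K).
  by apply: rationalM; [exact: mono_rat|exact/reg_rat/regp].
have ratpart K : is_rat (part K) by apply: sum_rat => k; exact: e_rat.
have xiE K z : (N <= K)%N -> generic z -> xi z = part K z + rest K z.
  move=> NK gz; rewrite /xi (series_expansion j K gz); apply: eq_addr.
  rewrite (big_cat_nat (leq0n N) NK) /=.
  rewrite [kernel_entry in kernel_entry + _]big_nat_cond [kernel_entry in kernel_entry + _]big1 ?add0r // => k /andP[/andP[_ kN] _].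
  by rewrite series_coef_small ?mul0r // (leq_trans kN).
have regrest K (i0 j0 k0 : int) (G : R[i] -> R[i]) :
    (forall z, generic z -> G z = mono i0 j0 k0 z) ->
    0 <= i0 + (K%:Z - n%:Z - 1) -> 0 <= j0 + (n%:Z + 1) ->
    rho (fun z => G z * rest K z) = 0.
  move=> GE h1 h2; apply: (rho_reg Gamma_nested).
  apply: (rational_eq (F := fun z => mono (i0 + (K%:Z - n%:Z - 1)) (j0 + (n%:Z + 1)) (k0 + 0) z *
     (series_rest (caffine a ^+ n) 'X^j K).[z])).
    by move=> z gz; rewrite GE // /rest mulrA monoM.
  by apply: rationalM; [exact: mono_reg|exact: regp].
have regT K : (n < K)%N -> is_reg (rest K).
  by move=> nK; apply: rationalM; [apply: mono_reg; lia|exact: regp].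
have solc : solution xi c.
  move=> l Nl; pose K := (maxn j (maxn n l)).+1.
  have [jK nK lK] : [/\ j < K, n < K & l < K]%N by rewrite /K; split; lia.
  have -> : D (f_fun l) xi = D (f_fun l) (fun z => part K z + rest K z).
    by apply: (pairing_eq Gamma_nested) => [//|z gz]; apply: xiE gz; rewrite (leq_trans Nj) // ltnW.
  have -> := pairingDr Gamma_nested (f_rat l) (ratpart K) (ratrest K).
  have -> : D (f_fun l) (rest K) = 0.
    have -> := pairing_reg Gamma_nested (f_rat l) (regT K nK).
    by apply: (regrest _ (n%:Z - l%:Z) (- (n%:Z + 1)) (- n%:Z)) => //; lia.
  have -> := pairing_sumr (index_iota N K) c (f_rat l) e_rat.
  rewrite addr0; under [RHS]eq_bigr do rewrite pairing_fe mulrBr [c _ * K_unsigned _ _]mulrC [c _ * _]mulrC.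
  by rewrite sumrB sum_delta ?Nl // (@sum_truncate _ N n K_unsigned K_unsigned_vanish).
have corrE : corrected xi = rho (fun z => xi z * bt z).
  rewrite (corrected_sol solc).
  have ratxi : is_rat xi by exact: mono_rat.
  have <- := pairing_sym Gamma_nested ratxi (beta_rat j' r'); apply: eq_addl.
  have NM : (N <= M)%N by case/andP: N_bounds => _ Nn; rewrite (leq_trans Nn) // ltnW.
  have -> : D bt xi = D bt (fun z => part M z + rest M z).
    by apply: (pairing_eq Gamma_nested) => [//|z gz]; exact: xiE.
  have -> := pairingDr Gamma_nested (beta_rat j' r') (ratpart M) (ratrest M).
  have -> : D bt (rest M) = 0.
    have -> := pairing_reg Gamma_nested (beta_rat j' r') (regT M nM).
    by apply: (regrest _ (n%:Z - j'%:Z) (r'%:Z - n%:Z - 1) (- r'%:Z)) => //; lia.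
  by have -> := pairing_sumr (index_iota N M) c (beta_rat j' r') e_rat; rewrite addr0.
have two z : generic z -> phi j 0 z + - ac * phi (j%:Z - 1) 0 z = xi z.
  move=> gz; have [z0 za zb] := genericP gz.
  have -> : phi j 0 z = phi (j%:Z - 1) 0 z * z.
    by rewrite -[z in _ * z]expr1z mono_z monoM //; apply: mono_eq; lia.
  have -> : phi (j%:Z - 1) 0 z * z + - ac * phi (j%:Z - 1) 0 z =
     phi (j%:Z - 1) 0 z * (z - ac) by ring.
  by rewrite -[z - ac]expr1z mono_za monoM //; apply: mono_eq; lia.
have ratz : is_rat (fun z => - ac * phi (j%:Z - 1) 0 z) by apply: rationalZ; exact: phi_rat.
have eC : corrected (phi j 0) - ac * corrected (phi (j%:Z - 1) 0) = corrected xi.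
  rewrite -(corrected_eq two) (correctedD (phi_rat j 0) ratz).
  by rewrite (correctedZ (- ac) (phi_rat (j%:Z - 1) 0)) mulNr.
pose P (i s : int) := rho (fun z => phi i s z * bt z).
have ratP i s : is_rat (fun z => phi i s z * bt z).
  by apply: rationalM; [exact: phi_rat|exact: beta_rat].
have ratb i s x : is_rat (fun z => x * (phi i s z * bt z)).
  by apply: rationalZ; exact: ratP.
have eP : P j 0 - ac * P (j%:Z - 1) 0 = rho (fun z => xi z * bt z).
  rewrite -mulNr /P; have <- := rho_scale Gamma_nested (- ac) (ratP (j%:Z - 1) 0).
  have <- := rho_add Gamma_nested (ratP j 0) (ratb (j%:Z - 1) 0 (- ac)).
  by apply: (residue_eq Gamma_nested) => z gz; rewrite -two // mulrDl !mulrA.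
rewrite /kernel_entry -/(P j 0) -/(P (j%:Z - 1) 0).
move: (corrected (phi j 0)) (corrected (phi (j%:Z - 1) 0)) eC => c1 c2 eC.
move: (P j 0) (P (j%:Z - 1) 0) eP => p1 p2 eP.
have l0 b : - (b * p1) + c1 - ac * (- (b * p2) + c2) =
   (c1 - ac * c2) - b * (p1 - ac * p2) by ring.
rewrite l0 eC eP corrE; case: (posnP r') => [r0|r0].
  have -> : (0 < r'%:Z :> int) = false by apply/negbTE; lia.
  have -> : (0 == r')%N = true by apply/eqP.
  rewrite andbT mul0r subr0; apply: (@rho_two_term j xi 0) => [z gz|]; last by lia.
  by rewrite /xi; apply: mono_eq; lia.
have -> : (0 < r'%:Z :> int) = true by apply/idP; lia.
have -> : (0 == r')%N = false by apply/negbTE; lia.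
by rewrite andbF mul1r subrr.
Qed.

End FixedBlackVertex.
End AztecKernel.

(** * Right inverses of finite square matrices *)

Section FiniteInverse.
Variables (F : fieldType) (T : choiceType) (sb sw : seq T) (K L : T -> T -> F).
Hypotheses (size_eq : size sb = size sw) (uniq_b : uniq sb).

Lemma left_inverse_of_right :
  {in sb &, forall b b', \sum_(w <- sw) K b w * L w b' = (b == b')%:R} ->
  {in sw &, forall w w', \sum_(b <- sb) L w b * K b w' = (w == w')%:R}.
Proof.
move=> KL w w' wI w'I; pose d := size sb.
pose A : 'M[F]_d := \matrix_(p, q) K (nth w sb p) (nth w sw q).
pose B : 'M[F]_d := \matrix_(q, p) L (nth w sw q) (nth w sb p).
have sumw (G : T -> F) : \sum_(x <- sw) G x = \sum_(q < d) G (nth w sw q).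
  by rewrite (big_nth w) big_mkord -size_eq.
have sumb (G : T -> F) : \sum_(x <- sb) G x = \sum_(p < d) G (nth w sb p).
  by rewrite (big_nth w) big_mkord.
have AB : A *m B = 1%:M.
  apply/matrixP => p p'; rewrite !mxE.
  have := KL (nth w sb p) (nth w sb p'); rewrite !mem_nth // nth_uniq // => /(_ isT isT).
  rewrite sumw val_eqE => <-.
  by apply: eq_bigr => q _; rewrite !mxE.
have wq x : x \in sw -> (index x sw < d)%N by rewrite /d size_eq index_mem.
have /matrixP/(_ (Ordinal (wq w wI)) (Ordinal (wq w' w'I))) := mulmx1C AB.
rewrite !mxE -val_eqE /= => E.
have -> : (w == w') = (index w sw == index w' sw).
  apply/eqP/eqP => [->//|ww]; by rewrite -(nth_index w wI) ww nth_index.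
rewrite sumb -E; apply: eq_bigr => p _; rewrite !mxE /=.
by rewrite !nth_index.
Qed.
End FiniteInverse.

Section Phases.
Variable R : realType.
Local Notation i0 := ('i%C : R[i]).

Lemma m1powD (x y : R) : m1pow (x + y) = m1pow x * m1pow y.
Proof.
by rewrite /m1pow mulrDr cosD sinD; apply: eq_complexP; rewrite /= ?[_ + cos _ * _]addrC.
Qed.

Lemma m1pow_half : m1pow (2^-1 : R) = i0.
Proof. by rewrite /m1pow cos_pihalf sin_pihalf. Qed.

Lemma i0_neq0 : i0 != 0.
Proof. by rewrite eq_complex /= oner_eq0 andbF. Qed.

Lemma m1pow_halfz (k : int) : m1pow (k%:~R / 2 : R) = i0 ^ k.
Proof.
have m0 : m1pow (0 : R) = 1 by rewrite /m1pow mulr0 cos0 sin0.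
have mn (p : nat) : m1pow (p%:R / 2 : R) = i0 ^+ p.
  elim: p => [|p IH]; first by rewrite mul0r m0.
  by rewrite -addn1 natrD mulrDl m1powD IH mul1r m1pow_half exprD expr1.
case: k => p; first by rewrite -pmulrn mn.
apply: (mulIf (x := i0 ^+ p.+1)); first by rewrite expf_neq0 // i0_neq0.
rewrite NegzE -exprnN mulVf ?expf_neq0 ?i0_neq0 // -mn -m1powD.
by rewrite mulrNz -pmulrn mulNr addNr m0.
Qed.
End Phases.

(** * Coordinates of the vertices *)

Section VertexCoordinates.
Implicit Types (p : nat * nat).

Definition white_vertex p : vertex := (2 * p.1%:Z + 1, 2 * p.2%:Z).
Definition black_vertex p : vertex := (2 * p.1%:Z, 2 * p.2%:Z - 1).

Lemma white_vertex_inj : injective white_vertex.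
Proof. by move=> [i s] [i' s'] [] /= h1 h2; congr pair; lia. Qed.

Lemma black_vertex_inj : injective black_vertex.
Proof. by move=> [i s] [i' s'] [] /= h1 h2; congr pair; lia. Qed.

Definition white_coords (n N : nat) : seq (nat * nat) :=
  [seq (i, s) | s <- iota 0 n, i <- iota 0 (N + n)] ++ [seq (i, n) | i <- iota 0 n].
Definition black_coords (n N : nat) : seq (nat * nat) :=
  [seq (j, r) | r <- iota 1 n, j <- iota 0 (N + n)] ++ [seq (j, 0%N) | j <- iota N n].

Lemma mem_white_coords n N p : (p \in white_coords n N) =
  ((p.1 < N + n) && (p.2 < n))%N || ((p.1 < n) && (p.2 == n))%N.
Proof.
case: p => i s; rewrite mem_cat /=; congr (_ || _).
  apply/allpairsP/andP => [[[s' i'] /= []]|[h1 h2]].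
    by rewrite !mem_iota /= !add0n => h1 h2 [-> ->].
  by exists (s, i) => /=; rewrite !mem_iota /= !add0n.
apply/mapP/andP => [[i' /=]|[h1 /eqP ->]].
  by rewrite mem_iota /= add0n => h1 [-> ->].
by exists i => //; rewrite mem_iota.
Qed.

Lemma mem_black_coords n N p : (p \in black_coords n N) =
  [&& p.1 < N + n, 0 < p.2 & p.2 <= n]%N || [&& N <= p.1, p.1 < N + n & p.2 == 0]%N.
Proof.
case: p => i s; rewrite mem_cat /=; congr (_ || _).
  apply/allpairsP/and3P => [[[s' i'] /= []]|[h1 h2 h3]].
    rewrite !mem_iota /= add0n add1n ltnS => /andP[h1 h2] h3 [-> ->] //.
  by exists (s, i) => /=; rewrite !mem_iota /= add0n add1n ltnS h2.
apply/mapP/and3P => [[i' /=]|[h1 h2 /eqP ->]].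
  by rewrite mem_iota => /andP[h1 h2] [-> ->].
by exists i => //; rewrite mem_iota h1.
Qed.

Lemma uniq_white_coords n N : uniq (white_coords n N).
Proof.
rewrite cat_uniq; apply/and3P; split.
- by apply: allpairs_uniq; rewrite ?iota_uniq // => -[s i] [s' i'] _ _ [-> ->].
- apply/hasPn => _ /mapP[i _ ->]; apply/allpairsP => -[[s i'] /= [h1 _ [_ h]]].
  by move: h1; rewrite mem_iota h add0n ltnn.
- by rewrite map_inj_uniq ?iota_uniq // => i i' [].
Qed.

Lemma uniq_black_coords n N : uniq (black_coords n N).
Proof.
rewrite cat_uniq; apply/and3P; split.
- by apply: allpairs_uniq; rewrite ?iota_uniq // => -[s i] [s' i'] _ _ [-> ->].
- apply/hasPn => _ /mapP[i _ ->]; apply/allpairsP => -[[s i'] /= [h1 _ [_ h]]].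
  by move: h1; rewrite mem_iota -h.
- by rewrite map_inj_uniq ?iota_uniq // => i i' [].
Qed.

Lemma size_coords n N : size (black_coords n N) = size (white_coords n N).
Proof. by rewrite !size_cat !size_allpairs !size_map !size_iota. Qed.

Lemma white_ADE n m :
  white_AD n m = [set` map white_vertex (white_coords n (2 * m + 1))].
Proof.
apply/seteqP; split => [[x1 x2]|_ /mapP[[i s] + ->]] /=.
  rewrite /white_AD /even_int /=; move=> [par1 [par2 h]].
  have [i Ei] : exists i : nat, x1 = 2 * i%:Z + 1.
    by exists `|(x1 %/ 2)%Z|%N; by case: h; move=> [h _]; lia.
  have [s Es] : exists s : nat, x2 = 2 * s%:Z.
    by exists `|(x2 %/ 2)%Z|%N; by case: h; move=> [_ h]; lia.
  apply/mapP; exists (i, s); last by rewrite Ei Es.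
  by rewrite mem_white_coords /=; case: h; move=> [h1 h2]; apply/orP; [left|right]; lia.
rewrite mem_white_coords /white_AD /even_int /= => h; split; first by lia.
split; first by lia.
by case/orP: h => /andP[h1 h2]; [left|right]; lia.
Qed.

Lemma black_ADE n m :
  black_AD n m = [set` map black_vertex (black_coords n (2 * m + 1))].
Proof.
apply/seteqP; split => [[x1 x2]|_ /mapP[[j r] + ->]] /=.
  rewrite /black_AD /even_int /=; move=> [par1 [par2 h]].
  have [j Ej] : exists j : nat, x1 = 2 * j%:Z.
    by exists `|(x1 %/ 2)%Z|%N; by case: h; move=> [h _]; lia.
  have [r Er] : exists r : nat, x2 = 2 * r%:Z - 1.
    by exists `|((x2 + 1) %/ 2)%Z|%N; by case: h; move=> [_ h]; lia.
  apply/mapP; exists (j, r); last by rewrite Ej Er.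
  by rewrite mem_black_coords /=; case: h; move=> [h1 h2]; apply/orP; [left|right]; lia.
rewrite mem_black_coords /black_AD /even_int /= => h; split; first by lia.
split; first by lia.
by case/orP: h => /and3P[h1 h2 h3]; [left|right]; lia.
Qed.

Lemma fsbig_map_vertex (F : fieldType) (v : nat * nat -> vertex) (s : seq (nat * nat))
    (G : vertex -> F) : injective v -> uniq s ->
  \sum_(x \in [set` map v s]) G x = \sum_(p <- s) G (v p).
Proof. by move=> vI us; rewrite -fsbig_seq ?map_inj_uniq // big_map. Qed.

Lemma sum_pred1_seq (F : fieldType) (s : seq (nat * nat)) (x : nat * nat)
    (G : nat * nat -> F) : uniq s ->
  \sum_(p <- s) (p == x)%:R * G p = (x \in s)%:R * G x.
Proof.
move=> us; have [xs|xs] := boolP (x \in s).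
  rewrite (bigD1_seq x) //= eqxx big1 ?addr0 // => p px.
  by rewrite (negbTE px) mul0r.
rewrite mul0r big_seq big1 // => p ps.
by have [e|_] := eqVneq p x; [move: xs; rewrite -e ps|rewrite mul0r].
Qed.

End VertexCoordinates.

(** * The inverse Kasteleyn matrix *)

Section InverseKasteleyn.
Variables (R : realType) (n rho m : nat) (a : R) (g g' : R -> R[i]).
Hypotheses (n_ge1 : (1 <= n)%N) (rho_ge1 : (1 <= rho)%N) (rho_le_n : (rho <= n)%N).
Hypotheses (n_rho : (n - rho = 2 * m)%N) (a_gt0 : 0 < a).
Hypotheses (Hg : is_Gamma0 a g) (Hg' : is_Gamma0u a g g').
Local Notation ac := (a%:C)%C.
Local Notation ii := ('i%C : R[i]).
Local Notation N := (2 * m + 1)%N.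

Lemma eq_mulr (x y z : R[i]) : y = z -> y * x = z * x.
Proof. by move=> ->. Qed.

Lemma truncation_bounds : (0 < N <= n)%N.
Proof. by lia. Qed.

Definition inverse_entry (w b : vertex) : R[i] :=
  - m1pow ((w.1 - w.2 + b.1 - b.2 + 2)%:~R / 4) *
  KK n m a g g'
    (b.2 + 1) ((b.2 - b.1 + 2 * m%:Z + 1) %/ 2)%Z
    (w.2 + 1) ((w.2 - w.1 + 2 * m%:Z + 1) %/ 2)%Z.

Definition entry_value (j' r' : nat) (i s : int) : R[i] :=
  kernel_entry a g g' n N j' r' (maxn n j').+1 i s.

(** The prefactor -(-1)^(k/2 + 1) equals i^k for k = i-s+j-r. *)
Lemma inverse_entryE (p q : nat * nat) : (q.2 <= n)%N ->
  inverse_entry (white_vertex p) (black_vertex q) =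
  ii ^ (p.1%:Z - p.2%:Z + q.1%:Z - q.2%:Z) * entry_value q.1 q.2 p.1 p.2.
Proof.
case: p q => [i s] [j r] /= rn; rewrite /inverse_entry /=.
have -> : 2 * i%:Z + 1 - 2 * s%:Z + 2 * j%:Z - (2 * r%:Z - 1) + 2 =
    2 * (i%:Z - s%:Z + j%:Z - r%:Z + 2) by lia.
set k := i%:Z - s%:Z + j%:Z - r%:Z.
have -> : (2 * (k + 2))%:~R / 4 = (k + 2)%:~R / 2 :> R.
  by rewrite intrM; field.
rewrite m1pow_halfz expfzDr ?i0_neq0 // -exprnP sqr_i mulrN1 opprK; apply: eq_mull.
have -> : 2 * r%:Z - 1 + 1 = 2 * r%:Z by lia.
have -> : ((2 * r%:Z - 1 - 2 * j%:Z + 2 * m%:Z + 1) %/ 2)%Z = r%:Z + m%:Z - j%:Z by lia.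
have -> : ((2 * s%:Z - (2 * i%:Z + 1) + 2 * m%:Z + 1) %/ 2)%Z = s%:Z + m%:Z - i%:Z by lia.
have [c sc] := solution_exists a_gt0 Hg Hg' truncation_bounds (phi a n i s).
rewrite (KK_value a_gt0 Hg Hg' truncation_bounds (c := c) (M := (maxn n j).+1)) //.
  by rewrite /entry_value (kernel_entryE a_gt0 Hg Hg' truncation_bounds _ _ _ sc).
by move=> l lM; apply: (beta_e_vanish a_gt0 Hg Hg' truncation_bounds) => //; lia.
Qed.

Lemma KasteleynE (p q : nat * nat) :
  Kasteleyn a (black_vertex q) (white_vertex p) =
  ii ^ (- (2 * (q.1%:Z + q.2%:Z))) *
  ((p == q)%:R - ac * ii * ((0 < q.1)%N%:R * (p == (q.1.-1, q.2))%:R) -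
   ((0 < q.1) && (0 < q.2))%N%:R * (p == (q.1.-1, q.2.-1))%:R +
   ac * ii * ((0 < q.2)%N%:R * (p == (q.1, q.2.-1))%:R)).
Proof.
case: p q => [i s] [j r]; rewrite /Kasteleyn /=.
have E1 : (white_vertex (i, s) == black_vertex (j, r) + e1) = ((i, s) == (j, r)).
  by rewrite !xpair_eqE /=; lia.
have E2 : (white_vertex (i, s) == black_vertex (j, r) + e2) =
    (0 < j)%N && ((i, s) == (j.-1, r)).
  by rewrite !xpair_eqE /=; lia.
have E3 : (white_vertex (i, s) == black_vertex (j, r) - e1) =
    ((0 < j) && (0 < r))%N && ((i, s) == (j.-1, r.-1)).
  by rewrite !xpair_eqE /=; lia.
have E4 : (white_vertex (i, s) == black_vertex (j, r) - e2) =
    (0 < r)%N && ((i, s) == (j, r.-1)).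
  by rewrite !xpair_eqE /=; lia.
have ph1 : m1pow (- ((2 * j%:Z + (2 * r%:Z - 1) + 1)%:~R / 2) : R) = ii ^ (- (2 * (j%:Z + r%:Z))).
  rewrite -m1pow_halfz mulrNz mulNr; congr (m1pow (- (_ / 2))); congr (_%:~R); lia.
have ph2 : m1pow (- ((2 * j%:Z + (2 * r%:Z - 1) - 1)%:~R / 2) : R) = - ii ^ (- (2 * (j%:Z + r%:Z))).
  transitivity (ii ^ (- (2 * (j%:Z + r%:Z)) + 2)).
    rewrite -m1pow_halfz -mulNr -mulrNz; congr (m1pow (_ / 2)); congr (_%:~R); lia.
  by rewrite expfzDr ?i0_neq0 // -exprnP sqr_i mulrN1.
have al2 : alpha2 a = - (ac * ii).
  by apply: eq_complexP; rewrite /= ?mul0r ?mulr0 ?mulr1 ?subr0 ?addr0 ?oppr0.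
rewrite /alpha1 al2 ph1 ph2 E1 E2 E3 E4 -!natrM !mulnb.
set t := ii ^ _.
case: ifP => [/eqP[<- <-]|h1].
  have -> : (0 < i)%N && ((i, s) == (i.-1, s)) = false by rewrite !xpair_eqE; lia.
  have -> : ((0 < i) && (0 < s))%N && ((i, s) == (i.-1, s.-1)) = false by rewrite !xpair_eqE; lia.
  have -> : (0 < s)%N && ((i, s) == (i, s.-1)) = false by rewrite !xpair_eqE; lia.
  by rewrite /=; ring.
case: ifP => [h2|h2].
  have -> : ((0 < j) && (0 < r))%N && ((i, s) == (j.-1, r.-1)) = false.
    by move: h2; rewrite !xpair_eqE; lia.
  have -> : (0 < r)%N && ((i, s) == (j, r.-1)) = false.
    by move: h2; rewrite !xpair_eqE; lia.
  by rewrite /=; ring.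
case: ifP => [h3|h3].
  have -> : (0 < r)%N && ((i, s) == (j, r.-1)) = false.
    by move: h3; rewrite !xpair_eqE; lia.
  by rewrite /=; ring.
by case: ifP => h4 /=; ring.
Qed.

(** A neighbour of a black vertex may fail to be a vertex, but the kernel
    vanishes there: on the left side by [kernel_entry_left], on the top row
    by [kernel_entry_top]. So the row of the product is the full four-term
    combination of the kernel, or the two-term one when r = 0, times powers
    of the imaginary unit. *)
Lemma right_inverse (q q' : nat * nat) :
  q \in black_coords n N -> q' \in black_coords n N ->
  \sum_(p <- white_coords n N) Kasteleyn a (black_vertex q) (white_vertex p) *
    inverse_entry (white_vertex p) (black_vertex q') = (q == q')%:R.
Proof.
case: q q' => [j r] [j' r'] qB q'B.
have [jlt rn rj] : [/\ (j < N + n)%N, (r <= n)%N & (0 < r)%N || (N <= j)%N].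
  by move: qB; rewrite mem_black_coords /=; split; lia.
have r'n : (r' <= n)%N by move: q'B; rewrite mem_black_coords /=; lia.
pose V := entry_value j' r'.
have nM : (n < (maxn n j').+1)%N by lia.
have jM : (j' < (maxn n j').+1)%N by lia.
pose G (p : nat * nat) := ii ^ (p.1%:Z - p.2%:Z + j'%:Z - r'%:Z) * V p.1 p.2.
have Vleft (s : nat) : V (-1) s = 0 by exact: (kernel_entry_left a_gt0 Hg Hg' truncation_bounds r'n nM jM s).
have Vtop (i : nat) : (n <= i < n + N)%N -> V i n = 0.
  by move=> iI; exact: (kernel_entry_top a_gt0 Hg Hg' truncation_bounds r'n nM jM iI).
(* The only points of the rectangle that are not vertices are on its top row. *)
have inG (i s : nat) : (i < N + n)%N -> (s <= n)%N ->
    ((i, s) \in white_coords n N)%:R * G (i, s) = G (i, s).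
  move=> iN sn; have [h|h] := boolP (_ \in _); first by rewrite mul1r.
  rewrite mem_white_coords /= in h; rewrite /G /=.
  have -> : s = n by lia.
  by rewrite Vtop ?mulr0 //; lia.
set t := ii ^ (- (2 * (j%:Z + r%:Z))).
have sE x : \sum_(p <- white_coords n N) (p == x)%:R * G p =
    (x \in white_coords n N)%:R * G x.
  by apply: sum_pred1_seq; exact: uniq_white_coords.
transitivity (t * (G (j, r) - ac * ii * ((0 < j)%N%:R * G (j.-1, r)) -
   ((0 < j) && (0 < r))%N%:R * G (j.-1, r.-1) +
   ac * ii * ((0 < r)%N%:R * G (j, r.-1)))).
  rewrite -(inG j r) // -(inG j.-1 r) //; last by lia.
  rewrite -(inG j.-1 r.-1); [|by lia|by lia].
  rewrite -(inG j r.-1); [|by lia|by lia].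
  rewrite -!sE !mulr_sumr -!sumrN -!big_split /= mulr_sumr.
  apply: eq_bigr => p _; rewrite KasteleynE inverse_entryE //= -/t -/(G p) -/V -/(G p).
  by ring.
pose th := ii ^ (- (2 * (j%:Z + r%:Z)) + (j%:Z - r%:Z + j'%:Z - r'%:Z)).
have iD (x y : int) : ii ^ x * ii ^ y = ii ^ (x + y) by rewrite expfzDr ?i0_neq0.
have i1 : ii = ii ^ 1 by rewrite expr1z.
have T1 : t * G (j, r) = th * V j r by rewrite mulrA iD.
have T2 : t * (ii * ((0 < j)%N%:R * G (j.-1, r))) = th * V (j%:Z - 1) r.
  case: (posnP j) => [j0|j0]; first by rewrite mul0r !mulr0 j0 sub0r Vleft mulr0.
  rewrite mul1r /G /= {1}i1 !mulrA !iD.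
  have -> : (j.-1)%:Z = j%:Z - 1 by lia.
  by apply: eq_mulr; congr (_ ^ _); lia.
have T3 : t * (((0 < j) && (0 < r))%N%:R * G (j.-1, r.-1)) =
    th * ((0 < r)%N%:R * V (j%:Z - 1) (r%:Z - 1)).
  case: (posnP r) => [r0|r0]; first by rewrite andbF !mul0r !mulr0.
  have er : (r.-1)%:Z = r%:Z - 1 by lia.
  case: (posnP j) => [j0|j0]; first by rewrite mul0r !mulr0 j0 sub0r -er Vleft !mulr0.
  rewrite !mul1r /G /= !mulrA !iD er.
  have -> : (j.-1)%:Z = j%:Z - 1 by lia.
  by apply: eq_mulr; congr (_ ^ _); lia.
have T4 : t * (ii * ((0 < r)%N%:R * G (j, r.-1))) = - (th * ((0 < r)%N%:R * V j (r%:Z - 1))).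
  case: (posnP r) => [r0|r0]; first by rewrite !mul0r !mulr0 oppr0.
  have er : (r.-1)%:Z = r%:Z - 1 by lia.
  rewrite !mul1r /G /= {1}i1 !mulrA !iD er -[RHS]mulNr; apply: eq_mulr.
  transitivity (th * ii ^ 2); last by rewrite -exprnP sqr_i mulrN1.
  by rewrite /th iD; congr (_ ^ _); lia.
transitivity (th * (V j r - ac * V (j%:Z - 1) r -
    (0 < r)%N%:R * (V (j%:Z - 1) (r%:Z - 1) + ac * V j (r%:Z - 1)))).
  move: T1 T2 T3 T4.
  move: (G (j, r)) (G (j.-1, r)) (G (j.-1, r.-1)) (G (j, r.-1)) => g1 g2 g3 g4.
  move: (V j r) (V (j%:Z - 1) r) (V (j%:Z - 1) (r%:Z - 1)) (V j (r%:Z - 1)) => v1 v2 v3 v4.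
  move: ((0 < j)%N%:R) (((0 < j) && (0 < r))%N%:R) ((0 < r)%N%:R) => b1 b2 b3.
  move: t th ac ii => {}t {}th c ii' T1 T2 T3 T4.
  transitivity (t * g1 - c * (t * (ii' * (b1 * g2))) - t * (b2 * g3) +
     c * (t * (ii' * (b3 * g4)))); first by ring.
  by rewrite T1 T2 T3 T4; ring.
have -> : V j r - ac * V (j%:Z - 1) r -
    (0 < r)%N%:R * (V (j%:Z - 1) (r%:Z - 1) + ac * V j (r%:Z - 1)) =
    ((j == j') && (r == r'))%:R.
  case: (posnP r) => [r0|r0].
    have Nj : (N <= j)%N by lia.
    have := kernel_entry_bottom a_gt0 Hg Hg' truncation_bounds r'n nM jM Nj.
    by rewrite r0 mul0r subr0.
  have <- := kernel_entry_interior a_gt0 Hg Hg' truncation_bounds r'n nM jM j r0.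
  by rewrite mul1r opprD addrA.
rewrite xpair_eqE; case: eqP => [jj|]; last by rewrite mulr0.
case: eqP => [rr|]; last by rewrite mulr0.
rewrite mulr1 /th -jj -rr.
have -> : - (2 * (j%:Z + r%:Z)) + (j%:Z - r%:Z + j%:Z - r%:Z) = - (4 * r)%N%:Z by lia.
by rewrite -exprnN exprM (exprM _ 2 2) sqr_i sqrrN !expr1n invr1.
Qed.

Lemma inverse_matrix :
  is_inverse_matrix (black_AD n m) (white_AD n m) (Kasteleyn a) inverse_entry.
Proof.
have ub := uniq_black_coords n N; have uw := uniq_white_coords n N.
have KL : {in black_coords n N &, forall q q',
    \sum_(p <- white_coords n N) Kasteleyn a (black_vertex q) (white_vertex p) *
      inverse_entry (white_vertex p) (black_vertex q') = (q == q')%:R}.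
  by move=> q q'; exact: right_inverse.
have LK := left_inverse_of_right (K := fun q p => Kasteleyn a (black_vertex q) (white_vertex p))
  (L := fun p q => inverse_entry (white_vertex p) (black_vertex q)) (size_coords n N) ub KL.
rewrite black_ADE white_ADE; split.
- move=> _ _ /mapP[q qB ->] /mapP[q' q'B ->].
  rewrite (fsbig_map_vertex _ white_vertex_inj uw) KL //.
  by rewrite (inj_eq black_vertex_inj).
- move=> _ _ /mapP[p pW ->] /mapP[p' p'W ->].
  rewrite (fsbig_map_vertex _ black_vertex_inj ub) LK //.
  by rewrite (inj_eq white_vertex_inj).
Qed.

End InverseKasteleyn.

Theorem theorem2p3 (R : realType) (n rho m : nat) (a : R) (g g' : R -> R[i])
    (n_ge1 : (1 <= n)%N) (rho_ge1 : (1 <= rho)%N) (rho_le_n : (rho <= n)%N)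
    (n_rho : (n - rho = 2 * m)%N) (a_gt0 : 0 < a)
    (Hg : is_Gamma0 a g) (Hg' : is_Gamma0u a g g') :
  exists2 Kinv : vertex -> vertex -> R[i],
    is_inverse_matrix (black_AD n m) (white_AD n m) (Kasteleyn a) Kinv &
    forall w b : vertex, white_AD n m w -> black_AD n m b ->
      Kinv w b =
        - m1pow ((w.1 - w.2 + b.1 - b.2 + 2)%:~R / 4) *
        KK n m a g g'
          (b.2 + 1) ((b.2 - b.1 + 2 * m%:Z + 1) %/ 2)%Z
          (w.2 + 1) ((w.2 - w.1 + 2 * m%:Z + 1) %/ 2)%Z.
Proof.
exists (inverse_entry n m a g g') => //.
exact: (inverse_matrix n_ge1 rho_ge1 rho_le_n n_rho a_gt0 Hg Hg').
Qed.
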